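(* The following formal identity holds (in infinitely many variables $x_1,x_2,\dots$): $$\sum_{\mu,\nu}P_{\mu\cup\nu}(x;t)\,t^{\langle\mu+\nu,\rho\rangle-\frac12\langle\mu\cup\nu,\rho\rangle}\,\frac{b_{\mu\cup\nu}(t)}{b_\mu(t)b_\nu(t)}=\prod_{j<k}\frac{1-tx_jx_k}{1-x_jx_k}\prod_j\frac{1+\sqrt t\,x_j}{1-\sqrt t\,x_j},$$ where the sum is over all ordered pairs of partitions $(\mu,\nu)$ and $\rho=(1,3,5,\dots)$.
   Context: $P_\lambda(x;t)$ denotes the Hall–Littlewood symmetric function. For partitions $\mu,\nu$, $\mu\cup\nu$ is the partition whose parts are those of $\mu$ and $\nu$ together, arranged in decreasing order; $\mu+\nu$ is the componentwise sum. $\langle\lambda,\rho\rangle=\sum_i\lambda_i\rho_i$. With $m_i(\lambda)$ the number of parts of $\lambda$ equal to $i$ and $\phi_m(t)=\prod_{i=1}^m(1-t^i)$, $b_\lambda(t)=\prod_{i\ge1}\phi_{m_i(\lambda)}(t)$. *)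

(* Defs.v *)
From HB Require Import structures.
From mathcomp Require Import all_boot all_order all_algebra all_fingroup.
From mathcomp Require Import mpoly.
Set Implicit Arguments. Unset Strict Implicit. Unset Printing Implicit Defensive.
Import Order.TTheory GRing.Theory Num.Theory.
Local Open Scope ring_scope.

Definition K : fieldType := {fraction {poly rat}}.
Definition sq : K := tofrac ('X : {poly rat}).
Definition tt : K := sq ^+ 2.

Definition is_partition (l : seq nat) : bool :=
  sorted geq l && all (fun x => 0 < x)%N l.

Definition punion (mu nu : seq nat) : seq nat := sort geq (mu ++ nu).
Definition padd (mu nu : seq nat) : seq nat :=
  mkseq (fun i => nth 0 mu i + nth 0 nu i)%N (maxn (size mu) (size nu)).
(* rho = (1,3,5,...); rho_(i+1) = 2i+1 with 0-based index i *)
Definition rho (i : nat) : nat := (2 * i).+1.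
Definition ip_rho (l : seq nat) : nat := (\sum_(i < size l) nth 0 l i * rho i)%N.

Definition mult (i : nat) (l : seq nat) : nat := count_mem i l.
Definition phi (m : nat) : K := \prod_(1 <= i < m.+1) (1 - tt ^+ i).
(* b_lambda(t) = prod_{i>=1} phi_{m_i(lambda)}(t)  (parts are <= |lambda|) *)
Definition blam (l : seq nat) : K := \prod_(1 <= i < (sumn l).+1) phi (mult i l).

(* The coefficient t^{<mu+nu,rho> - 1/2 <mu u nu, rho>} b_{mu u nu}/(b_mu b_nu),
   with t^{a - b/2} = sq^(2a - b), sq = sqrt t. *)
Definition coef (mu nu : seq nat) : K :=
  sq ^ (2 * (ip_rho (padd mu nu))%:Z - (ip_rho (punion mu nu))%:Z)
  * (blam (punion mu nu) / (blam mu * blam nu)).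

(* ---------- Hall-Littlewood polynomials in n variables (Macdonald III.2.2) ---------- *)
Definition vm (m : nat) : K := \prod_(1 <= i < m.+1) ((1 - tt ^+ i) / (1 - tt)).
(* v_lambda(t) = prod_{i>=0} v_{m_i}(t), with m_0 = n - l(lambda) *)
Definition vlam (n : nat) (l : seq nat) : K :=
  vm (n - size l) * \prod_(1 <= i < (sumn l).+1) vm (mult i l).

Definition Fx (n : nat) := {fraction {mpoly K[n]}}.
Definition xv (n : nat) (i : 'I_n) : Fx n := tofrac ('X_i : {mpoly K[n]}).
Definition cst (n : nat) (c : K) : Fx n := tofrac (c%:MP : {mpoly K[n]}).

Definition HL (n : nat) (l : seq nat) : Fx n :=
  if (n < size l)%N then 0 else
  (cst n (vlam n l))^-1 *
  \sum_(w : 'S_n)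
     ((\prod_(i < n) xv (w i) ^+ nth 0 l i) *
      \prod_(i < n) \prod_(j < n | (i < j)%N)
         ((xv (w i) - cst n tt * xv (w j)) / (xv (w i) - xv (w j)))).

Fixpoint bseqs (k B : nat) : seq (seq nat) :=
  match k with
  | 0 => [:: [::]]
  | k'.+1 => [::] :: [seq x :: r | x <- iota 1 B, r <- bseqs k' B]
  end.
Definition partitions_upto (D : nat) : seq (seq nat) :=
  undup [seq l <- bseqs D D | is_partition l && (sumn l <= D)%N].

(* ---------- formal power series in x_1..x_n, via truncations ---------- *)
Definition mtrunc (n D : nat) (p : {mpoly K[n]}) : {mpoly K[n]} :=
  \sum_(m <- msupp p | (mdeg m <= D)%N) p@_m *: 'X_[m].
(* 1/(1-q) truncated: 1 + q + ... + q^D *)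
Definition geom (n D : nat) (q : {mpoly K[n]}) : {mpoly K[n]} :=
  \sum_(k < D.+1) q ^+ k.

(* Main.v *)
From mathcomp Require Import boolp functions ring zify.
Require Import Defs.
From HB Require Import structures.
From mathcomp Require Import all_boot all_order all_algebra all_fingroup.
From mathcomp Require Import mpoly.
Set Implicit Arguments. Unset Strict Implicit. Unset Printing Implicit Defensive.
Import Order.TTheory GRing.Theory Num.Theory.
Local Open Scope ring_scope.

(** Write s = sqrt t and let z mark l(mu) - l(nu).  Removing the first column of
    lambda expresses a Hall-Littlewood polynomial as a sum over subsets K of the
    set J of variables in use, with weights
      A(K, J \ K) = prod_(i in K, j in J \ K) (x_i - t x_j) / (x_i - x_j),
    and it multiplies the coefficient of the identity by s^(D^2) [m, k]_t, where
    D is the difference of the first columns of mu and nu.  Hence the left side is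
    the value at z = 1 of a sum over chains of subsets, in which a column
    contributes the Rogers-Szego polynomial sum_k [m, k]_t z^(2k - m) followed by
    the operator z^D |-> s^(D^2) z^D.

    The identity follows by adding the variables one at a time: if S(J) denotes
    the left side in the variables J, one needs
      (1 - s y) S(J + y) = (1 + s y) prod_(j in J) (1 - t x_j y)/(1 - x_j y) S(J).
    A branching rule (left) and a Pieri rule (right) turn both sides into sums over
    chains of subsets of J, of pairs of Laurent polynomials (L0, L1) and (R0, R1)
    that obey explicit recursions.  A system of linear relations among L0, L1, R0,
    R1 and two auxiliary even Laurent polynomials phi, chi is preserved by the
    recursions; it contains L0 + L1 - R0 - R1 = (z + 1/z - 2) chi, which vanishes
    at z = 1.

    To start from states satisfying the relations one must modify the empty chain;
    after N columns the modification is divisible by the N-th power of a variable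
    u that scales all the x_i, so the identity holds modulo u^N for every N. *)

(** * Laurent polynomials and the relations preserved by one column *)

(** The operator z^D |-> s^(D^2) z^D does not act on values at z = 1, so an identity true only at z
    = 1 cannot be carried from one column to the next. This is why the relations concern Laurent
    polynomials, and why more of them are needed than the one wanted: the difference of the two
    sides must stay divisible by (z - 1)(1 - 1/z), and this divisibility is recovered after every
    column from the symmetry z -> 1/z. The two components of a state tell whether the horizontal
    strip between two partitions has a box in the current column, which turns branching and Pieri
    rules into recursions on pairs. Both recursions weight the subsets identically, so they can be
    compared summand by summand, in terms of y alone. With finitely many columns the recurrence has
    an error term. The denominators x_i - x_j are not invertible as power series in the x_i; after
    scaling by u the weights become constants, and the error is measured by divisibility by a power
    of u. *)

(* The value of [f] at [D] is the coefficient of z^D.  Finite support is a separate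
   hypothesis, which makes every operator below total. *)
Definition laurent (F : fieldType) : Type := int -> F.
HB.instance Definition _ (F : fieldType) :=
  GRing.Zmodule.copy (laurent F) (int -> F).
Definition lscale (F : fieldType) (c : F) (f : laurent F) : laurent F :=
  fun D => c * f D.
Lemma lscaleA (F : fieldType) (c d : F) (f : laurent F) :
  lscale c (lscale d f) = lscale (c * d) f.
Proof. by apply: funext => D; rewrite /lscale mulrA. Qed.
Lemma lscale1 (F : fieldType) : left_id 1 (@lscale F).
Proof. by move=> f; apply: funext => D; rewrite /lscale mul1r. Qed.
Lemma lscaleDr (F : fieldType) : right_distributive (@lscale F) +%R.
Proof. by move=> c f g; apply: funext => D; rewrite /lscale mulrDr. Qed.
Lemma lscaleDl (F : fieldType) (f : laurent F) :
  {morph (@lscale F)^~ f : c d / c + d}.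
Proof. by move=> c d; apply: funext => D; rewrite /lscale mulrDl. Qed.
HB.instance Definition _ (F : fieldType) :=
  GRing.Zmodule_isLmodule.Build F (laurent F)
    (@lscaleA F) (@lscale1 F) (@lscaleDr F) (@lscaleDl F).

Section Laurent.
Variable F : fieldType.
Variable s : F.
Local Notation t := (s ^+ 2).
Local Notation V := (laurent F).

Definition zshift (f : V) : V := fun D => f (D - 1).
Definition zshiftV (f : V) : V := fun D => f (D + 1).
Definition zscale (f : V) : V := fun D => t ^ D * f D.
Definition zscaleV (f : V) : V := fun D => t ^ (- D) * f D.
Definition gauss (f : V) : V := fun D => s ^ (D * D) * f D.
Local Notation Z := zshift.
Local Notation Z' := zshiftV.
Local Notation T := zscale.
Local Notation T' := zscaleV.
Local Notation G := gauss.
Definition zsum (f : V) : V := Z f + Z' f.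
Local Notation W := zsum.

Lemma ptD (f g : V) D : (f + g) D = f D + g D. Proof. by []. Qed.
Lemma ptN (f : V) D : (- f) D = - f D. Proof. by []. Qed.
Lemma ptZ (c : F) (f : V) D : (c *: f) D = c * f D. Proof. by []. Qed.
Lemma pt0 D : (0 : V) D = 0. Proof. by []. Qed.
Lemma ptsh (f : V) D : Z f D = f (D - 1). Proof. by []. Qed.
Lemma ptshV (f : V) D : Z' f D = f (D + 1). Proof. by []. Qed.
Lemma ptsc (f : V) D : T f D = t ^ D * f D. Proof. by []. Qed.
Lemma ptscV (f : V) D : T' f D = t ^ (- D) * f D. Proof. by []. Qed.
Lemma ptW (f : V) D : W f D = f (D - 1) + f (D + 1). Proof. by []. Qed.
Lemma ptG (f : V) D : G f D = s ^ (D * D) * f D. Proof. by []. Qed.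

Lemma lin_zshift : linear Z. Proof. by move=> c f g; apply: funext. Qed.
Lemma lin_zshiftV : linear Z'. Proof. by move=> c f g; apply: funext. Qed.
Lemma lin_zscale : linear T.
Proof. by move=> c f g; apply: funext => D; rewrite ptsc !ptD !ptZ !ptsc; ring. Qed.
Lemma lin_zscaleV : linear T'.
Proof. by move=> c f g; apply: funext => D; rewrite ptscV !ptD !ptZ !ptscV; ring. Qed.
Lemma lin_gauss : linear G.
Proof. by move=> c f g; apply: funext => D; rewrite ptG !ptD !ptZ !ptG; ring. Qed.
HB.instance Definition _ := GRing.isLinear.Build F V V _ Z lin_zshift.
HB.instance Definition _ := GRing.isLinear.Build F V V _ Z' lin_zshiftV.
HB.instance Definition _ := GRing.isLinear.Build F V V _ T lin_zscale.
HB.instance Definition _ := GRing.isLinear.Build F V V _ T' lin_zscaleV.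
HB.instance Definition _ := GRing.isLinear.Build F V V _ G lin_gauss.

Lemma addK1 (D : int) : D + 1 - 1 = D. Proof. by rewrite addrK. Qed.
Lemma subK1 (D : int) : D - 1 + 1 = D. Proof. by rewrite subrK. Qed.

Definition fin_supp (f : V) := exists M : nat, forall D : int, (M < `|D|)%N -> f D = 0.
Definition even (f : V) := forall D, f (- D) = f D.
Definition nice (f : V) := even f /\ fin_supp f.

Lemma fin_supp0 : fin_supp 0. Proof. by exists 0%N. Qed.
Lemma fin_suppD f g : fin_supp f -> fin_supp g -> fin_supp (f + g).
Proof.
move=> [M hM] [N hN]; exists (maxn M N) => D hD.
by rewrite ptD hM ?hN ?addr0 //; apply: leq_ltn_trans hD; rewrite ?leq_maxl ?leq_maxr.
Qed.
Lemma fin_suppZ c f : fin_supp f -> fin_supp (c *: f).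
Proof. by move=> [M hM]; exists M => D hD; rewrite ptZ hM ?mulr0. Qed.
Lemma fin_suppN f : fin_supp f -> fin_supp (- f).
Proof. by move=> h; rewrite -scaleN1r; apply: fin_suppZ. Qed.
Lemma fin_supp_zshift f : fin_supp f -> fin_supp (Z f).
Proof. by move=> [M hM]; exists M.+1 => D hD; rewrite ptsh hM //; lia. Qed.
Lemma fin_supp_zshiftV f : fin_supp f -> fin_supp (Z' f).
Proof. by move=> [M hM]; exists M.+1 => D hD; rewrite ptshV hM //; lia. Qed.
Lemma fin_supp_zsum f : fin_supp f -> fin_supp (W f).
Proof. by move=> h; apply: fin_suppD; [apply: fin_supp_zshift|apply: fin_supp_zshiftV]. Qed.
Lemma fin_supp_zscale f : fin_supp f -> fin_supp (T f).
Proof. by move=> [M hM]; exists M => D hD; rewrite ptsc hM ?mulr0. Qed.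
Lemma fin_supp_zscaleV f : fin_supp f -> fin_supp (T' f).
Proof. by move=> [M hM]; exists M => D hD; rewrite ptscV hM ?mulr0. Qed.
Lemma fin_supp_gauss f : fin_supp f -> fin_supp (G f).
Proof. by move=> [M hM]; exists M => D hD; rewrite ptG hM ?mulr0. Qed.

Lemma even0 : even 0. Proof. by []. Qed.
Lemma evenD f g : even f -> even g -> even (f + g).
Proof. by move=> hf hg D; rewrite !ptD hf hg. Qed.
Lemma evenZ c f : even f -> even (c *: f).
Proof. by move=> hf D; rewrite !ptZ hf. Qed.
Lemma evenN f : even f -> even (- f).
Proof. by move=> hf D; rewrite !ptN hf. Qed.
Lemma even_zsum f : even f -> even (W f).
Proof.
move=> hf D; rewrite !ptW addrC; congr (_ + _).
  by rewrite -hf opprD opprK.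
by rewrite -hf opprB opprK addrC.
Qed.
Lemma even_gauss f : even f -> even (G f).
Proof. by move=> hf D; rewrite !ptG hf mulrNN. Qed.

Lemma nice0 : nice 0. Proof. by split; [exact: even0|exact: fin_supp0]. Qed.
Lemma niceD f g : nice f -> nice g -> nice (f + g).
Proof. by move=> [? ?] [? ?]; split; [apply: evenD|apply: fin_suppD]. Qed.
Lemma niceZ c f : nice f -> nice (c *: f).
Proof. by move=> [? ?]; split; [apply: evenZ|apply: fin_suppZ]. Qed.
Lemma niceN f : nice f -> nice (- f).
Proof. by move=> [? ?]; split; [apply: evenN|apply: fin_suppN]. Qed.
Lemma nice_zsum f : nice f -> nice (W f).
Proof. by move=> [? ?]; split; [apply: even_zsum|apply: fin_supp_zsum]. Qed.
Lemma nice_gauss f : nice f -> nice (G f).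
Proof. by move=> [? ?]; split; [apply: even_gauss|apply: fin_supp_gauss]. Qed.

Lemma shift_inv_fin_supp (f : V) :
  fin_supp f -> (forall D, f D = f (D - 1)) -> forall D, f D = 0.
Proof.
move=> [M hM] h D.
have hn (n : nat) : f (D + n%:Z) = f D.
  elim: n => [|n IH]; first by rewrite addr0.
  by rewrite h -IH; congr f; lia.
by rewrite -(hn (`|D|%N + M.+1)%N) hM //; lia.
Qed.

(* If f is finitely supported, f(z) - z^-1 f(z^-1) is divisible by
   1 - z^-1, with an even quotient. *)
Lemma even_quotient (f : V) : fin_supp f ->
  exists chi, nice chi /\ forall D, chi D - chi (D + 1) = f D - f (- (D + 1)).
Proof.
move=> [M hM].
pose mu (D : int) := f D - f (- (D + 1)).
have muN D : mu (- 1 - D) = - mu D.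
  by rewrite /mu opprB; congr (f _ - f _); lia.
have mu0 (D : int) : (M.+1 < `|D|)%N -> mu D = 0.
  by move=> hD; rewrite /mu !hM ?subrr //; lia.
(* The coefficient of the quotient at D is the full tail of [mu] from |D| on: [mu] vanishes beyond
   [M.+1], so [M.+2] terms suffice. The antisymmetry [muN] settles negative D and is what makes the
   quotient even. *)
pose tail (n : nat) := \sum_(k < M.+2) mu (n + k)%:Z.
have tailS n : tail n - tail n.+1 = mu n.
  rewrite /tail big_ord_recl addn0.
  rewrite [X in _ - X]big_ord_recr.
  have -> : mu (n.+1 + @ord_max M.+1)%N%:Z = 0 by apply: mu0 => /=; lia.
  rewrite [X in _ - (X + _)](eq_bigr (fun k : 'I_M.+1 => mu (n + bump 0 k)%N%:Z)).
    by rewrite addr0 addrK.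
  by move=> k _; congr (mu _%:Z); rewrite /bump /=; lia.
exists (fun D => tail `|D|%N); split; first split.
- by move=> D; rewrite abszN.
- exists M.+2 => D hD; rewrite /tail big1 // => k _; apply: mu0; lia.
move=> D; change (tail `|D|%N - tail `|(D + 1)%R|%N = mu D).
case: (lerP 0 D) => hD.
  have -> : `|(D + 1)%R|%N = `|D|%N.+1 by lia.
  by rewrite tailS; congr mu; lia.
have -> : `|D|%N = `|(D + 1)%R|%N.+1 by lia.
by rewrite -opprB tailS -muN; congr mu; lia.
Qed.

Hypothesis s0 : s != 0.
Hypothesis two0 : 2%:R != 0 :> F.

Lemma sqr_neq0 : t != 0. Proof. by rewrite expf_neq0. Qed.
Lemma tDS D : t ^ (D + 1) = t ^ D * t. Proof. by rewrite expfzDr ?sqr_neq0// expr1z. Qed.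
Lemma tDP D : t ^ (D - 1) = t ^ D / t. Proof. by rewrite expfzDr ?sqr_neq0. Qed.
Lemma tDN D : t ^ (- D) = (t ^ D)^-1. Proof. by rewrite invr_expz. Qed.
Lemma sqr_exp_neq0 D : t ^ D != 0. Proof. by rewrite expfz_neq0 ?sqr_neq0. Qed.
Lemma s2D D : s ^ (D * 2) = t ^ D.
Proof. by rewrite mulrC -exprz_exp. Qed.
Lemma sqS D : s ^ ((D + 1) * (D + 1)) = s ^ (D * D) * (s * t ^ D).
Proof.
have -> : (D + 1) * (D + 1) = D * D + (1 + D * 2) by ring.
by rewrite !expfzDr// s2D expr1z.
Qed.
Lemma sqP D : s ^ ((D - 1) * (D - 1)) = s ^ (D * D) * (s / t ^ D).
Proof.
have -> : (D - 1) * (D - 1) = D * D + (1 + - D * 2) by ring.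
by rewrite !expfzDr// s2D expr1z tDN.
Qed.

Lemma eq_sub0 (u v : F) : u = v -> u - v = 0.
Proof. by move=> ->; rewrite subrr. Qed.
(* Peels a multiple of a known relation off a goal; [field] closes what is left. *)
Lemma add_relation (c : F) (u v x : F) : x = 0 -> u = v + c * x -> u = v.
Proof. by move=> ->; rewrite mulr0 addr0. Qed.
Arguments add_relation c [u v x].

(* [invS] is the relation that is wanted; the others and the witnesses [phi], [chi]
   were found by closing it under the recursion. *)
Record invariants (y : F) (L0 L1 R0 R1 phi chi : V) : Prop := Invariants {
  inv_nice_L0 : nice L0; inv_nice_L1 : nice L1;
  inv_nice_R0 : nice R0; inv_nice_R1 : nice R1;
  inv_nice_phi : nice phi; inv_nice_chi : nice chi;
  invX : L0 - R0 + y *: (L1 - R1) + W (y *: L0 - R1)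
         = s^-1 *: W phi - T phi - T' phi;
  invY : L1 + R1 - y *: (L0 + R0)
         = Z (T phi) + Z' (T' phi) - (2%:R / s) *: phi;
  invS : L0 + L1 - R0 - R1 = W chi - 2%:R *: chi;
  invP : L0 - R0 - W R1 + (y ^+ 2) *: (L1 - R1 + W L0)
         = - (s * y / 2%:R) *: (T (L0 + R0 - L1 - R1 + Z chi - Z' chi)
                                + T' (L0 + R0 - L1 - R1 - Z chi + Z' chi));
  invQ : L1 + R1 - (y ^+ 2) *: (L0 + R0)
         = (s * y / 2%:R) *: (Z (T (L0 + R0 - L1 - R1 + Z chi - Z' chi))
                                + Z' (T' (L0 + R0 - L1 - R1 - Z chi + Z' chi)))
}.

Definition pointwiseE := (ptD, ptN, ptZ, ptsh, ptshV, ptsc, ptscV, ptW, ptG).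

(** * Propagation of the relations through one column *)

Section Step.
Variable y : F.
(* [b] is multiplication by a Rogers-Szego polynomial h_m and [a] is multiplication
   by (1 - t^m) h_(m-1), so that [W b - a] is multiplication by h_(m+1). *)
Variables a b : {linear V -> V}.
Hypothesis aZ : forall f, a (Z f) = Z (a f).
Hypothesis aZ' : forall f, a (Z' f) = Z' (a f).
Hypothesis bZ : forall f, b (Z f) = Z (b f).
Hypothesis bZ' : forall f, b (Z' f) = Z' (b f).
Hypothesis abT : forall f, T (b f - Z' (a f)) = b (T f) - Z (a (T f)).
Hypothesis a_nice : forall f, nice f -> nice (a f).
Hypothesis b_nice : forall f, nice f -> nice (b f).
Hypothesis a_fs : forall f, fin_supp f -> fin_supp (a f).
Hypothesis b_fs : forall f, fin_supp f -> fin_supp (b f).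

Lemma bW f : b (W f) = W (b f). Proof. by rewrite linearD bZ bZ'. Qed.
Lemma aW f : a (W f) = W (a f). Proof. by rewrite linearD aZ aZ'. Qed.

Lemma zscaleVK f : T (T' f) = f.
Proof.
by apply: funext => D; rewrite ptsc ptscV tDN; field; rewrite sqr_exp_neq0.
Qed.
Lemma zscaleK f : T' (T f) = f.
Proof.
by apply: funext => D; rewrite ptscV ptsc tDN; field; rewrite sqr_exp_neq0.
Qed.

Lemma abT' f : T' (b f - Z (a f)) = b (T' f) - Z' (a (T' f)).
Proof. by have := abT (T' f); rewrite !zscaleVK => <-; rewrite zscaleK. Qed.

Variables L0 L1 R0 R1 phi chi : V.
Hypothesis H : invariants y L0 L1 R0 R1 phi chi.

Definition step0 (f g : V) := G (b f + a g).
Definition step1 (f g : V) := G (W (b f) - a f + b g).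
Definition next_L0 := step0 L0 L1.
Definition next_L1 := y *: step1 L0 L1.
Definition next_R0 := G (b R0 + (W (b R1) - a R1)).
Definition next_R1 := y *: G (a R0 + b R1).
Definition skew := L0 + R0 - L1 - R1.
Definition next_phi := G ((y * s / 2%:R) *: (b skew + W (b chi) - 2%:R *: a chi)).

Definition commuteE := (linearD b, linearB b, linearN b, linearZ_LR b, bZ, bZ', bW,
   linearD a, linearB a, linearN a, linearZ_LR a, aZ, aZ', aW).

Lemma pointwise_b (u v : V) : u = v -> forall D, b u D - b v D = 0.
Proof. by move=> -> D; rewrite subrr. Qed.
Lemma pointwise_a (u v : V) : u = v -> forall D, a u D - a v D = 0.
Proof. by move=> -> D; rewrite subrr. Qed.
Lemma pointwise (u v : V) : u = v -> forall D, u D - v D = 0.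
Proof. by move=> -> D; rewrite subrr. Qed.

Definition powE := (sqS, sqP, tDS, tDP, tDN).

(** Here and in the next steps the goal is read at the coefficient of z^D. Shifted Gaussian factors
    reduce to g = s^(D^2) and q = t^D, and the multipliers given to [add_relation] write the goal as
    a linear combination of the [b]- and [a]-images of the old relations at neighbouring
    exponents. *)
Lemma stepY :
  next_L1 + next_R1 - y *: (next_L0 + next_R0)
         = Z (T next_phi) + Z' (T' next_phi) - (2%:R / s) *: next_phi.
Proof.
apply: funext => D.
have e1 := pointwise_b (invS H) (D - 1).
have e2 := pointwise_b (invS H) (D + 1).
have e3 := pointwise_a (invS H) D.
rewrite /next_L0 /next_L1 /next_R0 /next_R1 /next_phi /step0 /step1 /skew.
rewrite !commuteE in e1 e2 e3 *.
rewrite !pointwiseE in e1 e2 e3 *.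
rewrite !(addK1, subK1) in e1 e2 e3 *.
rewrite !powE.
set g := s ^ (D * D); set q := t ^ D.
have q0 : q != 0 := sqr_exp_neq0 D.
apply: (add_relation (g * y / 2%:R) e1).
apply: (add_relation (g * y / 2%:R) e2).
apply: (add_relation (- (g * y)) e3).
field.
by rewrite ?s0 ?q0 ?two0.
Qed.

Lemma abTb f D : t ^ D * (b f D - a f (D + 1)) - (b (T f) D - a (T f) (D - 1)) = 0.
Proof. by have := pointwise (abT f) D; rewrite !pointwiseE. Qed.
Lemma abTb' f D :
  (t ^ D)^-1 * (b f D - a f (D - 1)) - (b (T' f) D - a (T' f) (D + 1)) = 0.
Proof. by have := pointwise (abT' f) D; rewrite !pointwiseE tDN. Qed.

(** Moving a shift past [G] creates factors t^D and t^(-D), which multiply (b - a/z) and (b - z a)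
    applied to the two twisted combinations of [invP]. The commutation rule [abT] brings [T] and
    [T'] inside, where the [b]-image of [invP] and the [a]-image of [invQ] cancel them. *)
Lemma stepX :
  next_L0 - next_R0 + y *: (next_L1 - next_R1) + W (y *: next_L0 - next_R1)
         = s^-1 *: W next_phi - T next_phi - T' next_phi.
Proof.
apply: funext => D.
have e1 := pointwise_b (invS H) (D - 1).
have e2 := pointwise_b (invS H) (D + 1).
have e3 := pointwise_a (invS H) (D - 1).
have e4 := pointwise_a (invS H) (D + 1).
have e5 := pointwise_b (invP H) D.
have e6 := pointwise_a (invQ H) D.
have e7 := abTb (skew + Z chi - Z' chi) D.
have e8 := abTb' (skew - Z chi + Z' chi) D.
rewrite -/skew in e5 e6.
set twist := skew + _ - _ in e5 e6 e7.
set twist' := skew - _ + _ in e5 e6 e8.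
have bs2 E : b twist E = b L0 E + b R0 E - b L1 E - b R1 E + b chi (E - 1) - b chi (E + 1).
  by rewrite /twist /skew !commuteE !pointwiseE.
have as2 E : a twist E = a L0 E + a R0 E - a L1 E - a R1 E + a chi (E - 1) - a chi (E + 1).
  by rewrite /twist /skew !commuteE !pointwiseE.
have bs2' E : b twist' E = b L0 E + b R0 E - b L1 E - b R1 E - b chi (E - 1) + b chi (E + 1).
  by rewrite /twist' /skew !commuteE !pointwiseE.
have as2' E : a twist' E = a L0 E + a R0 E - a L1 E - a R1 E - a chi (E - 1) + a chi (E + 1).
  by rewrite /twist' /skew !commuteE !pointwiseE.
rewrite bs2 as2 in e7; rewrite bs2' as2' in e8.
clearbody twist twist'.
rewrite /next_L0 /next_L1 /next_R0 /next_R1 /next_phi /step0 /step1 /skew.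
rewrite !commuteE in e1 e2 e3 e4 e5 e6 *.
rewrite !pointwiseE in e1 e2 e3 e4 e5 e6 *.
rewrite !(addK1, subK1) in e1 e2 e3 e4 e5 e6 e7 e8 *.
rewrite !powE.
set g := s ^ (D * D); set q := t ^ D in e7 e8 *.
have q0 : q != 0 := sqr_exp_neq0 D.
apply: (add_relation g e5).
apply: (add_relation g e6).
apply: (add_relation (g * s * y / 2%:R) e7).
apply: (add_relation (g * s * y / 2%:R) e8).
apply: (add_relation (g * q * s * y / 2%:R) e2).
apply: (add_relation (g * q * s * y / 2%:R) e4).
apply: (add_relation (g / q * s * y / 2%:R) e1).
apply: (add_relation (g / q * s * y / 2%:R) e3).
field.
by rewrite ?s0 ?q0 ?two0.
Qed.

(** The next L0 + L1 - R0 - R1 equals (z - 1) [defect] + (1/z - 1) [defect'], and [defect'] is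
    [defect] with z inverted. By [abT] each has a second form in which the scaling comes after the
    multiplication; the steps below switch between the forms. *)
Definition defect := G (b (T phi) - Z (a (T phi))).
Definition defect' := G (b (T' phi) - Z' (a (T' phi))).

Lemma defectE1 D : defect D = s ^ (D * D) * (b (T phi) D - a (T phi) (D - 1)).
Proof. by []. Qed.
Lemma defectE2 D : defect D = s ^ (D * D) * (t ^ D * (b phi D - a phi (D + 1))).
Proof. by rewrite defectE1 (subr0_eq (abTb phi D)). Qed.
Lemma defect'E1 D : defect' D = s ^ (D * D) * (b (T' phi) D - a (T' phi) (D + 1)).
Proof. by []. Qed.
Lemma defect'E2 D : defect' D = s ^ (D * D) * ((t ^ D)^-1 * (b phi D - a phi (D - 1))).
Proof. by rewrite defect'E1 (subr0_eq (abTb' phi D)). Qed.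

Lemma defect'_opp D : defect' D = defect (- D).
Proof.
have [eb _] := b_nice (inv_nice_phi H); have [ea _] := a_nice (inv_nice_phi H).
rewrite defect'E2 defectE2 mulrNN tDN eb -(ea (- D + 1)).
by have -> : - (- D + 1) = D - 1 by ring.
Qed.

Lemma defect_fin_supp : fin_supp defect.
Proof.
have [_ h] := inv_nice_phi H.
by apply: fin_supp_gauss; apply: fin_suppD;
  [apply/b_fs/fin_supp_zscale|apply/fin_suppN/fin_supp_zshift/a_fs/fin_supp_zscale].
Qed.

Lemma stepS D : next_L0 D + next_L1 D - next_R0 D - next_R1 D =
  defect (D - 1) - defect D + defect' (D + 1) - defect' D.
Proof.
have e1 := pointwise_b (invX H) D.
have e2 := pointwise_a (invY H) D.
rewrite (defectE2 (D - 1)) (defectE1 D) (defect'E2 (D + 1)) (defect'E1 D).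
rewrite /next_L0 /next_L1 /next_R0 /next_R1 /step0 /step1.
rewrite !commuteE in e1 e2 *.
rewrite !pointwiseE in e1 e2 *.
rewrite !(addK1, subK1) in e1 e2 *.
rewrite !powE.
set g := s ^ (D * D); set q := t ^ D.
have q0 : q != 0 := sqr_exp_neq0 D.
apply: (add_relation g e1).
apply: (add_relation g e2).
field.
by rewrite ?s0 ?q0 ?two0.
Qed.

(** The equation reads (1 - 1/z) chi = [defect] - (1/z) [defect'], which [even_quotient] solves.
    Multiplied by z - 1 it yields the new [invS]; multiplied by z + 1 it yields (z - 1/z) chi, the
    combination in [invP] and [invQ]. *)
Variable next_chi : V.
Hypothesis next_chiE : forall D, next_chi D - next_chi (D + 1) = defect D - defect' (D + 1).

Lemma stepSchi : next_L0 + next_L1 - next_R0 - next_R1 = W next_chi - 2%:R *: next_chi.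
Proof.
apply: funext => D; rewrite !pointwiseE stepS.
have e1 := next_chiE D; have e2 := next_chiE (D - 1); rewrite !subK1 in e2.
apply: (add_relation 1 (eq_sub0 e1)).
apply: (add_relation (- 1) (eq_sub0 e2)).
ring.
Qed.

Definition next_skew := next_L0 + next_R0 - next_L1 - next_R1.
Lemma next_chi_diff D :
  next_chi (D - 1) - next_chi (D + 1) = defect (D - 1) - defect' D + defect D - defect' (D + 1).
Proof.
have e1 := next_chiE D; have e2 := next_chiE (D - 1); rewrite !subK1 in e2.
apply: (add_relation 1 (eq_sub0 e1)).
apply: (add_relation 1 (eq_sub0 e2)).
ring.
Qed.

Lemma next_twist D : (next_skew + Z next_chi - Z' next_chi) D
  = next_L0 D + next_R0 D - next_L1 D - next_R1 D + (defect (D - 1) - defect' D + defect D - defect' (D + 1)).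
Proof. by rewrite /next_skew !pointwiseE -next_chi_diff; ring. Qed.
Lemma next_twist' D : (next_skew - Z next_chi + Z' next_chi) D
  = next_L0 D + next_R0 D - next_L1 D - next_R1 D - (defect (D - 1) - defect' D + defect D - defect' (D + 1)).
Proof. by rewrite /next_skew !pointwiseE -next_chi_diff; ring. Qed.

Lemma stepQ : next_L1 + next_R1 - (y ^+ 2) *: (next_L0 + next_R0)
         = (s * y / 2%:R) *: (Z (T (next_L0 + next_R0 - next_L1 - next_R1 + Z next_chi - Z' next_chi))
                                + Z' (T' (next_L0 + next_R0 - next_L1 - next_R1 - Z next_chi + Z' next_chi))).
Proof.
rewrite -/next_skew; apply: funext => D.
rewrite [RHS]ptZ [X in _ * X]ptD ptsh ptshV ptsc ptscV next_twist next_twist'.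
have e1 := pointwise_b (invX H) (D - 1).
have e2 := pointwise_b (invX H) (D + 1).
have e3 := pointwise_b (invY H) D.
have e4 := pointwise_a (invX H) D.
have e5 := pointwise_a (invY H) (D - 1).
have e6 := pointwise_a (invY H) (D + 1).
rewrite !(addK1, subK1).
rewrite (defectE2 (D - 1 - 1)) (defect'E1 (D - 1)) (defectE1 (D - 1)) (defect'E2 D).
rewrite (defectE2 D) (defect'E1 (D + 1)) (defectE1 (D + 1)) (defect'E2 (D + 1 + 1)).
rewrite /next_L0 /next_L1 /next_R0 /next_R1 /step0 /step1.
rewrite !commuteE in e1 e2 e3 e4 e5 e6 *.
rewrite !pointwiseE in e1 e2 e3 e4 e5 e6 *.
rewrite !(addK1, subK1) in e1 e2 e3 e4 e5 e6 *.
rewrite !powE.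
set g := s ^ (D * D); set q := t ^ D.
have q0 : q != 0 := sqr_exp_neq0 D.
apply: (add_relation (g * y / 2%:R) e1).
apply: (add_relation (g * y / 2%:R) e2).
apply: (add_relation (g * y) e3).
apply: (add_relation (- (g * y)) e4).
apply: (add_relation (- (g * y / 2%:R)) e5).
apply: (add_relation (- (g * y / 2%:R)) e6).
field.
by rewrite ?s0 ?q0 ?two0.
Qed.

(** These are the combinations to which [abT] must be applied when the new [invP] is expanded. The
    old relations rewrite them through [twist], [twist'] and [phi], so that the old [invP] and
    [invQ] become applicable. *)
Definition cotwist := L0 + R0 - y *: (L1 + R1) + Z (R1 - y *: L0) - Z' (R1 - y *: L0)
  + T phi - s^-1 *: Z' phi.
Definition cotwist' := L0 + R0 - y *: (L1 + R1) - Z (R1 - y *: L0) + Z' (R1 - y *: L0)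
  + T' phi - s^-1 *: Z phi.
Definition twist := skew + Z chi - Z' chi.
Definition twist' := skew - Z chi + Z' chi.

Lemma fin_suppB f g : fin_supp f -> fin_supp g -> fin_supp (f - g).
Proof. by move=> hf hg; apply/fin_suppD/fin_suppN. Qed.

Let fsL0 := (inv_nice_L0 H).2.
Let fsL1 := (inv_nice_L1 H).2.
Let fsR0 := (inv_nice_R0 H).2.
Let fsR1 := (inv_nice_R1 H).2.
Let fsphi := (inv_nice_phi H).2.
Let fschi := (inv_nice_chi H).2.

Ltac fs := repeat first
  [ assumption | apply: fsL0 | apply: fsL1 | apply: fsR0 | apply: fsR1
  | apply: fsphi | apply: fschi
  | apply: fin_suppZ | apply: fin_supp_zshift | apply: fin_supp_zshiftV
  | apply: fin_supp_zscale | apply: fin_supp_zscaleV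
  | apply: fin_suppB | apply: fin_suppD | apply: fin_suppN ].

(* Both sides agree after multiplication by 1 - z, which is injective on Laurent polynomials. *)
Lemma cotwistE : cotwist = (1 + y) *: twist + T' phi + 2%:R *: Z' (T' phi)
   - s^-1 *: Z phi - (2%:R / s) *: phi.
Proof.
apply/subr0_eq/funext; apply: shift_inv_fin_supp.
  by rewrite /cotwist /twist /skew; fs.
move=> D; rewrite /cotwist /twist /skew.
have e1 := pointwise (invX H) D; have e2 := pointwise (invX H) (D - 1).
have e3 := pointwise (invY H) D.
have e4 := pointwise (invS H) D; have e5 := pointwise (invS H) (D - 1).
rewrite !pointwiseE in e1 e2 e3 e4 e5 *.
rewrite !(addK1, subK1) in e1 e2 e3 e4 e5 *.
rewrite !powE in e1 e2 e3 e4 e5 *.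
set q := t ^ D in e1 e2 e3 e4 e5 *.
have q0 : q != 0 := sqr_exp_neq0 D.
apply: (add_relation 1 e1).
apply: (add_relation 1 e2).
apply: (add_relation 2%:R e3).
apply: (add_relation (- (1 + y)) e4).
apply: (add_relation (- (1 + y)) e5).
field.
by rewrite ?s0 ?q0 ?two0.
Qed.

Lemma cotwist'E : cotwist' = (1 + y) *: twist' + T phi + 2%:R *: Z (T phi)
   - s^-1 *: Z' phi - (2%:R / s) *: phi.
Proof.
apply/subr0_eq/funext; apply: shift_inv_fin_supp.
  by rewrite /cotwist' /twist' /skew; fs.
move=> D; rewrite /cotwist' /twist' /skew.
have e1 := pointwise (invX H) D; have e2 := pointwise (invX H) (D - 1).
have e3 := pointwise (invY H) (D - 1).
have e4 := pointwise (invS H) D; have e5 := pointwise (invS H) (D - 1).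
rewrite !pointwiseE in e1 e2 e3 e4 e5 *.
rewrite !(addK1, subK1) in e1 e2 e3 e4 e5 *.
rewrite !powE in e1 e2 e3 e4 e5 *.
set q := t ^ D in e1 e2 e3 e4 e5 *.
have q0 : q != 0 := sqr_exp_neq0 D.
apply: (add_relation (- 1) e1).
apply: (add_relation (- 1) e2).
apply: (add_relation (- 2%:R) e3).
apply: (add_relation (1 + y) e4).
apply: (add_relation (1 + y) e5).
field.
by rewrite ?s0 ?q0 ?two0.
Qed.

Lemma stepP : next_L0 - next_R0 - W next_R1 + (y ^+ 2) *: (next_L1 - next_R1 + W next_L0)
  = - (s * y / 2%:R) *: (T (next_L0 + next_R0 - next_L1 - next_R1 + Z next_chi - Z' next_chi)
                         + T' (next_L0 + next_R0 - next_L1 - next_R1 - Z next_chi + Z' next_chi)).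
Proof.
rewrite -/next_skew; apply: funext => D.
rewrite [RHS]ptZ [X in _ * X]ptD ptsc ptscV next_twist next_twist'.
have e1 := pointwise_b (invP H) D.
have e2 := pointwise_b (invX H) D.
have e3 := pointwise_a (invQ H) D.
have e4 := pointwise_a (invY H) D.
have e5 := pointwise_a (invX H) (D + 1).
have e6 := pointwise_a (invX H) (D - 1).
have e7 := abTb cotwist D.
have e8 := abTb' cotwist' D.
have dT : T cotwist = (1 + y) *: T twist + phi + (2%:R / t) *: Z' phi
    - s *: Z (T phi) - (2%:R / s) *: T phi.
  apply: funext => E; rewrite cotwistE !pointwiseE !powE; field.
  by rewrite s0 sqr_exp_neq0.
have dT' : T' cotwist' = (1 + y) *: T' twist' + phi + (2%:R / t) *: Z phi
    - s *: Z' (T' phi) - (2%:R / s) *: T' phi.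
  apply: funext => E; rewrite cotwist'E !pointwiseE !powE; field.
  by rewrite s0 sqr_exp_neq0.
have e9 := pointwise_b dT D; have e10 := pointwise_a dT (D - 1).
have e11 := pointwise_b dT' D; have e12 := pointwise_a dT' (D + 1).
rewrite -/skew -/twist -/twist' in e1 e3.
clear dT dT'; move: twist twist' e1 e3 e9 e10 e11 e12 => w2 w2' e1 e3 e9 e10 e11 e12.
have bS2 E : b cotwist E = b L0 E + b R0 E - y * (b L1 E + b R1 E)
  + (b R1 (E - 1) - y * b L0 (E - 1)) - (b R1 (E + 1) - y * b L0 (E + 1))
  + b (T phi) E - s^-1 * b phi (E + 1) by rewrite /cotwist !commuteE !pointwiseE.
have aS2 E : a cotwist E = a L0 E + a R0 E - y * (a L1 E + a R1 E)
  + (a R1 (E - 1) - y * a L0 (E - 1)) - (a R1 (E + 1) - y * a L0 (E + 1))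
  + a (T phi) E - s^-1 * a phi (E + 1) by rewrite /cotwist !commuteE !pointwiseE.
have bS2' E : b cotwist' E = b L0 E + b R0 E - y * (b L1 E + b R1 E)
  - (b R1 (E - 1) - y * b L0 (E - 1)) + (b R1 (E + 1) - y * b L0 (E + 1))
  + b (T' phi) E - s^-1 * b phi (E - 1) by rewrite /cotwist' !commuteE !pointwiseE.
have aS2' E : a cotwist' E = a L0 E + a R0 E - y * (a L1 E + a R1 E)
  - (a R1 (E - 1) - y * a L0 (E - 1)) + (a R1 (E + 1) - y * a L0 (E + 1))
  + a (T' phi) E - s^-1 * a phi (E - 1) by rewrite /cotwist' !commuteE !pointwiseE.
rewrite bS2 aS2 in e7; rewrite bS2' aS2' in e8.
move: (T cotwist) (T' cotwist') e7 e8 e9 e10 e11 e12 => u u' e7 e8 e9 e10 e11 e12.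
rewrite {1}(defectE1 (D - 1)) {1}(defect'E2 D) {1}(defectE1 D) {1}(defect'E2 (D + 1)).
rewrite (defect'E1 (D + 1)) (defectE2 D) (defect'E1 D) (defectE2 (D - 1)).
rewrite /next_L0 /next_L1 /next_R0 /next_R1 /step0 /step1.
rewrite !commuteE in e1 e2 e3 e4 e5 e6 e9 e10 e11 e12 *.
rewrite !pointwiseE in e1 e2 e3 e4 e5 e6 e9 e10 e11 e12 *.
rewrite !(addK1, subK1) in e1 e2 e3 e4 e5 e6 e7 e8 e9 e10 e11 e12 *.
rewrite !powE.
set g := s ^ (D * D); set q := t ^ D in e7 e8 *.
have q0 : q != 0 := sqr_exp_neq0 D.
apply: (add_relation (g * (1 + y)) e1).
apply: (add_relation (- (g * y)) e2).
apply: (add_relation (g * (1 + y)) e3).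
apply: (add_relation (- (g * y)) e4).
apply: (add_relation (g * s * y / 2%:R * q) e4).
apply: (add_relation (g * s * y / 2%:R * q) e5).
apply: (add_relation (g * s * y / 2%:R / q) e4).
apply: (add_relation (g * s * y / 2%:R / q) e6).
apply: (add_relation (g * s * y / 2%:R) e7).
apply: (add_relation (g * s * y / 2%:R) e8).
apply: (add_relation (g * s * y / 2%:R) e9).
apply: (add_relation (g * s * y / 2%:R) e11).
apply: (add_relation (- (g * s * y / 2%:R)) e10).
apply: (add_relation (- (g * s * y / 2%:R)) e12).
field.
by rewrite ?s0 ?q0 ?two0.
Qed.

End Step.
End Laurent.
Arguments add_relation [F] c [u v x].

(** * Rogers-Szego polynomials *)

Section RogersSzego.
Variable F : fieldType.
Variable s : F.
Local Notation t := (s ^+ 2).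
Local Notation V := (laurent F).
Local Notation Z := (@zshift F).
Local Notation Z' := (@zshiftV F).
Local Notation T := (zscale s).
Local Notation G := (gauss s).
Local Notation W := (@zsum F).

Definition poch (m : nat) : F := \prod_(1 <= i < m.+1) (1 - t ^+ i).
Definition tbinom (m k : nat) : F :=
  if (k <= m)%N then poch m / (poch k * poch (m - k)) else 0.

Lemma poch0 : poch 0 = 1. Proof. by rewrite /poch big_geq. Qed.
Lemma pochS m : poch m.+1 = poch m * (1 - t ^+ m.+1).
Proof. by rewrite /poch big_nat_recr. Qed.
Hypothesis t_generic : forall i, (0 < i)%N -> 1 - t ^+ i != 0.
Lemma poch_neq0 m : poch m != 0.
Proof. by elim: m => [|m IH]; rewrite ?poch0 ?oner_neq0// pochS mulf_neq0 ?t_generic. Qed.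

Lemma tbinom_small m k : (m < k)%N -> tbinom m k = 0.
Proof. by move=> h; rewrite /tbinom leqNgt h. Qed.
Lemma tbinom0 m : tbinom m 0 = 1.
Proof. by rewrite /tbinom /= subn0 poch0 mul1r divff ?poch_neq0. Qed.

Lemma tbinom_absorb_r m k : (1 - t ^+ m.+1) * tbinom m k = (1 - t ^+ (m.+1 - k)) * tbinom m.+1 k.
Proof.
rewrite /tbinom; case: leqP => [km|mk].
  rewrite (leq_trans km) // subSn // !pochS; field.
  by rewrite !poch_neq0 t_generic.
rewrite mulr0; case: leqP => h; last by rewrite mulr0.
have -> : k = m.+1 by apply/eqP; rewrite eqn_leq h.
by rewrite subnn expr0 subrr mul0r.
Qed.
Lemma tbinom_absorb_l m k : (1 - t ^+ m.+1) * tbinom m k = (1 - t ^+ k.+1) * tbinom m.+1 k.+1.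
Proof.
rewrite /tbinom ltnS; case: leqP => [km|mk]; last by rewrite !mulr0.
rewrite subSS !pochS; field.
by rewrite !poch_neq0 t_generic.
Qed.
Lemma tbinom_pascal m k : tbinom m.+1 k.+1 = tbinom m k + t ^+ k.+1 * tbinom m k.+1.
Proof.
have tm : 1 - t ^+ m.+1 != 0 by rewrite t_generic.
apply: (mulfI tm); rewrite mulrDr tbinom_absorb_l mulrCA tbinom_absorb_r subSS.
case: (leqP k m) => km; last by rewrite tbinom_small // !mulr0 addr0.
have -> : t ^+ m.+1 = t ^+ k.+1 * t ^+ (m - k) by rewrite -exprD addSn subnKC.
ring.
Qed.

(* Multiplication by h_m = sum_k [m,k] z^(2k-m). *)
Definition rs (m : nat) (f : V) : V :=
  fun D => \sum_(k < m.+1) tbinom m k * f (D + m%:Z - 2 * k%:Z).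
Lemma lin_rs m : linear (rs m).
Proof.
move=> c f g; apply: funext => D; rewrite ptD ptZ /rs mulr_sumr -big_split /=.
by apply: eq_bigr => k _; rewrite ptD ptZ mulrDr mulrCA.
Qed.
HB.instance Definition _ m := GRing.isLinear.Build F V V _ (rs m) (lin_rs m).

Definition rsd (m : nat) (f : V) : V := (1 - t ^+ m) *: rs m.-1 f.
Lemma lin_rsd m : linear (rsd m).
Proof. by move=> c f g; rewrite /rsd linearP /= scalerDr !scalerA mulrC. Qed.
HB.instance Definition _ m := GRing.isLinear.Build F V V _ (rsd m) (lin_rsd m).

Lemma rs0 f : rs 0 f = f.
Proof. by apply: funext => D; rewrite /rs big_ord1 tbinom0 mul1r /=; congr f; lia. Qed.

Lemma rsZ m f : rs m (Z f) = Z (rs m f).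
Proof.
apply: funext => D; rewrite ptsh; apply: eq_bigr => k _; rewrite ptsh.
by congr (_ * f _); lia.
Qed.
Lemma rsZ' m f : rs m (Z' f) = Z' (rs m f).
Proof.
apply: funext => D; rewrite ptshV; apply: eq_bigr => k _; rewrite ptshV.
by congr (_ * f _); lia.
Qed.
Lemma rsdZ m f : rsd m (Z f) = Z (rsd m f).
Proof. by rewrite /rsd rsZ linearZ. Qed.
Lemma rsdZ' m f : rsd m (Z' f) = Z' (rsd m f).
Proof. by rewrite /rsd rsZ' linearZ. Qed.

(** Subtracting (1 - t^m) h_(m-1) / z from h_m weights its k-th term by t^(m-k); the mirror image
    below has weight t^k. The substitution z -> t z multiplies z^(2k-m) by t^(2k-m) and so carries
    one to the other, which is [rs_abT]. *)
Lemma rs_beta m f D : rs m f D - rsd m f (D + 1) =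
  \sum_(k < m.+1) t ^+ (m - k) * tbinom m k * f (D + m%:Z - 2 * k%:Z).
Proof.
rewrite /rsd ptZ; case: m => [|m].
  by rewrite expr0 subrr mul0r subr0; apply: eq_bigr => k _; rewrite mul1r.
rewrite /rs /= mulr_sumr big_ord_recr [RHS]big_ord_recr /= addrAC -sumrB subnn mul1r.
congr (_ + _); apply: eq_bigr => k _.
have -> : D + 1 + m%:Z - 2 * k%:Z = D + m.+1%:Z - 2 * k%:Z by lia.
by rewrite mulrA tbinom_absorb_r -mulrBl; congr (_ * _); ring.
Qed.
Lemma rs_beta' m f D : rs m f D - rsd m f (D - 1) =
  \sum_(k < m.+1) t ^+ k * tbinom m k * f (D + m%:Z - 2 * k%:Z).
Proof.
rewrite /rsd ptZ; case: m => [|m].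
  by rewrite expr0 subrr mul0r subr0; apply: eq_bigr => -[[|k]//= hk] _; rewrite expr0 mul1r.
rewrite /rs /= mulr_sumr big_ord_recl [RHS]big_ord_recl /= -addrA -sumrB mul1r.
congr (_ + _); apply: eq_bigr => k _; rewrite /bump /= add1n.
have -> : D - 1 + m%:Z - 2 * k%:Z = D + m.+1%:Z - 2 * k.+1%:Z by lia.
by rewrite mulrA tbinom_absorb_l -mulrBl; congr (_ * _); ring.
Qed.

(** The three-term recurrence of the Rogers-Szego polynomials. Once [rs_beta'] has absorbed the last
    term, it is the t-Pascal rule. *)
Lemma rs_recur m f : rs m.+1 f = W (rs m f) - rsd m f.
Proof.
apply: funext => D; rewrite ptD ptN ptW -addrA.
have := rs_beta' m f (D + 1); rewrite addrK => ->.
rewrite /rs big_ord_recl [in RHS]addrC [X in _ = X + _]big_ord_recl /=.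
rewrite !tbinom0 expr0 !mul1r -[RHS]addrA; congr (_ + _).
  by congr f; lia.
rewrite [X in _ = X + _](_ : _ = \sum_(k < m.+1) t ^+ k.+1 * tbinom m k.+1
    * f (D + m.+1%:Z - 2 * k.+1%:Z)).
  rewrite -big_split /=; apply: eq_bigr => k _; rewrite /bump /= add1n.
  rewrite tbinom_pascal mulrDl addrC; congr (_ * f _ + _ * f _); lia.
rewrite big_ord_recr /= [tbinom m m.+1]tbinom_small // mulr0 mul0r addr0.
apply: eq_bigr => k _; rewrite /bump /= add1n; congr (_ * f _); lia.
Qed.

Lemma rs_even m f : even f -> even (rs m f).
Proof.
move=> hf D; rewrite /rs (reindex_inj rev_ord_inj) /=; apply: eq_bigr => k _.
rewrite subSS -hf; congr (_ * f _); last by have := ltn_ord k; lia.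
rewrite /tbinom leq_subr -ltnS ltn_ord; have := ltn_ord k; rewrite ltnS => km.
by rewrite subKn // [poch k * _]mulrC.
Qed.
Lemma rs_fin_supp m f : fin_supp f -> fin_supp (rs m f).
Proof.
move=> [M hM]; exists (M + m)%N => D hD; rewrite /rs big1 // => k _.
by rewrite hM ?mulr0 //; have := ltn_ord k; lia.
Qed.
Lemma rs_nice m f : nice f -> nice (rs m f).
Proof. by move=> [? ?]; split; [apply: rs_even|apply: rs_fin_supp]. Qed.
Lemma rsd_fin_supp m f : fin_supp f -> fin_supp (rsd m f).
Proof. by move=> h; apply/fin_suppZ/rs_fin_supp. Qed.
Lemma rsd_nice m f : nice f -> nice (rsd m f).
Proof. by move=> h; apply/niceZ/rs_nice. Qed.

Hypothesis s0 : s != 0.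
Hypothesis two0 : 2%:R != 0 :> F.
Lemma rs_abT m f : T (rs m f - Z' (rsd m f)) = rs m (T f) - Z (rsd m (T f)).
Proof.
apply: funext => D; rewrite ptsc !ptD !ptN ptsh ptshV rs_beta rs_beta' mulr_sumr.
apply: eq_bigr => k _; rewrite ptsc !mulrA; congr (_ * _).
have := sqr_neq0 s0; move: (s ^+ 2) => q q0.
rewrite [RHS]mulrAC !exprnP -!expfzDr //.
congr (_ ^ _ * _); have := ltn_ord k; lia.
Qed.

Variable y : F.

(** All relations are linear, so for fixed y the balanced states form a vector space; hiding the
    witnesses lets them be summed over subsets. *)
Definition balanced (L0 L1 R0 R1 : V) :=
  exists phi chi, invariants s y L0 L1 R0 R1 phi chi.

Lemma balanced_step m L0 L1 R0 R1 : balanced L0 L1 R0 R1 ->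
  balanced (G (rs m L0 + rsd m L1)) (y *: G (rs m.+1 L0 + rs m L1))
           (G (rs m R0 + rs m.+1 R1)) (y *: G (rsd m R0 + rs m R1)).
Proof.
move=> [phi [chi H]].
have aN := @rsd_nice m; have bN := @rs_nice m.
have [next_chi [nchiN nchiE]] := even_quotient
  (defect_fin_supp (fun f => @rsd_fin_supp m f) (fun f => @rs_fin_supp m f) H).
have {}nchiE D : next_chi D - next_chi (D + 1) =
    defect s (rsd m) (rs m) phi D - defect' s (rsd m) (rs m) phi (D + 1).
  by rewrite nchiE (defect'_opp s0 (@rs_abT m) aN bN H).
exists (next_phi s y (rsd m) (rs m) L0 L1 R0 R1 chi), next_chi.
rewrite !rs_recur.
case: (H) => hL0 hL1 hR0 hR1 hphi hchi *.
have hDe : nice (L0 + R0 - L1 - R1).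
  by apply: niceD (niceN hR1); apply: niceD (niceN hL1); apply: niceD.
split.
- by apply/nice_gauss/niceD; [apply: bN|apply: aN].
- apply/niceZ/nice_gauss/niceD; last exact: bN.
  by apply: niceD; [apply/nice_zsum/bN|apply/niceN/aN].
- apply/nice_gauss/niceD; first exact: bN.
  by apply: niceD; [apply/nice_zsum/bN|apply/niceN/aN].
- by apply/niceZ/nice_gauss/niceD; [apply: aN|apply: bN].
- apply/nice_gauss/niceZ/niceD; last by apply/niceN/niceZ/aN.
  by apply: niceD; [apply: bN|apply/nice_zsum/bN].
- exact: nchiN.
- by apply: (stepX s0 two0 (@rsdZ m) (@rsdZ' m) (@rsZ m) (@rsZ' m) (@rs_abT m) H).
- by apply: (stepY s0 two0 (@rsdZ m) (@rsdZ' m) (@rsZ m) (@rsZ' m) H).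
- by apply: (stepSchi s0 (@rsdZ m) (@rsdZ' m) (@rsZ m) (@rsZ' m) (@rs_abT m) H nchiE).
- by apply: (stepP s0 two0 (@rsdZ m) (@rsdZ' m) (@rsZ m) (@rsZ' m) (@rs_abT m) H nchiE).
- by apply: (stepQ s0 two0 (@rsdZ m) (@rsdZ' m) (@rsZ m) (@rsZ' m) (@rs_abT m) H nchiE).
Qed.

Lemma balanced0 : balanced 0 0 0 0.
Proof.
exists 0, 0; split; try exact: nice0; apply: funext => D;
  rewrite !pointwiseE !pt0; ring.
Qed.
Lemma balancedZ c L0 L1 R0 R1 : balanced L0 L1 R0 R1 ->
  balanced (c *: L0) (c *: L1) (c *: R0) (c *: R1).
Proof.
move=> [phi [chi [? ? ? ? ? ? X Y S P Q]]]; exists (c *: phi), (c *: chi).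
split; try exact: niceZ; apply: funext => D;
  [move: X|move: Y|move: S|move: P|move: Q];
  move/(congr1 (fun f : V => c * f D)); rewrite !pointwiseE => e;
  apply: (add_relation 1 (eq_sub0 e)); ring.
Qed.
Lemma balancedD L0 L1 R0 R1 L0' L1' R0' R1' :
  balanced L0 L1 R0 R1 -> balanced L0' L1' R0' R1' ->
  balanced (L0 + L0') (L1 + L1') (R0 + R0') (R1 + R1').
Proof.
move=> [phi [chi [? ? ? ? ? ? X Y S P Q]]] [phi' [chi' [? ? ? ? ? ? X' Y' S' P' Q']]].
exists (phi + phi'), (chi + chi').
split; try exact: niceD; apply: funext => D;
  [move: X X'|move: Y Y'|move: S S'|move: P P'|move: Q Q'];
  move=> /(congr1 (@^~ D)) + /(congr1 (@^~ D)); rewrite !pointwiseE => e e';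
  apply: (add_relation 1 (eq_sub0 e)); apply: (add_relation 1 (eq_sub0 e')); ring.
Qed.
Lemma balanced_sum (J : Type) (r : seq J) (P : pred J) (l0 l1 r0 r1 : J -> V) :
  (forall j, P j -> balanced (l0 j) (l1 j) (r0 j) (r1 j)) ->
  balanced (\sum_(j <- r | P j) l0 j) (\sum_(j <- r | P j) l1 j)
           (\sum_(j <- r | P j) r0 j) (\sum_(j <- r | P j) r1 j).
Proof.
move=> h; elim: r => [|j r IH]; first by rewrite !big_nil; exact: balanced0.
by rewrite !big_cons; case: ifP => // Pj; apply: balancedD => //; apply: h.
Qed.

Definition delta0 : V := fun D => (D == 0)%:R.

Lemma delta0_nice : nice delta0.
Proof.
split=> [D|]; first by rewrite /delta0 oppr_eq0.
by exists 0%N => D; rewrite /delta0 absz_gt0; case: eqP.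
Qed.

(** The witnesses are both s y. For instance [invS] reads (1 - s y) + s y (z + 1/z) - (1 + s y) = s
    y (z + 1/z - 2). *)
Lemma balanced_init :
  balanced ((1 - s * y) *: delta0) ((s * y) *: W delta0) ((1 + s * y) *: delta0) 0.
Proof.
exists ((s * y) *: delta0), ((s * y) *: delta0).
have N := delta0_nice.
split; try by repeat first [exact: N|apply: niceZ|apply: nice_zsum|exact: nice0].
all: apply: funext => D; rewrite ?pointwiseE ?pt0 ?(addK1, subK1).
(* Every term of the relations is supported in |D| <= 2, so five exponents remain to be computed. *)
all: have : D = 0 \/ D = 0 + 1 \/ D = 0 - 1 \/
  D = 0 + 1 + 1 \/ D = 0 - 1 - 1 \/ (2 < `|D|)%N by lia.
all: case=> [|[|[|[|[]]]]].
all: try (move=> ->; repeat match goal with |- context [delta0 ?x] =>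
  first [have -> : delta0 x = 0 by [] | have -> : delta0 x = 1 by []] end;
  rewrite ?(powE s0) ?expr0z; field; by rewrite ?oner_neq0 ?s0).
all: try (move=> hD; repeat match goal with |- context [delta0 ?x] =>
  have -> : delta0 x = 0 by rewrite /delta0; case: eqP => //; lia end; ring).
Qed.

(* chi is finitely supported, so (z + z^-1 - 2) chi telescopes to 0 at z = 1. *)
Lemma balanced_eval L0 L1 R0 R1 : balanced L0 L1 R0 R1 ->
  exists M0, forall M, (M0 <= M)%N ->
    \sum_(k < (2 * M).+1) (L0 + L1 - R0 - R1) (k%:Z - M%:Z) = 0.
Proof.
move=> [phi [chi [_ _ _ _ _ [_ [M0 hM]] _ _ -> _ _]]]; exists M0.+1 => M leM.
pose u (k : nat) := chi (k%:Z - M%:Z - 1) - chi (k%:Z - M%:Z).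
rewrite (eq_bigr (fun k : 'I__ => - (u k.+1 - u k))); last first.
  move=> k _; rewrite !pointwiseE /u.
  have -> : k.+1%:Z - M%:Z - 1 = k%:Z - M%:Z by lia.
  have -> : k.+1%:Z - M%:Z = k%:Z - M%:Z + 1 by lia.
  ring.
rewrite sumrN -(big_mkord xpredT (fun k => u k.+1 - u k)) telescope_sumr // /u.
by rewrite !hM ?subrr ?oppr0 //; lia.
Qed.
End RogersSzego.

(** * Branching and Pieri rules for chains of subsets *)

Section SubsetSums.
Variables (I : finType) (V : nmodType).

Lemma sum_subsets_setU1 (i : I) (J : {set I}) (f : {set I} -> V) : i \notin J ->
  \sum_(K : {set I} | K \subset i |: J) f K =
  \sum_(K : {set I} | K \subset J) f K + \sum_(K : {set I} | K \subset J) f (i |: K).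
Proof.
move=> iJ; rewrite (bigID (fun K : {set I} => i \in K)) /= addrC; congr (_ + _).
  apply: eq_bigl => K; rewrite -subsetD1 setU1K //.
rewrite (reindex_onto (fun K => i |: K) (fun K : {set I} => K :\ i)) /=; last first.
  by move=> K /andP[_ iK]; rewrite setD1K.
apply: eq_bigl => K; rewrite setU11 andbT.
apply/andP/idP => [[sK /eqP <-]|sK].
  by rewrite -(setU1K iJ) setSD.
by rewrite setUS // setU1K //; apply: contra iJ; apply/subsetP.
Qed.

Lemma exchange_subset_out (J : {set I}) (f : {set I} -> I -> V) :
  \sum_(K : {set I} | K \subset J) \sum_(i in J :\: K) f K i =
  \sum_(K : {set I} | K \subset J) \sum_(i in K) f (K :\ i) i.
Proof.
rewrite !pair_big_dep /=.
rewrite (reindex_onto (fun p => (p.1 :\ p.2, p.2)) (fun p => (p.2 |: p.1, p.2))) /=.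
  apply: eq_bigl => -[K i] /=; rewrite !inE eqxx /= xpair_eqE eqxx andbT.
  apply/andP/andP => [[/andP[sK iJ] /eqP e]|[sK iK]].
    have iK : i \in K by rewrite -e setU11.
    by split=> //; rewrite -(setD1K iK) subUset sub1set iJ.
  by rewrite setD1K ?eqxx // (subsetP sK) // (subset_trans _ sK) ?subD1set.
move=> [K i] /= /andP[sK]; rewrite inE => /andP[iK iJ].
by rewrite setU1K.
Qed.

Lemma exchange_subset_in (K : {set I}) (f : I -> {set I} -> V) :
  \sum_(i in K) \sum_(L : {set I} | L \subset K :\ i) f i L =
  \sum_(L : {set I} | L \subset K) \sum_(i in K :\: L) f i L.
Proof.
rewrite (exchange_big_dep (fun L : {set I} => L \subset K)) /=; last first.
  by move=> i L _ h; apply: subset_trans h (subD1set _ _).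
apply: eq_bigr => L sL; apply: eq_bigl => i.
by rewrite subsetD1 sL inE andbC.
Qed.
End SubsetSums.

(** * Partial fractions for the Hall-Littlewood weights *)

Section PartialFractions.
Variables (F : fieldType) (t : F) (I : finType) (x : I -> F).
Hypothesis x_inj : injective x.

Definition hl_factor (y : F) (K : {set I}) : F := \prod_(j in K) ((y - t * x j) / (y - x j)).
Definition hl_factor_r (K : {set I}) (y : F) : F := \prod_(j in K) ((x j - t * y) / (x j - y)).
Definition hl_cross (J K : {set I}) : F := \prod_(i in J) hl_factor (x i) K.
(** The Cauchy kernel in one variable y, that is, the generating function of the Hall-Littlewood
    functions q_r in the variables of K. *)
Definition kernel_factor (y : F) (K : {set I}) : F := \prod_(j in K) ((1 - t * x j * y) / (1 - x j * y)).

Lemma hl_crossC (J K : {set I}) : hl_cross J K = \prod_(j in K) hl_factor_r J (x j).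
Proof. by rewrite /hl_cross exchange_big. Qed.
Lemma hl_factor0 y : hl_factor y set0 = 1. Proof. by rewrite /hl_factor big_set0. Qed.
Lemma hl_cross0l K : hl_cross set0 K = 1. Proof. by rewrite /hl_cross big_set0. Qed.
Lemma hl_factorU y i (K : {set I}) : i \notin K ->
  hl_factor y (i |: K) = (y - t * x i) / (y - x i) * hl_factor y K.
Proof. by move=> iK; rewrite /hl_factor big_setU1. Qed.
Lemma hl_factor_rU y i (K : {set I}) : i \notin K ->
  hl_factor_r (i |: K) y = (x i - t * y) / (x i - y) * hl_factor_r K y.
Proof. by move=> iK; rewrite /hl_factor_r big_setU1. Qed.
Lemma hl_crossUl i (J K : {set I}) : i \notin J ->
  hl_cross (i |: J) K = hl_factor (x i) K * hl_cross J K.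
Proof. by move=> iK; rewrite /hl_cross big_setU1. Qed.
Lemma hl_crossUr i (J K : {set I}) : i \notin K ->
  hl_cross J (i |: K) = hl_factor_r J (x i) * hl_cross J K.
Proof. by move=> iK; rewrite !hl_crossC big_setU1. Qed.

Lemma set_indU1 (P : {set I} -> Prop) : P set0 ->
  (forall i (K : {set I}), i \notin K -> P K -> P (i |: K)) -> forall K, P K.
Proof.
move=> P0 PU K; elim: {K}#|K| {-2}K (erefl #|K|) => [|n IH] K hK.
  by rewrite (cards0_eq hK).
have /card_gt0P[i iK] : (0 < #|K|)%N by rewrite hK.
rewrite -(setD1K iK); apply: PU; rewrite ?setD11 //.
by apply: IH; move: hK; rewrite (cardsD1 i) iK => -[].
Qed.

Lemma D1_in_setU1 (i j : I) (K : {set I}) : i \notin K -> j \in K ->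
  (i |: K) :\ j = i |: (K :\ j) /\ i \notin K :\ j.
Proof.
move=> iK jK; split; last by rewrite !inE negb_and iK orbT.
have ij : i != j by apply: contraNneq iK => ->.
by apply/setP=> k; rewrite !inE; case: (eqVneq k i) => [->|_] //=; rewrite ij.
Qed.

Lemma x_neq i j (K : {set I}) : i \notin K -> j \in K -> x i - x j != 0.
Proof.
by move=> iK jK; rewrite subr_eq0 (inj_eq x_inj); apply: contraNneq iK => ->.
Qed.

(** As a function of y the product is 1 at infinity and has simple poles at the x_i. The induction
    works with field values only and uses its hypothesis twice, at y and at the new pole. *)
Lemma hl_factor_partial_fractions (M : {set I}) (y : F) : (forall j, j \in M -> y - x j != 0) ->
  hl_factor y M = 1 + (1 - t) * \sum_(i in M) x i / (y - x i) * hl_factor (x i) (M :\ i).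
Proof.
elim/set_indU1: M y => [|i0 M i0M IH] y hy; first by rewrite hl_factor0 big_set0 mulr0 addr0.
have hM j : j \in M -> y - x j != 0 by move=> jM; apply: hy; rewrite setU1r.
have h0 : y - x i0 != 0 by apply: hy; rewrite setU11.
rewrite hl_factorU // big_setU1 //= setU1K // (IH _ hM) (IH (x i0)); last first.
  by move=> j; apply: x_neq.
set S1 := \sum_(i in M) _; set S2 := \sum_(i in M) _.
have -> : \sum_(i in M) x i / (y - x i) * hl_factor (x i) ((i0 |: M) :\ i) =
    (1 + (1 - t) * x i0 / (y - x i0)) * S1 - (1 - t) * x i0 / (y - x i0) * S2.
  rewrite !mulr_sumr -sumrB; apply: eq_bigr => i iM.
  have [-> iN] := D1_in_setU1 i0M iM; rewrite hl_factorU //.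
  have := hM _ iM; have := x_neq i0M iM => h1 h2.
  by field; rewrite h0 h1 h2 -oppr_eq0 opprB h1.
by field; rewrite h0.
Qed.

(** Normalized at y = 0, where the product is 1; hence the terms y / (y - x_i). *)
Lemma hl_factor_r_partial_fractions (M : {set I}) (y : F) : (forall j, j \in M -> y - x j != 0) ->
  hl_factor_r M y = 1 - (1 - t) * \sum_(i in M) y / (y - x i) * hl_factor_r (M :\ i) (x i).
Proof.
elim/set_indU1: M y => [|i0 M i0M IH] y hy.
  by rewrite /hl_factor_r !big_set0 mulr0 subr0.
have hM j : j \in M -> y - x j != 0 by move=> jM; apply: hy; rewrite setU1r.
have h0 : y - x i0 != 0 by apply: hy; rewrite setU11.
rewrite hl_factor_rU // big_setU1 //= setU1K // (IH _ hM) (IH (x i0)); last first.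
  by move=> j; apply: x_neq.
set S1 := \sum_(i in M) _; set S2 := \sum_(i in M) _.
have -> : \sum_(i in M) y / (y - x i) * hl_factor_r ((i0 |: M) :\ i) (x i) =
    (1 - (1 - t) * y / (y - x i0)) * S1 + (1 - t) * y / (y - x i0) * S2.
  rewrite !mulr_sumr -big_split; apply: eq_bigr => i iM /=.
  have [-> iN] := D1_in_setU1 i0M iM; rewrite hl_factor_rU //.
  have := hM _ iM; have := x_neq i0M iM => h1 h2.
  by field; rewrite h0 h1 h2.
by field; rewrite h0 -oppr_eq0 opprB h0.
Qed.

Hypothesis t0 : t != 0.

Lemma hl_factor_neq0 y (M : {set I}) : (forall j, j \in M -> y - x j != 0) ->
  (forall j, j \in M -> y - t * x j != 0) -> hl_factor y M != 0.
Proof. by move=> h1 h2; apply/prodf_neq0 => j jM; rewrite mulf_neq0 ?invr_eq0 ?h1 ?h2. Qed.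

(** The preceding expansion at y / t, where [hl_factor_r] becomes t^|M| / [hl_factor y M]. *)
Lemma sum_hl_factor_r (M : {set I}) (y : F) : (forall j, j \in M -> y - x j != 0) ->
  (forall j, j \in M -> y - t * x j != 0) ->
  (1 - t) * \sum_(i in M) y / (y - t * x i) * hl_factor_r (M :\ i) (x i) = 1 - t ^+ #|M| / hl_factor y M.
Proof.
move=> h1 h2; have hy j : j \in M -> y / t - x j != 0.
  move=> jM; have := h2 j jM; apply: contra => /eqP e.
  have -> : y - t * x j = t * (y / t - x j) by field.
  by rewrite e mulr0.
have := hl_factor_r_partial_fractions hy.
have -> : hl_factor_r M (y / t) = t ^+ #|M| / hl_factor y M.
  rewrite /hl_factor_r /hl_factor -prodfV -[t ^+ _]prodr_const -big_split; apply: eq_bigr => j jM /=.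
  have k1 := h1 j jM; have k2 := h2 j jM.
  by field; rewrite k1 k2 t0 -oppr_eq0 opprB mulrC.
move=> ->; rewrite subKr.
congr (_ * _); apply: eq_bigr => i iM; congr (_ * _).
have := h2 i iM; have := hy i iM => k1 k2.
by field; rewrite t0 ?mulNr [x i * t]mulrC k2.
Qed.

(** Partial fractions at y = 0, where every factor of the product equals t. *)
Lemma sum_hl_factor (M : {set I}) : (forall j, x j != 0) ->
  (1 - t) * \sum_(i in M) hl_factor (x i) (M :\ i) = 1 - t ^+ #|M|.
Proof.
move=> x0; have h j : j \in M -> 0 - x j != 0 by rewrite sub0r oppr_eq0.
have := hl_factor_partial_fractions h.
have -> : hl_factor 0 M = t ^+ #|M|.
  rewrite -[t ^+ _]prodr_const; apply: eq_bigr => j jM.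
  by field; rewrite ?sub0r ?oppr_eq0 x0.
under eq_bigr => i _ do rewrite sub0r invrN mulrN divff // mulN1r.
by rewrite sumrN mulrN => ->; ring.
Qed.

Section KernelFactor.
Variable y : F.
Hypothesis y0 : y != 0.
Hypothesis xy1 : forall i, 1 - x i * y != 0.
Hypothesis txy1 : forall i, 1 - t * x i * y != 0.

Lemma kernel_factorE M : kernel_factor y M = hl_factor y^-1 M.
Proof. by apply: eq_bigr => j _; field; rewrite y0 mulNr xy1. Qed.

Lemma yVx j : y^-1 - x j != 0.
Proof.
have -> : y^-1 - x j = (1 - x j * y) / y by field.
by rewrite mulf_neq0 ?invr_eq0.
Qed.
Lemma yVtx j : y^-1 - t * x j != 0.
Proof.
have -> : y^-1 - t * x j = (1 - t * x j * y) / y by field.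
by rewrite mulf_neq0 ?invr_eq0.
Qed.

Lemma kernel_factor_partial_fractions M :
  kernel_factor y M = 1 + \sum_(i in M) ((1 - t) * x i * y / (1 - x i * y)) * hl_factor (x i) (M :\ i).
Proof.
rewrite kernel_factorE hl_factor_partial_fractions => [|j _]; last exact: yVx.
congr (1 + _); rewrite mulr_sumr; apply: eq_bigr => i iM; rewrite mulrA; congr (_ * _).
by field; rewrite y0 xy1.
Qed.

Lemma sum_hl_factor_r_kernel (M : {set I}) :
  \sum_(i in M) ((1 - t) / (1 - t * x i * y)) * hl_factor_r (M :\ i) (x i) = 1 - t ^+ #|M| / kernel_factor y M.
Proof.
rewrite kernel_factorE -sum_hl_factor_r => [|j _|j _]; [|exact: yVx|exact: yVtx].
rewrite mulr_sumr; apply: eq_bigr => i iM; rewrite mulrA; congr (_ * _).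
have -> : y^-1 / (y^-1 - t * x i) = (1 - t * x i * y)^-1 by rewrite -invfM mulrBr divff // mulrC.
by [].
Qed.

Lemma kernel_factor_neq0 M : kernel_factor y M != 0.
Proof. by apply/prodf_neq0 => j _; rewrite mulf_neq0 ?invr_eq0. Qed.

Lemma kernel_factorU1 i (K : {set I}) : i \notin K ->
  kernel_factor y (i |: K) = (1 - t * x i * y) / (1 - x i * y) * kernel_factor y K.
Proof. by move=> iK; rewrite /kernel_factor big_setU1. Qed.
Lemma kernel_factorD (J K : {set I}) : K \subset J ->
  kernel_factor y J = kernel_factor y (J :\: K) * kernel_factor y K.
Proof.
move=> sK; rewrite /kernel_factor (big_setID K) /= (setIidPr sK) mulrC //.
Qed.
End KernelFactor.

(** * Chains of subsets and their regrouping *)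

Section Chains.
Variables (V : lmodType F) (H : nat -> {linear V -> V}) (G : {linear V -> V}) (v0 : V).

Definition xprod (J : {set I}) : F := \prod_(i in J) x i.
Lemma xprod0 : xprod set0 = 1. Proof. by rewrite /xprod big_set0. Qed.
Lemma xprodU i (J : {set I}) : i \notin J -> xprod (i |: J) = x i * xprod J.
Proof. by move=> iJ; rewrite /xprod big_setU1. Qed.
Lemma xprodD1 i (J : {set I}) : i \in J -> xprod J = x i * xprod (J :\ i).
Proof. by move=> iJ; rewrite -xprodU ?setD11 // setD1K. Qed.

(** Both sides weight the ordered decomposition of J into K, {i} and the remaining variables by the
    cross factors between its blocks; i is attached to the right block on one side and to the left
    block on the other. *)
Lemma regroup_out (J : {set I}) (c : I -> F) (f : {set I} -> V) :
  \sum_(K : {set I} | K \subset J) hl_cross K (J :\: K) *: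
     (\sum_(i in J :\: K) (c i * hl_factor (x i) (J :\: K :\ i)) *: f K) =
  \sum_(K : {set I} | K \subset J) hl_cross K (J :\: K) *:
     (\sum_(i in K) (c i * hl_factor_r (K :\ i) (x i)) *: f (K :\ i)).
Proof.
under eq_bigr do rewrite scaler_sumr.
rewrite (exchange_subset_out J (fun K i => _)).
apply: eq_bigr => K sK; rewrite scaler_sumr; apply: eq_bigr => i iK.
have e1 : J :\: (K :\ i) = i |: (J :\: K).
  apply/setP => k; rewrite !inE; case: (eqVneq k i) => //= ->.
  by rewrite (subsetP sK).
have iN : i \notin J :\: K by rewrite inE iK.
rewrite !scalerA; congr (_ *: _); rewrite e1 setU1K // hl_crossUr //.
have -> : hl_cross K (J :\: K) = hl_factor (x i) (J :\: K) * hl_cross (K :\ i) (J :\: K).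
  by rewrite -hl_crossUl ?setD11 // setD1K.
ring.
Qed.

(** The same principle for the ordered decomposition of K into L, the remaining variables, and
    {i}. *)
Lemma regroup_in (K : {set I}) (c : I -> F) (f : I -> {set I} -> V) :
  \sum_(i in K) (c i * hl_factor_r (K :\ i) (x i)) *:
     (\sum_(L : {set I} | L \subset K :\ i) hl_cross L (K :\ i :\: L) *: f i L) =
  \sum_(L : {set I} | L \subset K) hl_cross L (K :\: L) *:
     (\sum_(i in K :\: L) (c i * hl_factor_r (K :\: L :\ i) (x i)) *: f i L).
Proof.
under eq_bigr do rewrite scaler_sumr.
rewrite (exchange_subset_in K (fun i L => _)).
apply: eq_bigr => L sL; rewrite scaler_sumr; apply: eq_bigr => i.
rewrite inE => /andP[iL iK].
have e1 : K :\ i :\: L = K :\: L :\ i by rewrite !setDDl setUC.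
have e2 : hl_factor_r (K :\ i) (x i) = hl_factor_r L (x i) * hl_factor_r (K :\: L :\ i) (x i).
  rewrite /hl_factor_r (big_setID L) /= -e1; congr (_ * _); apply: eq_bigl => k.
  rewrite !inE; case: (boolP (k \in L)) => kL; rewrite ?andbF //.
  by rewrite (subsetP sL) // !andbT; apply: contraNneq iL => <-.
rewrite !scalerA; congr (_ *: _); rewrite e1 e2.
have iKL : i \in K :\: L by rewrite inE iL.
have -> : hl_cross L (K :\: L) = hl_factor_r L (x i) * hl_cross L (K :\: L :\ i).
  by rewrite -hl_crossUr ?setD11 // setD1K.
ring.
Qed.

(** J holds the variables whose rows reach the current column and K those reaching the next one, so
    |J \ K| rows end here. [H] and [G] stay abstract because the branching and Pieri rules use only
    their linearity. *)
Definition chain_step (X : {set I} -> V) (J : {set I}) : V :=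
  xprod J *: G (\sum_(K : {set I} | K \subset J) hl_cross K (J :\: K) *: H #|J :\: K| (X K)).
Definition only_empty (J : {set I}) : V := if J == set0 then v0 else 0.
Definition chains (N : nat) : {set I} -> V := iter N chain_step only_empty.

Lemma chainsS N J : chains N.+1 J = chain_step (chains N) J.
Proof. by []. Qed.
Lemma only_empty_sum (J : {set I}) (f : {set I} -> V -> V) : (forall K, f K 0 = 0) ->
  \sum_(K : {set I} | K \subset J) f K (only_empty K) = f set0 v0.
Proof.
move=> f0; rewrite (bigD1 set0) ?sub0set //= /only_empty eqxx big1 ?addr0 //.
by move=> K /andP[_ /negPf->].
Qed.

(** * The branching rule: removing one variable *)

Section Branching.
Variable i0 : I.
Local Notation y := (x i0).
Hypothesis xtx : forall j, y - t * x j != 0.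

(** J is a column of the partition left after removing y. The larger partition has column length |J|
    in the first component and |J| + 1, with one factor y, in the second; the index of [H] is the
    drop between consecutive columns of the larger one. *)
Definition branch_step (X : {set I} -> V * V) (J : {set I}) : V * V :=
  (xprod J *: G (\sum_(K : {set I} | K \subset J) hl_cross K (J :\: K) *:
     (H #|J :\: K| (X K).1 + (1 - t ^+ #|J :\: K|) *: H #|J :\: K|.-1 (X K).2)),
   (y * xprod J) *: G (\sum_(K : {set I} | K \subset J) hl_cross K (J :\: K) *:
     (H #|J :\: K|.+1 (X K).1 + H #|J :\: K| (X K).2))).
Definition branch_state N := iter N branch_step (fun J => (only_empty J, 0)).

Lemma branch_stateS N J : branch_state N.+1 J = branch_step (branch_state N) J.
Proof. by []. Qed.

Lemma subset_notin (K J : {set I}) : K \subset J -> i0 \notin J -> i0 \notin K.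
Proof. by move=> sK; apply: contra; apply: (subsetP sK). Qed.
Lemma setU1Dl (K J : {set I}) : i0 \notin J -> K \subset J ->
  (i0 |: J) :\: K = i0 |: (J :\: K).
Proof.
move=> iJ sK; apply/setP => k; rewrite !inE; case: (eqVneq k i0) => //= ->.
by rewrite andbT (subset_notin sK).
Qed.
Lemma setU1Dr (K J : {set I}) : i0 \notin J -> (i0 |: J) :\: (i0 |: K) = J :\: K.
Proof.
move=> iJ; apply/setP => k; rewrite !inE; case: (eqVneq k i0) => //= ->.
by rewrite (negPf iJ) andbF.
Qed.

Lemma branching_split (J : {set I}) (X : {set I} -> V) (Y : {set I} -> V)
    (w : nat -> {linear V -> V}) : i0 \notin J ->
  (forall K : {set I}, K \subset J -> X (i0 |: K) = Y K) ->
  \sum_(K : {set I} | K \subset i0 |: J) hl_cross K ((i0 |: J) :\: K) *: w #|K| (X K) =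
  \sum_(K : {set I} | K \subset J) hl_cross K (J :\: K) *:
     (hl_factor_r K y *: w #|K| (X K) + hl_factor y (J :\: K) *: w #|K|.+1 (Y K)).
Proof.
move=> iJ XY; rewrite sum_subsets_setU1 // -big_split; apply: eq_bigr => K sK /=.
have iK := subset_notin sK iJ.
rewrite setU1Dl // setU1Dr // XY // cardsU1 iK add1n.
rewrite hl_crossUr ?hl_crossUl // ?inE ?(negPf iJ) ?andbF // scalerDr !scalerA.
by congr (_ *: _ + _ *: _); rewrite mulrC.
Qed.

(** The weight [w] is arbitrary because the second part is used both for the final sum, with the
    identity, and for the next column, with an [H] whose index depends on |K|. *)
Lemma branching N :
  (forall J : {set I}, i0 \notin J -> chains N (i0 |: J) = (branch_state N J).2) /\
  (forall (J : {set I}) (w : nat -> {linear V -> V}), i0 \notin J ->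
    \sum_(K : {set I} | K \subset J) hl_cross K (J :\: K) *:
       (hl_factor_r K y *: w #|K| (chains N K) + hl_factor y (J :\: K) *: w #|K|.+1 (branch_state N K).2) =
    \sum_(K : {set I} | K \subset J) hl_cross K (J :\: K) *:
       (w #|K| (branch_state N K).1 + w #|K|.+1 (branch_state N K).2)).
Proof.
elim: N => [|N [IHa IHb]].
  split=> [J iJ|J w iJ] /=.
    rewrite /only_empty; case: eqP => // e.
    by have := setU11 i0 J; rewrite e inE.
  rewrite /chains /=.
  under eq_bigr do rewrite linear0 scaler0 addr0.
  under [RHS]eq_bigr do rewrite linear0 addr0.
  rewrite (@only_empty_sum J (fun K v => hl_cross K (J :\: K) *: (hl_factor_r K y *: w #|K| v))); last first.
    by move=> K; rewrite linear0 !scaler0.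
  rewrite (@only_empty_sum J (fun K v => hl_cross K (J :\: K) *: w #|K| v)); last first.
    by move=> K; rewrite linear0 !scaler0.
  by rewrite /hl_factor_r big_set0 scale1r.
have Hsub (J K : {set I}) : K \subset J -> #|J :\: K| = (#|J| - #|K|)%N.
  by move=> sK; rewrite cardsDS.
have IHa' (J : {set I}) : i0 \notin J -> chains N.+1 (i0 |: J) = (branch_state N.+1 J).2.
  move=> iJ; rewrite chainsS /chain_step branch_stateS /=.
  rewrite xprodU //; congr (_ *: G _).
  pose w k : {linear V -> V} := H (#|J|.+1 - k).
  transitivity (\sum_(K : {set I} | K \subset i0 |: J)
      hl_cross K ((i0 |: J) :\: K) *: w #|K| (chains N K)).
    by apply: eq_bigr => K sK; rewrite Hsub // cardsU1 iJ.
  rewrite (@branching_split _ _ (fun K => (branch_state N K).2)) // => [|K sK]; last first.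
    by rewrite IHa // (subset_notin sK).
  rewrite IHb //; apply: eq_bigr => K sK; rewrite /w Hsub // subSS subSn //.
  exact: subset_leq_card.
split=> // J w iJ.
(* A closed form of the first component. Given it, the second part follows by expanding
   [hl_factor y (J :\: K)] in partial fractions and moving each pole variable i into K. *)
have claim (K : {set I}) : K \subset J -> (branch_state N.+1 K).1 = hl_factor_r K y *: chains N.+1 K +
   \sum_(i in K) ((1 - t) * x i / (y - x i) * hl_factor_r (K :\ i) (x i)) *: (branch_state N.+1 (K :\ i)).2.
  move=> sK; have iK := subset_notin sK iJ.
  pose w' k : {linear V -> V} := H (#|K| - k).
  have hU i : i \in K ->
    ((1 - t) * x i / (y - x i) * hl_factor_r (K :\ i) (x i)) *: (branch_state N.+1 (K :\ i)).2 =
    xprod K *: G (((1 - t) * (y / (y - x i)) * hl_factor_r (K :\ i) (x i)) *: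
      \sum_(L : {set I} | L \subset K :\ i) hl_cross L (K :\ i :\: L) *:
       (hl_factor_r L y *: w' #|L| (chains N L) + hl_factor y (K :\ i :\: L) *: w' #|L|.+1 (branch_state N L).2)).
    move=> iiK.
    have iD : i0 \notin K :\ i by rewrite inE negb_and iK orbT.
    have yx : y - x i != 0 by apply: x_neq iK iiK.
    rewrite -IHa' // chainsS /chain_step xprodU // [in RHS]linearZ /= !scalerA.
    congr (_ *: G _); first by rewrite (xprodD1 iiK); field; exact: yx.
    rewrite -(@branching_split _ (chains N)) //; last first.
      by move=> L sL; apply: IHa; apply: subset_notin sL _.
    apply: eq_bigr => L sL; rewrite Hsub // cardsU1 iD /w'.
    by rewrite [in RHS](cardsD1 i) iiK.
  rewrite (eq_bigr _ hU).
  rewrite -scaler_sumr -linear_sum regroup_in branch_stateS chainsS /chain_step /=.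
  rewrite scalerA [hl_factor_r K y * _]mulrC -scalerA -scalerDr.
  congr (_ *: _); rewrite -(linearZ_LR G) -(linearD G); congr (G _).
  rewrite scaler_sumr -big_split /=.
  have wE (L : {set I}) : L \subset K ->
    w' #|L| = H #|K :\: L| /\ w' #|L|.+1 = H #|K :\: L|.-1.
    by move=> sL; rewrite /w' Hsub // subnS.
  (* Adding the t^m part completes 1 - t^m to 1, so that the induction hypothesis with weight [w']
     applies. *)
  apply: (@addIr _ (\sum_(L : {set I} | L \subset K)
     hl_cross L (K :\: L) *: (t ^+ #|K :\: L| *: H #|K :\: L|.-1 (branch_state N L).2))).
  rewrite -!big_split /=.
  transitivity (\sum_(L : {set I} | L \subset K) hl_cross L (K :\: L) *:
      (w' #|L| (branch_state N L).1 + w' #|L|.+1 (branch_state N L).2)).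
    apply: eq_bigr => L sL; have [-> ->] := wE L sL.
    rewrite -scalerDr -addrA; congr (_ *: (_ + _)).
    by rewrite -scalerDl subrK scale1r.
  rewrite -IHb //; apply: eq_bigr => L sL; have [-> ->] := wE L sL.
  rewrite -/(branch_state N).
  have yx j : j \in K :\: L -> y - x j != 0 by rewrite inE => /andP[_]; apply: x_neq.
  have ytx j : j \in K :\: L -> y - t * x j != 0 by [].
  have e1 := hl_factor_r_partial_fractions yx.
  have e2 := sum_hl_factor_r yx ytx.
  have e3 : hl_factor_r K y = hl_factor_r L y * hl_factor_r (K :\: L) y.
    by rewrite /hl_factor_r (big_setID L) /= (setIidPr sL).
  have := hl_factor_neq0 yx ytx => e4.
  have -> : \sum_(i in K :\: L) ((1 - t) * (y / (y - x i)) * hl_factor_r (K :\: L :\ i) (x i)) *: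
      (hl_factor_r L y *: H #|K :\: L| (chains N L) +
       hl_factor y (K :\ i :\: L) *: H #|K :\: L|.-1 (branch_state N L).2)
    = ((1 - hl_factor_r (K :\: L) y) * hl_factor_r L y) *: H #|K :\: L| (chains N L)
      + (hl_factor y (K :\: L) - t ^+ #|K :\: L|) *: H #|K :\: L|.-1 (branch_state N L).2.
    have -> : hl_factor y (K :\: L) - t ^+ #|K :\: L| =
        (1 - t ^+ #|K :\: L| / hl_factor y (K :\: L)) * hl_factor y (K :\: L).
      by rewrite mulrBl mul1r divfK.
    rewrite -e2 e1 subKr !mulr_sumr !mulr_suml !scaler_suml -big_split /=.
    apply: eq_bigr => i iM; rewrite scalerDr !scalerA.
    have -> : K :\ i :\: L = K :\: L :\ i by rewrite !setDDl setUC.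
    congr (_ *: _ + _ *: _); first by rewrite !mulrA.
    rewrite -[in RHS](setD1K iM) hl_factorU ?setD11 //.
    rewrite [in RHS](setD1K iM).
    by field; rewrite yx // ytx.
  rewrite e3 !scalerDr !scalerA -!addrA addrA -!scalerDl.
  by congr (_ *: _ + _ *: _); ring.
move: (branch_state N.+1) (chains N.+1) claim => l c claim.
under [LHS]eq_bigr => K sK.
  have yx j : j \in J :\: K -> y - x j != 0.
    by rewrite inE => /andP[_]; apply: x_neq.
  rewrite (hl_factor_partial_fractions yx) scalerDl scale1r addrA scalerDr mulr_sumr scaler_suml.
  under [X in _ + _ *: X]eq_bigr => i _ do rewrite mulrA mulrA.
  over.
rewrite big_split /= (regroup_out J (fun i => (1 - t) * x i / (y - x i))
  (fun K => w #|K|.+1 (l K).2)) -big_split.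
apply: eq_bigr => K sK /=.
rewrite -scalerDr claim // (linearD (w #|K|)) (linearZ_LR (w #|K|)) (linear_sum (w #|K|)) /=
  addrAC; congr (_ *: (_ + _ + _)).
apply: eq_bigr => i iK; rewrite (linearZ_LR (w #|K|)) /= [in RHS](cardsD1 i K) iK //.
Qed.
End Branching.

(** * The Pieri rule: multiplication by the Cauchy kernel *)

Section Pieri.
Variable y : F.
Hypothesis y0 : y != 0.
Hypothesis xy1 : forall i, 1 - x i * y != 0.
Hypothesis txy1 : forall i, 1 - t * x i * y != 0.

(** Now J is a column of the larger partition. The smaller one has column length |J| in the first
    component and |J| - 1 in the second, and its drops index [H]. *)
Definition pieri_step (X : {set I} -> V * V) (J : {set I}) : V * V :=
  (xprod J *: G (\sum_(K : {set I} | K \subset J) hl_cross K (J :\: K) *: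
     (H #|J :\: K| (X K).1 + H #|J :\: K|.+1 (X K).2)),
   (y * xprod J) *: G (\sum_(K : {set I} | K \subset J) hl_cross K (J :\: K) *:
     ((1 - t ^+ #|J :\: K|) *: H #|J :\: K|.-1 (X K).1 + H #|J :\: K| (X K).2))).
(** The strip may continue past the last recorded column as a single row of any length r >= 1; the
    coefficient is the sum over r of (1 - t) (x_i y)^r. *)
Definition singletons (J : {set I}) : V :=
  \sum_(i | J == [set i]) ((1 - t) * x i * y / (1 - x i * y)) *: v0.
Definition pieri_state N := iter N pieri_step (fun J => (only_empty J, singletons J)).
Lemma pieri_stateS N J : pieri_state N.+1 J = pieri_step (pieri_state N) J.
Proof. by []. Qed.

(** Makes the truncated predecessor [#|K|.-1] harmless at the empty set. *)
Lemma pieri_state_set0 N : (pieri_state N set0).2 = 0.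
Proof.
elim: N => [|N IH].
  by rewrite /pieri_state /= /singletons big1 // => i /eqP e; have := set11 i; rewrite -e inE.
rewrite pieri_stateS /= big1 ?linear0 ?scaler0 // => K; rewrite subset0 => /eqP->.
by rewrite setD0 cards0 expr0 subrr scale0r IH linear0 addr0 scaler0.
Qed.

Lemma pieri N :
  (forall J : {set I}, kernel_factor y J *: chains N J = (pieri_state N J).1) /\
  (forall (J : {set I}) (w : nat -> {linear V -> V}),
    kernel_factor y J *: (\sum_(K : {set I} | K \subset J) hl_cross K (J :\: K) *: w #|K| (chains N K)) =
    \sum_(K : {set I} | K \subset J) hl_cross K (J :\: K) *:
       (w #|K| (pieri_state N K).1 + w #|K|.-1 (pieri_state N K).2)).
Proof.
elim: N => [|N [IHa IHb]].
  split=> [J|J w]; rewrite /chains /=.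
    rewrite /only_empty; case: eqP => [->|_]; last by rewrite scaler0.
    by rewrite /kernel_factor big_set0 scale1r.
  rewrite (@only_empty_sum J (fun K v => hl_cross K (J :\: K) *: w #|K| v)); last first.
    by move=> K; rewrite linear0 scaler0.
  under eq_bigr do rewrite scalerDr; rewrite big_split /=.
  rewrite (@only_empty_sum J (fun K v => hl_cross K (J :\: K) *: w #|K| v)); last first.
    by move=> K; rewrite linear0 scaler0.
  rewrite hl_cross0l scale1r cards0 kernel_factor_partial_fractions // scalerDl scale1r; congr (_ + _).
  rewrite scaler_suml /singletons.
  under [RHS]eq_bigr => K _ do rewrite (linear_sum (w _)) scaler_sumr.
  rewrite (exchange_big_dep xpredT) //= [LHS]big_mkcond; apply: eq_bigr => i _.
  case: ifP => iJ.
    rewrite (eq_bigl (pred1 [set i])) => [|K]; last first.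
      by rewrite /= andbC; case: eqP => //= ->; rewrite sub1set.
    rewrite big_pred1_eq.
    rewrite cards1 (linearZ_LR (w _)) /= scalerA; congr (_ *: _).
    by rewrite mulrC /hl_cross big_set1.
  rewrite big_pred0 // => K; rewrite andbC; case: eqP => //= ->; rewrite sub1set.
  by rewrite iJ.
have Hsub (J K : {set I}) : K \subset J -> #|J :\: K| = (#|J| - #|K|)%N.
  by move=> sK; rewrite cardsDS.
have IHa' J : kernel_factor y J *: chains N.+1 J = (pieri_state N.+1 J).1.
  rewrite chainsS /chain_step pieri_stateS /= scalerA mulrC -scalerA -(linearZ_LR G).
  congr (_ *: G _).
  pose w k : {linear V -> V} := H (#|J| - k).
  transitivity (kernel_factor y J *: \sum_(K : {set I} | K \subset J) hl_cross K (J :\: K) *: w #|K| (chains N K)).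
    by congr (_ *: _); apply: eq_bigr => K sK; rewrite Hsub.
  rewrite IHb; apply: eq_bigr => K sK; rewrite /w Hsub //; congr (_ *: (_ + _)).
  case: (eqVneq K set0) => [->|]; first by rewrite pieri_state_set0 !linear0.
  rewrite -card_gt0 => K0; congr (H _ _).
  by have := subset_leq_card sK; lia.
split=> // J w.
(* This time it is the second component that has a closed form; the expansion of
   [kernel_factor y (J :\: K)] then produces it. *)
have claim (K : {set I}) : (pieri_state N.+1 K).2 =
   \sum_(i in K) ((1 - t) * x i * y / (1 - x i * y) * hl_factor_r (K :\ i) (x i)) *: (pieri_state N.+1 (K :\ i)).1.
  pose w' k : {linear V -> V} := H (#|K|.-1 - k).
  have hU i : i \in K ->
    ((1 - t) * x i * y / (1 - x i * y) * hl_factor_r (K :\ i) (x i)) *: (pieri_state N.+1 (K :\ i)).1 =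
    (y * xprod K) *: G (((1 - t) / (1 - t * x i * y) * hl_factor_r (K :\ i) (x i)) *:
      \sum_(L : {set I} | L \subset K :\ i) hl_cross L (K :\ i :\: L) *: (kernel_factor y K *: w' #|L| (chains N L))).
    move=> iiK; have Ki : #|K :\ i| = #|K|.-1 by rewrite (cardsD1 i K) iiK.
    rewrite -IHa' // chainsS /chain_step (xprodD1 iiK) [in RHS]linearZ /= !scalerA.
    under [in RHS]eq_bigr do rewrite scalerA mulrC -scalerA.
    rewrite -scaler_sumr (linearZ_LR G) /= scalerA; congr (_ *: G _).
      rewrite -[in RHS](setD1K iiK) kernel_factorU1 ?setD11 //.
      rewrite [in RHS](setD1K iiK).
      by field; rewrite xy1 txy1.
    by apply: eq_bigr => L sL; rewrite Hsub // /w' Ki.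
  rewrite (eq_bigr _ hU) -scaler_sumr -(linear_sum G) regroup_in pieri_stateS /=.
  congr (_ *: G _).
  apply: (@addIr _ (\sum_(L : {set I} | L \subset K)
     hl_cross L (K :\: L) *: (t ^+ #|K :\: L| *: H #|K :\: L|.-1 (pieri_state N L).1))).
  rewrite -!big_split /=.
  transitivity (\sum_(L : {set I} | L \subset K) hl_cross L (K :\: L) *:
      (w' #|L| (pieri_state N L).1 + w' #|L|.-1 (pieri_state N L).2)).
    apply: eq_bigr => L sL; rewrite -scalerDr addrAC -scalerDl subrK scale1r /w'.
    rewrite Hsub // predn_sub; congr (_ *: (_ + _)).
    case: (eqVneq L set0) => [->|]; first by rewrite pieri_state_set0 !linear0.
    rewrite -card_gt0 => L0; congr (H _ _).
    by have := subset_leq_card sL; lia.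
  rewrite -IHb scaler_sumr; apply: eq_bigr => L sL.
  rewrite -scaler_suml (sum_hl_factor_r_kernel y0 xy1 txy1) -IHa /w'.
  rewrite -predn_sub -Hsub // (linearZ_LR (H _)) /= !scalerA -scalerDl.
  congr (_ *: _); rewrite (kernel_factorD y sL); field.
  exact: kernel_factor_neq0.
move: (pieri_state N.+1) (chains N.+1) IHa' claim => r c IHa' claim.
rewrite scaler_sumr.
under [LHS]eq_bigr => K sK.
  rewrite (_ : kernel_factor y J *: (hl_cross K (J :\: K) *: w #|K| (c K)) =
     hl_cross K (J :\: K) *: (kernel_factor y (J :\: K) *: w #|K| (r K).1)); last first.
    by rewrite -IHa' (linearZ_LR (w _)) /= (kernel_factorD y sK) !scalerA; congr (_ *: _); ring.
  rewrite (kernel_factor_partial_fractions y0 xy1).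
  rewrite scalerDl scale1r scaler_suml scalerDr.
  over.
rewrite big_split /= (regroup_out J (fun i => (1 - t) * x i * y / (1 - x i * y))
  (fun K => w #|K| (r K).1)) -big_split.
apply: eq_bigr => K sK /=.
rewrite -scalerDr claim // (linear_sum (w #|K|.-1)) /=; congr (_ *: (_ + _)).
apply: eq_bigr => i iK; rewrite (linearZ_LR (w _)) /= [in RHS](cardsD1 i K) iK //.
Qed.
End Pieri.
End Chains.
End PartialFractions.

(** * Evaluation at z = 1, adding one variable at a time *)

Section Combine.
Variables (F : fieldType) (s : F).
Local Notation t := (s ^+ 2).
Local Notation V := (laurent F).
Local Notation G := (gauss s).
Hypothesis s0 : s != 0.
Hypothesis two0 : 2%:R != 0 :> F.
Hypothesis t_generic : forall i, (0 < i)%N -> 1 - t ^+ i != 0.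
Variables (I : finType) (x : I -> F).
Hypothesis x_inj : injective x.
Hypothesis x0 : forall i, x i != 0.
Hypothesis xtx : forall i j, x i - t * x j != 0.
Hypothesis xx1 : forall i j, 1 - x i * x j != 0.
Hypothesis txx1 : forall i j, 1 - t * x i * x j != 0.

Definition rs_lin (m : nat) : {linear V -> V} := rs s m.
Definition gauss_lin : {linear V -> V} := G.

Local Notation cross := (hl_cross t x).
Local Notation chains := (chains t x rs_lin gauss_lin (delta0 F)).
Local Notation lstep := (branch_step t x rs_lin gauss_lin).
Local Notation rstep y := (pieri_step t x rs_lin gauss_lin y).

Definition chain_sum (N : nat) (J : {set I}) : V :=
  \sum_(K : {set I} | K \subset J) cross K (J :\: K) *: chains N K.

Section OneVariable.
Variable i0 : I.
Local Notation y := (x i0).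
Local Notation lstep := (lstep i0).
Local Notation rstep := (rstep y).

(* [lbal] and [rbal] are the balanced initial states.  They differ from the initial
   states of the branching and Pieri rules, scaled by 1 - s y and 1 + s y, by [lrem]
   and [rrem], which do not contribute in low degree. *)
Definition lbal (J : {set I}) : V * V :=
  if J == set0 then ((1 - s * y) *: delta0 F, (s * y) *: zsum (delta0 F)) else (0, 0).
Definition rbal (J : {set I}) : V * V :=
  if J == set0 then ((1 + s * y) *: delta0 F, 0) else (0, 0).

Lemma balanced_iter N J :
  balanced s y (iter N lstep lbal J).1 (iter N lstep lbal J).2
               (iter N rstep rbal J).1 (iter N rstep rbal J).2.
Proof.
elim: N J => [|N IH] J.
  rewrite /= /lbal /rbal; case: eqP => _ /=; last exact: balanced0.
  exact: balanced_init.
rewrite !iterS; move: (iter N lstep lbal) (iter N rstep rbal) IH => X Y IH.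
pose b K (p : V) := (xprod x J * cross K (J :\: K)) *: p.
pose m K := #|J :\: K|.
have -> : (lstep X J).1 = \sum_(K : {set I} | K \subset J)
    b K (G (rs s (m K) (X K).1 + rsd s (m K) (X K).2)).
  rewrite [LHS]/= linear_sum scaler_sumr; apply: eq_bigr => K _.
  by rewrite (linearZ_LR gauss_lin) scalerA.
have -> : (lstep X J).2 = \sum_(K : {set I} | K \subset J)
    b K (y *: G (rs s (m K).+1 (X K).1 + rs s (m K) (X K).2)).
  rewrite [LHS]/= linear_sum scaler_sumr; apply: eq_bigr => K _.
  by rewrite (linearZ_LR gauss_lin) /b !scalerA; congr (_ *: _); ring.
have -> : (rstep Y J).1 = \sum_(K : {set I} | K \subset J)
    b K (G (rs s (m K) (Y K).1 + rs s (m K).+1 (Y K).2)).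
  rewrite [LHS]/= linear_sum scaler_sumr; apply: eq_bigr => K _.
  by rewrite (linearZ_LR gauss_lin) scalerA.
have -> : (rstep Y J).2 = \sum_(K : {set I} | K \subset J)
    b K (y *: G (rsd s (m K) (Y K).1 + rs s (m K) (Y K).2)).
  rewrite [LHS]/= linear_sum scaler_sumr; apply: eq_bigr => K _.
  by rewrite (linearZ_LR gauss_lin) /b !scalerA; congr (_ *: _); ring.
apply: balanced_sum => K _; apply: balancedZ; apply: balanced_step => //.
Qed.

Lemma scaled_sum_linear (c k : F) (P : pred {set I}) (A : {set I} -> F) (f g h : {set I} -> V) :
  (forall K, f K = c *: g K + h K) ->
  k *: gauss_lin (\sum_(K : {set I} | P K) A K *: f K) =
  c *: (k *: gauss_lin (\sum_(K : {set I} | P K) A K *: g K))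
  + k *: gauss_lin (\sum_(K : {set I} | P K) A K *: h K).
Proof.
move=> fE; rewrite [c *: _]scalerA [c * k]mulrC -scalerA -scalerDr; congr (_ *: _).
rewrite -(linearZ_LR gauss_lin) -(linearD gauss_lin); congr (gauss_lin _).
rewrite scaler_sumr -big_split; apply: eq_bigr => K _ /=.
by rewrite fE scalerDr !scalerA mulrC.
Qed.

Lemma lstep_linear c X Y J :
  lstep (fun K => c *: X K + Y K) J = c *: lstep X J + lstep Y J.
Proof.
rewrite /branch_step; congr pair; apply: scaled_sum_linear => K /=;
  by rewrite !linearP /= !scalerDr ?scalerA addrACA // ?[c * _]mulrC.
Qed.
Lemma rstep_linear c X Y J :
  rstep (fun K => c *: X K + Y K) J = c *: rstep X J + rstep Y J.
Proof.
rewrite /pieri_step; congr pair; apply: scaled_sum_linear => K /=;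
  by rewrite !linearP /= ?scalerDr ?scalerA addrACA // ?[c * _]mulrC.
Qed.

Lemma iter_linear (f : ({set I} -> V * V) -> {set I} -> V * V) :
  (forall c X Y J, f (fun K => c *: X K + Y K) J = c *: f X J + f Y J) ->
  forall N c X Y J, iter N f (fun K => c *: X K + Y K) J = c *: iter N f X J + iter N f Y J.
Proof.
move=> h N c X Y; elim: N => [|N IH] J //=.
by rewrite -h; congr (f _ _); apply: funext.
Qed.

Definition lrem (J : {set I}) : V * V :=
  (0, if J == set0 then (s * y) *: zsum (delta0 F) else 0).
Definition rrem (J : {set I}) : V * V :=
  (0, - (1 + s * y) *: singletons t x (delta0 F) y J).

Lemma chain_sum_recurrence N (J : {set I}) : i0 \notin J ->
  (1 - s * y) *: chain_sum N (i0 |: J) - (1 + s * y) *: (kernel_factor t x y J *: chain_sum N J) =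
  \sum_(K : {set I} | K \subset J) cross K (J :\: K) *:
    ((iter N lstep lbal K).1 + (iter N lstep lbal K).2
     - (iter N rstep rbal K).1 - (iter N rstep rbal K).2)
  - \sum_(K : {set I} | K \subset J) cross K (J :\: K) *:
    ((iter N lstep lrem K).1 + (iter N lstep lrem K).2
     - (iter N rstep rrem K).1 - (iter N rstep rrem K).2).
Proof.
move=> iJ.
pose w (k : nat) : {linear V -> V} := idfun.
have t0 : t != 0 by rewrite expf_neq0.
have [bA bB] := @branching _ _ _ _ x_inj t0 _ rs_lin gauss_lin (delta0 F) i0 (xtx i0) N.
have [pA pB] := @pieri _ _ _ _ x_inj t0 _ rs_lin gauss_lin (delta0 F) y (x0 _)
  (fun i => xx1 i _) (fun i => txx1 i _) N.
rewrite (pB J w) /chain_sum.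
rewrite (@branching_split _ _ _ _ _ _ _ (chains N)
  (fun K => (branch_state t x rs_lin gauss_lin (delta0 F) i0 N K).2) w) //;
  last first.
  by move=> K sK; apply: bA; apply: contra iJ; apply: (subsetP sK).
rewrite (bB J w iJ) /w /=.
have hl K : (1 - s * y) *: branch_state t x rs_lin gauss_lin (delta0 F) i0 N K =
    iter N lstep lbal K - iter N lstep lrem K.
  apply/eqP; rewrite -subr_eq opprK -(iter_linear lstep_linear) eq_sym; apply/eqP.
  congr (iter N lstep _ K); apply: funext => L.
  rewrite /lrem /lbal /only_empty; case: eqP => _; congr pair => /=;
   by rewrite ?addr0 ?scaler0 ?add0r.
have hr K : (1 + s * y) *: pieri_state t x rs_lin gauss_lin (delta0 F) y N K =
    iter N rstep rbal K - iter N rstep rrem K.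
  apply/eqP; rewrite -subr_eq opprK -(iter_linear rstep_linear) eq_sym; apply/eqP.
  congr (iter N rstep _ K); apply: funext => L.
  rewrite /rrem /rbal /only_empty; case: eqP => _; congr pair => /=;
   by rewrite ?addr0 ?scaler0 // scaleNr subrr.
have hl1 K : (1 - s * y) *: (branch_state t x rs_lin gauss_lin (delta0 F) i0 N K).1 =
  (iter N lstep lbal K).1 - (iter N lstep lrem K).1 := congr1 fst (hl K).
have hl2 K : (1 - s * y) *: (branch_state t x rs_lin gauss_lin (delta0 F) i0 N K).2 =
  (iter N lstep lbal K).2 - (iter N lstep lrem K).2 := congr1 snd (hl K).
have hr1 K : (1 + s * y) *: (pieri_state t x rs_lin gauss_lin (delta0 F) y N K).1 =
  (iter N rstep rbal K).1 - (iter N rstep rrem K).1 := congr1 fst (hr K).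
have hr2 K : (1 + s * y) *: (pieri_state t x rs_lin gauss_lin (delta0 F) y N K).2 =
  (iter N rstep rbal K).2 - (iter N rstep rrem K).2 := congr1 snd (hr K).
rewrite !scaler_sumr -!sumrB; apply: eq_bigr => K _.
apply: funext => D.
have e1 := congr1 (@^~ D) (hl1 K); have e2 := congr1 (@^~ D) (hl2 K).
have e3 := congr1 (@^~ D) (hr1 K); have e4 := congr1 (@^~ D) (hr2 K).
rewrite !pointwiseE in e1 e2 e3 e4 *.
apply: (add_relation (cross K (J :\: K)) (eq_sub0 e1)).
apply: (add_relation (cross K (J :\: K)) (eq_sub0 e2)).
apply: (add_relation (- cross K (J :\: K)) (eq_sub0 e3)).
apply: (add_relation (- cross K (J :\: K)) (eq_sub0 e4)).
ring.
Qed.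
End OneVariable.

(** * Divisibility of the error by powers of u *)

Section Smallness.
Variables (reg : F -> Prop) (u : F).
Hypothesis u0 : u != 0.
Hypothesis reg1 : reg 1.
Hypothesis regD : forall a b, reg a -> reg b -> reg (a + b).
Hypothesis regN : forall a, reg a -> reg (- a).
Hypothesis regM : forall a b, reg a -> reg b -> reg (a * b).
Hypothesis reg_s : reg s.
Hypothesis reg_u : reg u.
Hypothesis reg_tbinom : forall m k, reg (tbinom s m k).
Hypothesis reg_x : forall i, reg (x i / u).
Hypothesis reg_factor : forall i j, i != j -> reg ((x i - t * x j) / (x i - x j)).
Hypothesis reg_xx : forall i j, reg (1 - x i * x j)^-1.

(* [reg a] stands for regularity of [a] at u = 0, and [small N a] for a = O(u^N). *)
Definition small (N : nat) (a : F) := reg (a / u ^+ N).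

Lemma reg0 : reg 0. Proof. by rewrite -(subrr 1); apply: regD => //; apply: regN. Qed.
Lemma regX a n : reg a -> reg (a ^+ n).
Proof. by move=> h; elim: n => [|n IH]; rewrite ?expr0 // exprS; apply: regM. Qed.
Lemma reg_prod (J : Type) (r : seq J) (P : pred J) (f : J -> F) :
  (forall j, P j -> reg (f j)) -> reg (\prod_(j <- r | P j) f j).
Proof. by move=> h; apply: big_ind. Qed.
Lemma small0 N : small N 0. Proof. by rewrite /small mul0r; apply: reg0. Qed.
Lemma smallD N a b : small N a -> small N b -> small N (a + b).
Proof. by rewrite /small mulrDl; apply: regD. Qed.
Lemma smallN N a : small N a -> small N (- a).
Proof. by rewrite /small mulNr; apply: regN. Qed.
Lemma small_mul M N a b : small M a -> small N b -> small (M + N) (a * b).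
Proof. by rewrite /small exprD invfM mulrACA; apply: regM. Qed.
Lemma smallM N a b : reg a -> small N b -> small N (a * b).
Proof. by rewrite /small -mulrA; apply: regM. Qed.
Lemma smallMx N i b : small N b -> small N.+1 (x i * b).
Proof. by rewrite -add1n; apply: small_mul; rewrite /small expr1. Qed.
Lemma small_sum N (J : Type) (r : seq J) (P : pred J) (f : J -> F) :
  (forall j, P j -> small N (f j)) -> small N (\sum_(j <- r | P j) f j).
Proof. by move=> h; apply: big_ind; [exact: small0 | exact: smallD |]. Qed.

Lemma reg_xi i : reg (x i).
Proof. by rewrite -(divfK u0 (x i)); apply: regM. Qed.
Lemma reg_t : reg t. Proof. exact: regX. Qed.
Lemma reg_cross (J K : {set I}) : [disjoint J & K] -> reg (cross J K).
Proof.
move=> dJK; apply: reg_prod => i iJ; apply: reg_prod => j jK; apply: reg_factor.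
by apply: contraTneq jK => <-; rewrite (disjointFr dJK iJ).
Qed.

Definition vsmall N (f : V) := forall D, small N (f D).
Lemma vsmall0 N : vsmall N 0. Proof. by move=> D; apply: small0. Qed.
Lemma vsmallD N f g : vsmall N f -> vsmall N g -> vsmall N (f + g).
Proof. by move=> hf hg D; apply: smallD. Qed.
Lemma vsmallZ N c f : reg c -> vsmall N f -> vsmall N (c *: f).
Proof. by move=> hc hf D; apply: smallM. Qed.
Lemma vsmall_sum N (J : Type) (r : seq J) (P : pred J) (f : J -> V) :
  (forall j, P j -> vsmall N (f j)) -> vsmall N (\sum_(j <- r | P j) f j).
Proof. by move=> h; apply: big_ind; [exact: vsmall0 | exact: vsmallD |]. Qed.
Lemma vsmallH N m f : vsmall N f -> vsmall N (rs s m f).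
Proof. by move=> h D; apply: small_sum => k _; apply: smallM. Qed.
Lemma vsmallG N f : vsmall N f -> vsmall N (gauss s f).
Proof.
move=> h D; apply: smallM => //.
have -> : D * D = (`|D| * `|D|)%N%:Z by lia.
exact: regX.
Qed.

Lemma vsmall_xprod N (J : {set I}) (f : V) : J != set0 -> vsmall N f -> vsmall N.+1 (xprod x J *: f).
Proof.
move=> /set0Pn[i iJ] h; rewrite (xprodD1 x iJ) -scalerA => D.
rewrite ptZ; apply: smallMx; rewrite ptZ; apply: smallM => //.
by apply: reg_prod => j _; apply: reg_xi.
Qed.

(** A column gains a variable from [xprod x J], except in the first component at the empty set,
    which must therefore vanish. The second component always gains the factor y. *)
Definition pair_small N (X : {set I} -> V * V) :=
  (X set0).1 = 0 /\ forall J, vsmall N (X J).1 /\ vsmall N (X J).2.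

Lemma subset0_sum (f : {set I} -> V) : \sum_(K : {set I} | K \subset set0) f K = f set0.
Proof. by under eq_bigl do rewrite subset0; rewrite big_pred1_eq. Qed.

Lemma lstep_small i0 N X : pair_small N X -> pair_small N.+1 (lstep i0 X).
Proof.
move=> [X0 hX]; split.
  rewrite /= subset0_sum setD0 cards0 expr0 subrr scale0r addr0 X0.
  by rewrite linear0 scaler0 linear0 scaler0.
move=> J; split.
  case: (eqVneq J set0) => [->|J0] /=.
    rewrite subset0_sum setD0 cards0 expr0 subrr scale0r addr0 X0.
    by rewrite linear0 scaler0 linear0 scaler0; apply: vsmall0.
  apply: vsmall_xprod => //; apply: vsmallG; apply: vsmall_sum => K sK.
  have [h1 h2] := hX K.
  apply: vsmallZ; first by apply: reg_cross; rewrite -setI_eq0 setIDA setIC -setIDA setDv setI0.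
  apply: vsmallD; first exact: vsmallH.
  apply: vsmallZ; last exact: vsmallH.
  by apply: regD => //; apply: regN; apply: regX; apply: reg_t.
rewrite /= -scalerA => D; rewrite ptZ; apply: smallMx; move: D.
apply: vsmallZ; first by apply: reg_prod => j _; apply: reg_xi.
apply: vsmallG; apply: vsmall_sum => K sK.
have [h1 h2] := hX K.
apply: vsmallZ; first by apply: reg_cross; rewrite -setI_eq0 setIDA setIC -setIDA setDv setI0.
by apply: vsmallD; apply: vsmallH.
Qed.

(** On the Pieri side the remainder vanishes entirely at the empty set, so [xprod x J] alone
    supplies the variable. *)
Definition rpair_small N (X : {set I} -> V * V) :=
  X set0 = (0, 0) /\ forall J, vsmall N (X J).1 /\ vsmall N (X J).2.

Lemma rstep_small y N X : reg y -> rpair_small N X -> rpair_small N.+1 (rstep y X).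
Proof.
move=> ry [X0 hX].
have h0 : rstep y X set0 = (0, 0).
  rewrite /pieri_step /= !subset0_sum setD0 cards0 expr0 subrr scale0r X0 /=.
  by rewrite !(linear0, addr0, scaler0).
split=> // J; case: (eqVneq J set0) => [->|J0].
  by rewrite h0; split; apply: vsmall0.
split=> /=.
  apply: vsmall_xprod => //; apply: vsmallG; apply: vsmall_sum => K sK.
  have [h1 h2] := hX K.
  apply: vsmallZ; first by apply: reg_cross; rewrite -setI_eq0 setIDA setIC -setIDA setDv setI0.
  by apply: vsmallD; apply: vsmallH.
rewrite -scalerA; apply: vsmallZ => //.
apply: vsmall_xprod => //; apply: vsmallG; apply: vsmall_sum => K sK.
have [h1 h2] := hX K.
apply: vsmallZ; first by apply: reg_cross; rewrite -setI_eq0 setIDA setIC -setIDA setDv setI0.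
apply: vsmallD; last exact: vsmallH.
apply: vsmallZ; last exact: vsmallH.
by apply: regD => //; apply: regN; apply: regX; apply: reg_t.
Qed.

Lemma vsmall_delta0 : vsmall 0 (delta0 F).
Proof.
move=> D; rewrite /small divr1 /delta0; case: eqP => _ //; exact: reg0.
Qed.

Lemma lrem_small i0 N : pair_small N (iter N (lstep i0) (lrem i0)).
Proof.
elim: N => [|N IH]; last by rewrite iterS; apply: lstep_small.
split=> //= J; split; first exact: vsmall0.
case: eqP => _; last exact: vsmall0.
apply: vsmallZ; first by apply: regM => //; apply: reg_xi.
by move=> D; apply: smallD; apply: vsmall_delta0.
Qed.

Lemma rrem_small i0 N : rpair_small N (iter N (rstep (x i0)) (rrem i0)).
Proof.
elim: N => [|N IH]; last by rewrite iterS; apply: rstep_small => //; apply: reg_xi.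
have rx := reg_xi.
split=> [|J] /=.
  rewrite /rrem /singletons big1 ?scaler0 // => i /eqP e.
  by have := set11 i; rewrite -e inE.
split; first exact: vsmall0.
apply: vsmallZ; first by apply: regN; apply: regD => //; apply: regM.
apply: vsmall_sum => i _; apply: vsmallZ; last exact: vsmall_delta0.
apply: regM => //; apply: regM => //; apply: regM => //.
by apply: regD => //; apply: regN; apply: reg_t.
Qed.

Definition at1 (M : nat) (f : V) : F := \sum_(k < (2 * M).+1) f (k%:Z - M%:Z).
Lemma at1D M f g : at1 M (f + g) = at1 M f + at1 M g.
Proof. by rewrite /at1 -big_split. Qed.
Lemma at1Z M c f : at1 M (c *: f) = c * at1 M f.
Proof. by rewrite /at1 mulr_sumr. Qed.
Lemma at1N M f : at1 M (- f) = - at1 M f.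
Proof. by rewrite /at1 -sumrN. Qed.
Lemma at1_small M N f : vsmall N f -> small N (at1 M f).
Proof. by move=> h; apply: small_sum => k _; apply: h. Qed.

Lemma vsmallN N f : vsmall N f -> vsmall N (- f).
Proof. by move=> h D; apply: smallN; apply: h. Qed.

Lemma at1_chain_sum_recurrence N i0 (J : {set I}) : i0 \notin J ->
  exists M0, forall M, (M0 <= M)%N ->
  small N ((1 - s * x i0) * at1 M (chain_sum N (i0 |: J))
           - (1 + s * x i0) * (kernel_factor t x (x i0) J * at1 M (chain_sum N J))).
Proof.
move=> iJ.
have bal := @balanced_sum F s (x i0) _ (index_enum {set I}) (fun K => K \subset J)
  _ _ _ _ (fun K _ => balancedZ (cross K (J :\: K)) (balanced_iter i0 N K)).
have [M0 hM0] := balanced_eval s0 two0 bal; exists M0 => M leM.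
rewrite -!at1Z -at1N -at1D chain_sum_recurrence //.
rewrite at1D [X in X + _](_ : _ = 0); last first.
  rewrite -[RHS](hM0 M leM) -/(at1 M _); congr (at1 M _).
  by rewrite -big_split -!sumrB; apply: eq_bigr => K _; rewrite !scalerBr scalerDr.
rewrite add0r; apply/at1_small/vsmallN/vsmall_sum => K sK.
have [_ hl] := lrem_small i0 N; have [_ hr] := rrem_small i0 N.
have [l1 l2] := hl K; have [r1 r2] := hr K.
apply: vsmallZ; first by apply: reg_cross; rewrite -setI_eq0 setIDA setIC -setIDA setDv setI0.
by repeat apply: vsmallD => //; apply: vsmallN.
Qed.

End Smallness.
End Combine.

(** * The product formula modulo u^N, by induction on the number of variables *)

Section MainIdentity.
Variables (F : fieldType) (s : F) (n : nat) (x : 'I_n -> F).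
Local Notation t := (s ^+ 2).
Hypothesis s0 : s != 0.
Hypothesis two0 : 2%:R != 0 :> F.
Hypothesis t_generic : forall i, (0 < i)%N -> 1 - t ^+ i != 0.
Hypothesis x_inj : injective x.
Hypothesis x0 : forall i, x i != 0.
Hypothesis xtx : forall i j, x i - t * x j != 0.
Hypothesis xx1 : forall i j, 1 - x i * x j != 0.
Hypothesis txx1 : forall i j, 1 - t * x i * x j != 0.
Hypothesis sx1 : forall i, 1 - s * x i != 0.
Variables (reg : F -> Prop) (u : F).
Hypothesis u0 : u != 0.
Hypothesis reg1 : reg 1.
Hypothesis regD : forall a b, reg a -> reg b -> reg (a + b).
Hypothesis regN : forall a, reg a -> reg (- a).
Hypothesis regM : forall a b, reg a -> reg b -> reg (a * b).
Hypothesis reg_s : reg s.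
Hypothesis reg_u : reg u.
Hypothesis reg_tbinom : forall m k, reg (tbinom s m k).
Hypothesis reg_x : forall i, reg (x i / u).
Hypothesis reg_factor : forall i j, i != j -> reg ((x i - t * x j) / (x i - x j)).
Hypothesis reg_xx : forall i j, reg (1 - x i * x j)^-1.
Hypothesis reg_sx : forall i, reg (1 - s * x i)^-1.

Definition initial_set (m : nat) : {set 'I_n} := [set i : 'I_n | (i < m)%N].

(** Variables enter in increasing order, so the kernel of the k-th runs over the earlier ones; this
    yields the product over pairs j < k. The bound [M0] makes the window of exponents contain the
    supports of the witnesses chi. *)
Lemma truncated_identity N : exists M0, forall M, (M0 <= M)%N ->
  small reg u N (at1 M (chain_sum s x N [set: 'I_n]) -
    \prod_(k < n) ((1 + s * x k) / (1 - s * x k) * kernel_factor t x (x k) (initial_set k))).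
Proof.
suff key m : (m <= n)%N -> exists M0, forall M, (M0 <= M)%N ->
  small reg u N (at1 M (chain_sum s x N (initial_set m)) -
    \prod_(k < n | (k < m)%N) ((1 + s * x k) / (1 - s * x k) * kernel_factor t x (x k) (initial_set k))).
  have [M0 h] := key n (leqnn n); exists M0 => M /h.
  have -> : initial_set n = setT by apply/setP => i; rewrite !inE ltn_ord.
  by rewrite [X in _ - X](eq_bigl xpredT) // => k; rewrite ltn_ord.
elim: m => [|m IH] mn.
  exists 0%N => M _.
  rewrite big_pred0 // (_ : initial_set 0 = set0); last by apply/setP => i; rewrite !inE.
  rewrite /chain_sum subset0_sum setD0 hl_cross0l scale1r.
  have -> : chains t x (rs_lin s) (gauss_lin s) (delta0 F) N set0 = delta0 F.
    elim: N => [|N IHN]; first by rewrite /chains /= /only_empty eqxx.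
    rewrite chainsS /chain_step subset0_sum setD0 hl_cross0l xprod0 !scale1r cards0 IHN.
    rewrite /= rs0 //; apply: funext => D; rewrite ptG /delta0.
    by case: eqP => [->|_] /=; [rewrite mulr0 expr0z mul1r|rewrite mulr0].
  rewrite /at1 (bigD1 (inord M)) //= inordK; last by lia.
  rewrite subrr /delta0 eqxx big1 ?addr0 ?subrr; first exact: small0.
  move=> k; rewrite -val_eqE /= inordK; last by lia.
  move=> kM; case: eqP => // e; case/negP: kM; lia.
have [M1 h1] := IH (ltnW mn).
pose i0 : 'I_n := Ordinal mn.
have iN : i0 \notin initial_set m by rewrite inE ltnn.
have initial_setS : initial_set m.+1 = i0 |: initial_set m.
  by apply/setP => i; rewrite !inE -val_eqE /= ltnS leq_eqVlt.
have [M2 h2] := @at1_chain_sum_recurrence _ _ s0 two0 t_generic _ _ x_inj x0 xtx xx1 txx1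
  reg u u0 reg1 regD regN regM reg_s reg_u reg_tbinom reg_x reg_factor reg_xx N i0 _ iN.
exists (maxn M1 M2) => M; rewrite geq_max => /andP[/h1 {}h1 /h2 {}h2].
rewrite initial_setS (bigD1 i0) //= (eq_bigl (fun k : 'I_n => (k < m)%N)); last first.
  by move=> k; rewrite -val_eqE /= ltnS leq_eqVlt; case: ltngtP.
set P := \prod_(k < n | _) _ in h1 *.
set a := at1 M _ in h1 h2 *; set b := at1 M _ in h1 h2 *.
have rx i : reg (x i) by rewrite -(divfK u0 (x i)); apply: regM.
have rg : reg (kernel_factor t x (x i0) (initial_set m)).
  apply: reg_prod => // j _; apply: regM => //.
  by apply: regD => //; apply: regN; do 2!apply: regM => //; apply: regX.
have -> : b - (1 + s * x i0) / (1 - s * x i0) * kernel_factor t x (x i0) (initial_set m) * P =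
   (1 - s * x i0)^-1 * ((1 - s * x i0) * b - (1 + s * x i0) * (kernel_factor t x (x i0) (initial_set m) * a))
   + (1 + s * x i0) * (1 - s * x i0)^-1 * kernel_factor t x (x i0) (initial_set m) * (a - P).
  by field; apply: sx1.
apply: smallD => //; apply: smallM => //.
apply: regM => //; apply: regM => //; apply: regD => //; exact: regM.
Qed.
End MainIdentity.

(** * Hall-Littlewood polynomials as sums over subsets *)

Section PermutationSums.
Variables (F : fieldType) (t : F).

Lemma sum_perm_lift (n : nat) (f : 'S_n.+1 -> F) :
  \sum_w f w = \sum_(i < n.+1) \sum_(w : 'S_n) f (lift_perm ord0 i w).
Proof.
rewrite (partition_big (fun w : 'S_n.+1 => w ord0) predT) //=; apply: eq_bigr => i _.
have inj (w : 'S_n.+1) : injective (fun k => odflt k (unlift (w ord0) (w (lift ord0 k)))).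
  move=> k l.
  have E m : exists2 m', w (lift ord0 m) = lift (w ord0) m' & unlift (w ord0) (w (lift ord0 m)) = Some m'.
    case: unliftP => [m' ->|/perm_inj e]; first by exists m'.
    by have := neq_lift ord0 m; rewrite e eqxx.
  have [k' ek ->] := E k; have [l' el ->] := E l => /= e.
  by apply: (@lift_inj _ ord0); apply: (@perm_inj _ w); rewrite ek el e.
rewrite (reindex (lift_perm ord0 i)).
  by apply: eq_bigl => w; rewrite lift_perm_id eqxx.
exists (fun w => perm (inj w)) => [w _|w /eqP wi]; apply/permP => k.
  by rewrite permE lift_perm_lift lift_perm_id liftK.
case: (unliftP ord0 k) => [k'|] ->; last by rewrite lift_perm_id wi.
rewrite lift_perm_lift permE -wi.
case: unliftP => [m -> //|/perm_inj e].
by have := neq_lift ord0 k'; rewrite e eqxx.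
Qed.

Definition perm_sum (n : nat) (g : 'I_n -> F) (l : seq nat) : F :=
  \sum_(w : 'S_n) ((\prod_(i < n) g (w i) ^+ nth 0%N l i) *
    \prod_(i < n) \prod_(j < n | (i < j)%N) ((g (w i) - t * g (w j)) / (g (w i) - g (w j)))).

Lemma perm_sumS n (g : 'I_n.+1 -> F) a l :
  perm_sum g (a :: l) = \sum_(i < n.+1) g i ^+ a *
    (\prod_(k < n) ((g i - t * g (lift i k)) / (g i - g (lift i k)))) *
    perm_sum (g \o lift i) l.
Proof.
rewrite /perm_sum sum_perm_lift; apply: eq_bigr => i _; rewrite mulr_sumr; apply: eq_bigr => w _.
rewrite !big_ord_recl /= lift_perm_id.
rewrite [X in _ * (X * _)]big_mkcond big_ord_recl /= mul1r.
rewrite [X in _ * (X * _)](_ : _ = \prod_(k < n) ((g i - t * g (lift i k)) / (g i - g (lift i k)))); last first.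
  rewrite [RHS](reindex_inj (@perm_inj _ w)) /=; apply: eq_bigr => k _.
  by rewrite lift_perm_lift.
rewrite -!mulrA; congr (_ * _); rewrite mulrCA; congr (_ * (_ * _)).
  by apply: eq_bigr => k _; rewrite lift_perm_lift.
apply: eq_bigr => k _; rewrite big_mkcond big_ord_recl /= mul1r [RHS]big_mkcond.
by apply: eq_bigr => j _; rewrite !lift_perm_lift.
Qed.
End PermutationSums.

(** * Symmetrization over sets of variables *)

Section SetSums.
Variables (F : fieldType) (t : F) (I : finType) (x : I -> F).
Hypothesis x_inj : injective x.
Hypothesis t0 : t != 0.
Hypothesis t1 : 1 - t != 0.
Hypothesis x0 : forall i, x i != 0.
Local Notation fac := (hl_factor t x).
Local Notation cross := (hl_cross t x).

(** The unnormalized symmetrization over bijections from the entries of l to J, zero if the sizes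
    differ. Indexing by sets allows the exponent list to be cut anywhere. *)
Fixpoint set_sum (l : seq nat) (J : {set I}) : F :=
  if l is a :: l' then \sum_(i in J) x i ^+ a * fac (x i) (J :\ i) * set_sum l' (J :\ i)
  else (J == set0)%:R.

Lemma perm_sum_set_sum n (f : 'I_n -> I) l : injective f -> size l = n ->
  perm_sum t (x \o f) l = set_sum l (f @: setT).
Proof.
move=> + sl; rewrite -{n}sl in f *; elim: l f => [|a l IH] f f_inj /=.
  rewrite /perm_sum (eq_bigl (pred1 1%g)) => [|w]; last first.
    by apply/esym/eqP/permP => -[].
  rewrite big_pred1_eq.
  rewrite !big_ord0 mulr1 (_ : f @: setT = set0) ?eqxx //.
  by apply/setP => i; rewrite inE; apply/negbTE/negP => /imsetP[[]].
rewrite perm_sumS big_imset /=; last by move=> ? ? _ _ /f_inj.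
apply: eq_big => [i|i _]; first by rewrite inE.
have fi_inj : injective (f \o lift i) by move=> ? ? /f_inj /lift_inj.
have -> : (f @: setT) :\ f i = (f \o lift i) @: setT.
  apply/setP => k; rewrite !inE; apply/andP/imsetP => [[ki /imsetP[j _ e]]|[j _ ->]].
    case: (unliftP i j) => [j' e'|e']; last by move: ki; rewrite e e' eqxx.
    by exists j'; rewrite // e e'.
  by rewrite /= (inj_eq f_inj) eq_sym neq_lift; split=> //; apply: imset_f.
rewrite -(IH (f \o lift i)) //; congr (_ * _ * _).
by rewrite /hl_factor big_imset /=; [apply: eq_bigl => k; rewrite inE | move=> ? ? _ _ /fi_inj].
Qed.

Lemma set_sum_card l (J : {set I}) : #|J| != size l -> set_sum l J = 0.
Proof.
elim: l J => [|a l IH] J /= hJ.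
  by case: (J =P set0) hJ => [->|] //; rewrite cards0.
rewrite big1 // => i iJ; rewrite IH ?mulr0 //.
by move: hJ; rewrite (cardsD1 i J) iJ.
Qed.

Lemma set_sum_map_succ l (J : {set I}) : set_sum (map succn l) J = xprod x J * set_sum l J.
Proof.
elim: l J => [|a l IH] J /=.
  by case: eqP => [->|_]; rewrite ?mulr0 // xprod0 mul1r.
rewrite mulr_sumr; apply: eq_bigr => i iJ; rewrite IH (xprodD1 x iJ) exprS.
ring.
Qed.

(** K collects the variables carrying the exponents of [l1]; the cross factor is what remains of the
    product over pairs. *)
Lemma set_sum_cat l1 l2 (J : {set I}) : set_sum (l1 ++ l2) J =
  \sum_(K : {set I} | K \subset J) cross K (J :\: K) * set_sum l1 K * set_sum l2 (J :\: K).
Proof.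
elim: l1 J => [|a l IH] J /=.
  rewrite (bigD1 set0) ?sub0set //= eqxx setD0 hl_cross0l !mul1r big1 ?addr0 //.
  by move=> K /andP[_ /negPf->]; rewrite mulr0 mul0r.
under eq_bigr => i iJ do rewrite IH mulr_sumr.
rewrite (exchange_subset_in J (fun i L => _)).
rewrite (exchange_subset_out J (fun L i => _)).
apply: eq_bigr => K sK; rewrite mulr_sumr mulr_suml; apply: eq_bigr => i iK.
have e1 : J :\ i :\: (K :\ i) = J :\: K.
  apply/setP => k; rewrite !inE; case: (eqVneq k i) => [->|] //=.
  by rewrite iK.
have e3 : fac (x i) (J :\ i) = fac (x i) (K :\ i) * fac (x i) (J :\: K).
  by rewrite /hl_factor (big_setID (K :\ i)) /= (setIidPr (setSD _ sK)) e1.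
have e4 : cross K (J :\: K) = fac (x i) (J :\: K) * cross (K :\ i) (J :\: K).
  by rewrite -hl_crossUl ?setD11 // setD1K.
rewrite e1 e3 e4; ring.
Qed.

Definition tfact (m : nat) : F := \prod_(1 <= i < m.+1) ((1 - t ^+ i) / (1 - t)).
Lemma tfact0 : tfact 0 = 1. Proof. by rewrite /tfact big_geq. Qed.
Lemma tfactS m : tfact m.+1 = tfact m * ((1 - t ^+ m.+1) / (1 - t)).
Proof. by rewrite /tfact big_nat_recr. Qed.

(** This is the normalizing factor v_m(t); its recursion is [sum_hl_factor]. *)
Lemma set_sum_zeros m (J : {set I}) : set_sum (nseq m 0%N) J = if #|J| == m then tfact m else 0.
Proof.
case: ifP => [/eqP|] hJ; last by rewrite set_sum_card // size_nseq hJ.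
elim: m J hJ => [|m IH] J hJ /=; first by rewrite (cards0_eq hJ) eqxx tfact0.
under eq_bigr => i iJ.
  rewrite expr0 mul1r IH; last by move: hJ; rewrite (cardsD1 i) iJ => -[].
  over.
rewrite -mulr_suml tfactS mulrC -hJ -(sum_hl_factor t x_inj) //.
by field.
Qed.
End SetSums.

(** * Partitions built column by column *)

(* The diagram of [l] with a column of length [c] put in front, for size l <= c. *)
Definition addcol (c : nat) (l : seq nat) : seq nat := map succn l ++ nseq (c - size l) 1%N.
Definition positive (l : seq nat) := all (fun x => 0 < x)%N l.

Lemma size_addcol c l : (size l <= c)%N -> size (addcol c l) = c.
Proof. by move=> h; rewrite size_cat size_map size_nseq subnKC. Qed.
Lemma sumn_map_succ l : sumn (map succn l) = (sumn l + size l)%N.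
Proof. by elim: l => //= a l ->; lia. Qed.
Lemma sumn_addcol c l : (size l <= c)%N -> sumn (addcol c l) = (sumn l + c)%N.
Proof. by move=> h; rewrite sumn_cat sumn_map_succ sumn_nseq; lia. Qed.
Lemma positive_addcol c l : positive (addcol c l).
Proof. by rewrite /positive all_cat all_nseq orbT andbT; apply/allP => ? /mapP[? _ ->]. Qed.
Lemma geq_trans : transitive geq.
Proof. by move=> y x z /= h1 h2; apply: leq_trans h2 h1. Qed.
Lemma geq_total : total geq.
Proof. by move=> x y; rewrite /= leq_total. Qed.
Lemma geq_anti : antisymmetric geq.
Proof. by move=> x y /= h; apply/anti_leq; rewrite andbC. Qed.
Lemma sorted_addcol c l : sorted geq l -> sorted geq (addcol c l).
Proof.
move=> sl; rewrite sorted_pairwise; last exact: geq_trans.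
rewrite pairwise_cat -!sorted_pairwise; try exact: geq_trans.
apply/and3P; split.
- by apply/allrelP => a b /mapP[a' _ ->] /nseqP[-> _].
- by rewrite sorted_map; apply: sub_sorted sl => a b /=.
- by elim: (c - size l)%N => // k IH; case: k IH.
Qed.

Lemma mult_addcol1 c l : positive l -> mult 1 (addcol c l) = (c - size l)%N.
Proof.
move=> pl; rewrite /mult count_cat count_nseq /= mul1n (_ : count _ _ = 0%N) //.
apply/eqP; rewrite -leqn0 leqNgt -has_count; apply/hasPn => a /mapP[b bl ->].
by move/allP: pl => /(_ b bl) /=; rewrite eqSS; case: b {bl}.
Qed.
Lemma mult_addcolS c l i : mult i.+2 (addcol c l) = mult i.+1 l.
Proof.
rewrite /mult count_cat count_nseq /= mul0n addn0 count_map.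
by apply: eq_count => a /=; rewrite eqSS.
Qed.
Lemma mult_large i l : (sumn l < i)%N -> mult i l = 0%N.
Proof.
move=> h; apply/count_memPn; apply/negP => il; move: h; rewrite ltnNge => /negP; apply.
elim: l il => //= a l IH; rewrite inE => /orP[/eqP->|/IH]; lia.
Qed.

Section MultProducts.
Variables (R : comNzRingType) (f : nat -> R).
Hypothesis f0 : f 0%N = 1.
(** Covers b_lambda, with [phi], and the part of v_lambda coming from nonzero parts, with [vm]. *)
Definition mult_prod (l : seq nat) : R := \prod_(1 <= i < (sumn l).+1) f (mult i l).
Lemma mult_prod_widen l B : (sumn l <= B)%N -> \prod_(1 <= i < B.+1) f (mult i l) = mult_prod l.
Proof.
move=> h; rewrite (@big_cat_nat _ _ _ (sumn l).+1) //= [X in _ * X]big_nat_cond.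
rewrite [X in _ * X]big1 ?mulr1 // => i /andP[/andP[hi _] _].
by rewrite mult_large.
Qed.
Lemma mult_prod_addcol c l : positive l -> (size l <= c)%N ->
  mult_prod (addcol c l) = f (c - size l)%N * mult_prod l.
Proof.
move=> pl hc; case: (posnP c) hc => [-> |c0 hc].
  rewrite leqn0 size_eq0 => /eqP->.
  by rewrite /mult_prod /addcol /= sub0n /= f0 mul1r.
rewrite [LHS]/mult_prod sumn_addcol // big_ltn; last by lia.
rewrite mult_addcol1 //; congr (_ * _).
rewrite (_ : (sumn l + c).+1 = ((sumn l + c.-1).+2)); last by lia.
rewrite big_add1 /=.
rewrite -(@mult_prod_widen l (sumn l + c.-1)) ?leq_addr // !big_nat; apply: eq_bigr => i /andP[hi _].
by case: i hi => // i _; rewrite mult_addcolS.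
Qed.
End MultProducts.

Lemma punion_addcol a b mu nu : (size mu <= a)%N -> (size nu <= b)%N ->
  punion (addcol a mu) (addcol b nu) = addcol (a + b) (punion mu nu).
Proof.
move=> ha hb; apply: (sorted_eq geq_trans geq_anti).
- exact: sort_sorted geq_total _.
- by apply: sorted_addcol; apply: sort_sorted geq_total _.
rewrite perm_sort /addcol size_sort size_cat.
apply/seq.permP => P; rewrite /punion !count_cat !count_map !count_nseq.
rewrite (seq.permP (permEl (perm_sort _ _))) count_cat.
set u := count _ mu; set v := count _ nu; case: (P 1%N); lia.
Qed.

(** Hence a column of length c contributes c^2 to the pairing with rho. *)
Lemma sum_odds c : (\sum_(i < c) (2 * i).+1 = c * c)%N.
Proof. by elim: c => [|c IH]; rewrite ?big_ord0 // big_ord_recr /= IH; lia. Qed.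

Lemma ip_rho_widen l n : (size l <= n)%N -> ip_rho l = (\sum_(i < n) nth 0 l i * rho i)%N.
Proof.
move=> h; rewrite /ip_rho (big_ord_widen n (fun i => nth 0 l i * rho i)%N h).
rewrite [RHS](bigID (fun i : 'I_n => i < size l)%N) /= [X in (_ + X)%N]big1 ?addn0 // => i.
by rewrite -leqNgt => hi; rewrite nth_default.
Qed.
Lemma ip_rho_addcol c l : (size l <= c)%N -> ip_rho (addcol c l) = (ip_rho l + c * c)%N.
Proof.
move=> h; rewrite /ip_rho size_addcol // -/(ip_rho l) (ip_rho_widen h) -sum_odds -big_split.
apply: eq_bigr => i _ /=; rewrite /addcol nth_cat size_map /rho.
case: ltnP => hi; first by rewrite (nth_map 0%N) //; lia.
by rewrite nth_nseq (nth_default _ hi); case: ltnP; have := ltn_ord i; lia.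
Qed.
Lemma ip_rho_padd mu nu : ip_rho (padd mu nu) = (ip_rho mu + ip_rho nu)%N.
Proof.
rewrite (ip_rho_widen (leq_maxl (size mu) (size nu))) (ip_rho_widen (leq_maxr (size mu) (size nu))).
rewrite /ip_rho size_mkseq -big_split; apply: eq_bigr => i _ /=.
by rewrite nth_mkseq // mulnDl.
Qed.

Lemma sq_neq0 : sq != 0.
Proof. by rewrite /sq tofrac_eq0 polyX_eq0. Qed.

(** The exponent of s grows by 2 (a^2 + b^2) - (a + b)^2 = (a - b)^2. In the quotient of the b's
    only the multiplicities of the part 1 are new, and they form the t-binomial. *)
Lemma coef_addcol a b mu nu :
  positive mu -> positive nu -> (size mu <= a)%N -> (size nu <= b)%N ->
  coef (addcol a mu) (addcol b nu) =
  sq ^ ((a%:Z - b%:Z) * (a%:Z - b%:Z)) *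
  tbinom sq (a + b - size mu - size nu) (a - size mu) * coef mu nu.
Proof.
move=> pm pn ha hb; rewrite /coef punion_addcol //.
have pu : positive (punion mu nu) by rewrite /positive all_sort all_cat; apply/andP.
have su : size (punion mu nu) = (size mu + size nu)%N by rewrite size_sort size_cat.
have phi0 : phi 0 = 1 by rewrite /phi big_geq.
rewrite -![blam _]/(mult_prod phi _) !mult_prod_addcol ?su //; last by lia.
rewrite !ip_rho_padd !ip_rho_addcol ?su //; last by lia.
rewrite (_ : 2 * _ - _ = (a%:Z - b%:Z) * (a%:Z - b%:Z) +
  (2 * (ip_rho mu + ip_rho nu)%N%:Z - (ip_rho (punion mu nu))%:Z)); last by lia.
rewrite expfzDr ?sq_neq0 // -!mulrA; congr (_ * _); rewrite [RHS]mulrCA; congr (_ * _).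
rewrite /tbinom ifT; last by lia.
rewrite (_ : a + b - size mu - size nu - (a - size mu) = b - size nu)%N; last by lia.
rewrite (_ : a + b - (size mu + size nu) = a + b - size mu - size nu)%N; last by lia.
rewrite -![poch sq _]/(phi _) -[RHS]mulrA [X in _ = _ * X]mulrCA -invfM.
by congr (_ * (_ / _)); ring.
Qed.

(** Parts at most N and at most B of them, generated by columns so that the recursion matches
    [chain_step]. *)
Fixpoint bounded_partitions (N B : nat) : seq (seq nat) :=
  if N is N'.+1 then
    [seq addcol (size l + i) l | l <- bounded_partitions N' B, i <- index_iota 0 (B.+1 - size l)]
  else [:: [::]].

Definition decol (l : seq nat) := [seq x.-1 | x <- l & (1 < x)%N].

Lemma decolK l : is_partition l -> l = addcol (size l) (decol l).
Proof.
move=> /andP[sl pl]; rewrite /addcol; elim: l sl pl => //= a l IH pal /andP[a0 pl].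
have sl := path_sorted pal.
rewrite /decol /=; case: ltnP => a1 /=.
  by rewrite subSS prednK // -IH.
have aE : a = 1%N by lia.
have all1 : all (pred1 1%N) l.
  apply/allP => b bl; have := order_path_min geq_trans pal => /allP /(_ b bl) /=.
  by move/allP: pl => /(_ b bl); rewrite aE; lia.
have lE : l = nseq (size l) 1%N by apply/all_pred1P.
rewrite aE lE size_nseq (_ : [seq x <- nseq _ _ | _] = [::]) //.
by elim: (size l).
Qed.
Lemma decol_addcol c l : positive l -> decol (addcol c l) = l.
Proof.
move=> pl; rewrite /decol /addcol filter_cat map_cat.
rewrite (_ : [seq x <- nseq _ _ | _] = [::]) ?cats0; last by elim: (c - _)%N.
by elim: l pl => //= a l IH /andP[a0 pl]; rewrite ltnS a0 /= IH.
Qed.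
Lemma is_partition_addcol c l : is_partition l -> is_partition (addcol c l).
Proof. by move=> /andP[sl pl]; rewrite /is_partition sorted_addcol //; apply: positive_addcol. Qed.
Lemma is_partition_decol l : is_partition l -> is_partition (decol l).
Proof.
move=> /andP[sl pl]; apply/andP; split.
  rewrite /decol sorted_map; apply: (sub_sorted _ (sorted_filter geq_trans _ sl)).
  by move=> a b /=; lia.
by apply/allP => a /mapP[b]; rewrite mem_filter => /andP[hb _] ->; lia.
Qed.

Lemma mem_bounded_partitions N B l :
  (l \in bounded_partitions N B) = [&& is_partition l, all (fun a => a <= N)%N l & size l <= B]%N.
Proof.
elim: N l => [|N IH] l.
  rewrite inE; apply/eqP/and3P => [->|[/andP[_ pl] al _]] //.
  case: l pl al => //= a l /andP[a0 _] /andP[]; lia.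
apply/allpairsPdep/and3P => [[l' [i [hl' hi ->]]]|[pl al sl]].
  move: hl'; rewrite IH => /and3P[pl' al' sl'].
  move: hi; rewrite mem_index_iota => hi.
  rewrite is_partition_addcol // size_addcol ?leq_addr //; split=> //; last by lia.
  rewrite all_cat all_nseq /= orbT andbT all_map.
  by apply: sub_all al' => a /=.
have szd : (size (decol l) <= size l)%N by rewrite size_map size_filter count_size.
exists (decol l), (size l - size (decol l))%N; split.
- rewrite IH is_partition_decol //=; apply/andP; split; last by apply: leq_trans szd sl.
  apply/allP => a /mapP[b]; rewrite mem_filter => /andP[_ bl] ->.
  by move/allP: al => /(_ b bl); lia.
- by rewrite mem_index_iota; lia.
- by rewrite subnKC //; apply: decolK.
Qed.

Lemma positive_bp N B l : l \in bounded_partitions N B -> positive l.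
Proof. by rewrite mem_bounded_partitions => /and3P[/andP[]]. Qed.
Lemma size_bp N B l : l \in bounded_partitions N B -> (size l <= B)%N.
Proof. by rewrite mem_bounded_partitions => /and3P[]. Qed.

Lemma uniq_bounded_partitions N B : uniq (bounded_partitions N B).
Proof.
elim: N => //= N IH; apply: allpairs_uniq_dep => // [l _|]; first exact: iota_uniq.
move=> [l i] [l' i'] /allpairsPdep[l1 [i1 [h1 _ [-> ->]]]] /allpairsPdep[l2 [i2 [h2 _ [-> ->]]]] /= e.
have := congr1 decol e; rewrite !decol_addcol ?(positive_bp h1) ?(positive_bp h2) // => el.
have := congr1 size e; rewrite !size_addcol ?leq_addr // el => /addnI ei.
by rewrite ei.
Qed.

(** * Chains of subsets as sums over pairs of partitions *)

Section ChainExpansion.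
Variables (F : fieldType) (emb : {rmorphism K -> F}).
Local Notation s := (emb sq).
Local Notation t := (s ^+ 2).
Variables (I : finType) (x : I -> F).
Hypothesis x_inj : injective x.
Hypothesis x0 : forall i, x i != 0.
Hypothesis t_generic : forall i, (0 < i)%N -> 1 - t ^+ i != 0.
Local Notation cross := (hl_cross t x).
Local Notation V := (laurent F).

Lemma t0 : t != 0.
Proof. by rewrite expf_neq0 // fmorph_eq0 sq_neq0. Qed.
Lemma emb_tt : emb tt = t. Proof. by rewrite /tt rmorphXn. Qed.
Lemma emb_vm m : emb (vm m) = tfact t m.
Proof.
rewrite /vm rmorph_prod; apply: eq_bigr => i _.
by rewrite fmorph_div !rmorphB rmorph1 rmorphXn emb_tt.
Qed.
Lemma tfact_neq0 m : tfact t m != 0.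
Proof.
elim: m => [|m IH]; first by rewrite tfact0 oner_neq0.
rewrite tfactS mulf_neq0 // mulf_neq0 ?t_generic //.
by rewrite invr_eq0 -[t]expr1 t_generic.
Qed.
Lemma emb_tbinom m k : emb (tbinom sq m k) = tbinom s m k.
Proof.
have pE j : emb (poch sq j) = poch s j.
  rewrite /poch rmorph_prod; apply: eq_bigr => i _.
  by rewrite rmorphB rmorph1 !rmorphXn.
by rewrite /tbinom; case: ifP; rewrite ?rmorph0 // fmorph_div rmorphM !pE.
Qed.

(** The polynomial P_l in exactly as many variables as l has parts, so no factor for zero parts
    occurs. *)
Definition hl_full (l : seq nat) (J : {set I}) : F :=
  set_sum t x l J / emb (mult_prod vm l).

Lemma hl_full_card l (J : {set I}) : #|J| != size l -> hl_full l J = 0.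
Proof. by move=> h; rewrite /hl_full set_sum_card ?mul0r. Qed.

Lemma hl_full_addcol c l (J : {set I}) : positive l -> (size l <= c)%N ->
  hl_full (addcol c l) J = if #|J| == c then
    xprod x J * \sum_(K : {set I} | K \subset J) cross K (J :\: K) * hl_full l K else 0.
Proof.
move=> pl hc; case: ifP => [/eqP hJ|hJ]; last by rewrite hl_full_card // size_addcol // hJ.
have vm0 : vm 0 = 1 by rewrite /vm big_geq.
have t1 : 1 - t != 0 by rewrite -[t]expr1 t_generic.
rewrite /hl_full mult_prod_addcol // rmorphM emb_vm.
have -> : addcol c l = map succn (l ++ nseq (c - size l) 0%N).
  by rewrite map_cat map_nseq.
rewrite set_sum_map_succ set_sum_cat // -!mulrA; congr (_ * _).
rewrite mulr_suml; apply: eq_bigr => L sL.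
case: (eqVneq #|L| (size l)) => [eL|nL]; last by rewrite set_sum_card // !(mul0r, mulr0).
rewrite set_sum_zeros // cardsDS // hJ eL eqxx.
have h1 := tfact_neq0 (c - size l).
rewrite invfM -!mulrA; congr (_ * (_ * _)); rewrite mulrA divff // mul1r //.
Qed.

Definition monom (e : int) : V := fun D => (D == e)%:R.

Lemma rs_monom (j k m : nat) : rs s m (monom (j%:Z - k%:Z)) =
  \sum_(i < m.+1) tbinom s m i *: monom ((j + i)%N%:Z - (k + (m - i))%N%:Z).
Proof.
apply: funext => D; rewrite /rs (_ : (\sum_(i < m.+1) _) D =
  \sum_(i < m.+1) (tbinom s m i *: monom ((j + i)%N%:Z - (k + (m - i))%N%:Z)) D); last first.
  by elim/big_ind2: _ => // f a g b <- <-.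
apply: eq_bigr => i _; rewrite ptZ /monom; congr (_ * _%:R); congr nat_of_bool.
have := ltn_ord i; lia.
Qed.
Lemma gauss_monom e : gauss s (monom e) = s ^ (e * e) *: monom e.
Proof.
apply: funext => D; rewrite ptG ptZ /monom.
by case: eqP => [->|]; rewrite ?mulr0.
Qed.

(* The pairs (a, b) with a >= j, b >= k and a + b = c correspond to the
   terms of the Rogers-Szego polynomial of index c - j - k. *)
Lemma sum_pairs (w : nat -> nat -> V) (j k c B : nat) : (j + k <= c)%N -> (c <= B)%N ->
  \sum_(0 <= i < B.+1 - j) \sum_(0 <= l < B.+1 - k)
    (if (c == j + i + (k + l))%N then w (j + i)%N (k + l)%N else 0)
  = \sum_(i < (c - j - k).+1) w (j + i)%N (k + (c - j - k - i))%N.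
Proof.
move=> hjk hc; rewrite -[RHS](big_mkord xpredT (fun i => w (j + i)%N (k + (c - j - k - i))%N)).
rewrite [RHS](@big_nat_widen _ _ _ _ _ (B.+1 - j)); last by lia.
rewrite [RHS]big_mkcond /=; apply: eq_big_nat => i /andP[_ hi].
rewrite -big_mkcond /=.
case: ltnP => hi'.
  rewrite (eq_bigl (fun l => l == c - j - k - i)%N); last by move=> l; lia.
  by rewrite big_nat1_eq ifT //; lia.
rewrite big_nat_cond big_pred0 // => l; lia.
Qed.

(** Prepending columns of lengths a and b to mu and nu with a + b = |J| reproduces one step: the
    splittings give the Rogers-Szego sum and (a - b)^2 the Gaussian factor. *)
Lemma chains_expand N B (J : {set I}) : (#|J| <= B)%N ->
  chains t x (rs_lin s) (gauss_lin s) (delta0 F) N J =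
  \sum_(mu <- bounded_partitions N B) \sum_(nu <- bounded_partitions N B)
    (emb (coef mu nu) * hl_full (punion mu nu) J) *: monom ((size mu)%:Z - (size nu)%:Z).
Proof.
elim: N J => [|N IH] J hJ.
  rewrite /= !big_seq1 /chains /= /only_empty /hl_full /=.
  have -> : coef [::] [::] = 1.
    rewrite /coef /punion /padd /= /ip_rho /= !big_ord0 mulr0 subrr expr0z mul1r.
    by rewrite /blam /= !big_geq // mulr1 invr1 mulr1.
  rewrite rmorph1 mul1r /mult_prod /= big_geq // rmorph1 divr1.
  by case: eqP => _; rewrite ?scale1r ?scale0r //; apply: funext => D.
rewrite chainsS /chain_step.
transitivity (\sum_(mu <- bounded_partitions N B) \sum_(nu <- bounded_partitions N B)
    \sum_(L : {set I} | L \subset J)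
  (xprod x J * cross L (J :\: L) * emb (coef mu nu) * hl_full (punion mu nu) L) *:
   gauss s (rs s (#|J| - size mu - size nu) (monom ((size mu)%:Z - (size nu)%:Z)))).
  rewrite linear_sum scaler_sumr.
  under eq_bigr => L sL.
    rewrite IH; last by apply: leq_trans hJ; apply: subset_leq_card.
    rewrite /rs_lin linear_sum scaler_sumr linear_sum scaler_sumr.
    under eq_bigr => mu _.
      rewrite linear_sum scaler_sumr linear_sum scaler_sumr.
      over.
    over.
  rewrite exchange_big; apply: eq_bigr => mu _; rewrite exchange_big; apply: eq_bigr => nu _.
  apply: eq_bigr => L sL.
  (* Only subsets of this size contribute, so the index |J \ L| depends on mu and nu alone. *)
  case: (eqVneq #|L| (size mu + size nu)%N) => eL; last first.
    rewrite hl_full_card ?size_sort ?size_cat // !mulr0 !scale0r.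
    by rewrite !(linear0, scaler0).
  rewrite cardsDS // eL subnDA (linearZ_LR (rs s _)) !scalerA.
  rewrite (linearZ_LR (gauss_lin s)) scalerA; congr (_ *: _); ring.
rewrite /= big_allpairs_dep big_seq [RHS]big_seq; apply: eq_bigr => mu hmu.
under [RHS]eq_bigr do rewrite big_allpairs_dep.
rewrite [RHS]exchange_big /= big_seq [RHS]big_seq; apply: eq_bigr => nu hnu.
have pmu := positive_bp hmu; have pnu := positive_bp hnu.
have pu : positive (punion mu nu) by rewrite /positive all_sort all_cat; apply/andP.
have su : size (punion mu nu) = (size mu + size nu)%N by rewrite size_sort size_cat.
set j := size mu in su *; set k := size nu in su *.
pose P := xprod x J * \sum_(L : {set I} | L \subset J) cross L (J :\: L) * hl_full (punion mu nu) L.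
pose w (a b : nat) : V := (s ^ ((a%:Z - b%:Z) * (a%:Z - b%:Z)) *
  tbinom s (a + b - j - k) (a - j) * emb (coef mu nu) * P) *: monom (a%:Z - b%:Z).
transitivity (\sum_(0 <= i < B.+1 - j) \sum_(0 <= l < B.+1 - k)
    (if (#|J| == j + i + (k + l))%N then w (j + i)%N (k + l)%N else 0)); last first.
  apply: eq_bigr => i _; apply: eq_bigr => l _.
  rewrite !size_addcol ?leq_addr // punion_addcol ?leq_addr // hl_full_addcol ?su //; last by lia.
  case: ifP => _; last by rewrite mulr0 scale0r.
  rewrite coef_addcol ?leq_addr // 2!rmorphM emb_tbinom fmorphXz.
  by [].
case: (leqP (j + k) #|J|) => hjk; last first.
  rewrite big1 => [|L sL]; last first.
    rewrite hl_full_card ?mulr0 ?scale0r // su; have := subset_leq_card sL.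
    by rewrite -/j -/k; lia.
  rewrite big1 // => i _; rewrite big1 // => l _.
  by case: eqP => //; lia.
rewrite sum_pairs //.
rewrite -scaler_suml.
have -> : \sum_(L : {set I} | L \subset J)
   xprod x J * cross L (J :\: L) * emb (coef mu nu) * hl_full (punion mu nu) L = emb (coef mu nu) * P.
  by rewrite /P !mulr_sumr; apply: eq_bigr => L _; ring.
rewrite rs_monom (linear_sum (gauss_lin s)) scaler_sumr; apply: eq_bigr => i _.
rewrite (linearZ_LR (gauss_lin s)) /= gauss_monom !scalerA /w; congr (_ *: _).
rewrite (_ : j + i + (k + _) - j - k = #|J| - j - k)%N; last by have := ltn_ord i; lia.
rewrite addKn; ring.
Qed.
End ChainExpansion.

(** * Specialization to power series in a scaling variable *)

Section Regular.
Variable R : fieldType.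
Variables (KK : fieldType) (tof : {rmorphism {poly R} -> KK}).
Hypothesis tof_inj : injective tof.
(** The localization of R[u] at u = 0, inside a field containing R[u]. *)
Definition regular (f : KK) : Prop :=
  exists p q : {poly R}, q`_0 != 0 /\ f = tof p / tof q.

Lemma tof_eq0 p : (tof p == 0) = (p == 0).
Proof. by rewrite -(inj_eq tof_inj) rmorph0. Qed.
Lemma coef0M_neq0 (p q : {poly R}) : p`_0 != 0 -> q`_0 != 0 -> (p * q)`_0 != 0.
Proof. by move=> hp hq; rewrite coef0M mulf_neq0. Qed.
Lemma tof_neq0 (p : {poly R}) : p`_0 != 0 -> tof p != 0.
Proof. by apply: contra; rewrite tof_eq0 => /eqP->; rewrite coef0. Qed.

Lemma regular_poly (p : {poly R}) : regular (tof p).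
Proof. by exists p, 1; rewrite coef1 oner_neq0 (rmorph1 tof) divr1. Qed.
Lemma regular_inv (p : {poly R}) : p`_0 != 0 -> regular (tof p)^-1.
Proof. by move=> h; exists 1, p; rewrite (rmorph1 tof) mul1r. Qed.
Lemma regularD a b : regular a -> regular b -> regular (a + b).
Proof.
move=> [p [q [hq ->]]] [p' [q' [hq' ->]]]; exists (p * q' + p' * q), (q * q').
rewrite coef0M_neq0 //; split=> //; rewrite (rmorphD tof) !(rmorphM tof).
by rewrite addf_div ?tof_neq0.
Qed.
Lemma regularN a : regular a -> regular (- a).
Proof. by move=> [p [q [hq ->]]]; exists (- p), q; rewrite (rmorphN tof) mulNr. Qed.
Lemma regularM a b : regular a -> regular b -> regular (a * b).
Proof.
move=> [p [q [hq ->]]] [p' [q' [hq' ->]]]; exists (p * p'), (q * q').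
rewrite coef0M_neq0 //; split=> //; rewrite !(rmorphM tof).
by rewrite -mulf_div.
Qed.
Lemma regular1 : regular 1.
Proof. by rewrite -(rmorph1 tof); apply: regular_poly. Qed.

Local Notation u := (tof 'X).
Lemma u_neq0 : u != 0. Proof. by rewrite tof_eq0 polyX_eq0. Qed.

(** Clearing denominators gives p b = u^N a with b invertible at 0; the coefficients of p then
    vanish one after the other. *)
Lemma small_poly_coef N (p : {poly R}) i : small regular u N (tof p) -> (i < N)%N -> p`_i = 0.
Proof.
move=> [a [b [b0 e]]] iN.
have {}e : p * b = 'X^N * a.
  apply/eqP; rewrite -(inj_eq tof_inj) !(rmorphM tof) (rmorphXn tof); apply/eqP.
  have := u_neq0; have := tof_neq0 b0 => h1 h2.
  have uN : u ^+ N != 0 by rewrite expf_neq0.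
  by rewrite -[tof p](divfK uN) e mulrAC divfK // mulrC.
elim/ltn_ind: i iN => i IH iN.
have := congr1 (fun q : {poly R} => q`_i) e.
rewrite coefXnM iN coefM big_ord_recr /= subnn big1 ?add0r => [/eqP|j _]; last first.
  by rewrite IH ?mul0r //; apply: ltn_trans iN.
by rewrite mulf_eq0 (negPf b0) orbF => /eqP.
Qed.
End Regular.

Section Specialization.
Variables (R : fieldType) (emb : {rmorphism K -> R}) (n : nat) (X : 'I_n -> R).
Hypothesis two_neq0 : 2%:R != 0 :> R.
Hypothesis X_inj : injective X.
Hypothesis X0 : forall i, X i != 0.
Local Notation s := (emb sq).
Local Notation t := (s ^+ 2).
Hypothesis XtX : forall i j, X i - t * X j != 0.
Hypothesis t_generic : forall i, (0 < i)%N -> 1 - t ^+ i != 0.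

Variables (KK : fieldType) (tof : {rmorphism {poly R} -> KK}).
Hypothesis tof_inj : injective tof.
Local Notation u := (tof 'X).
Definition iota_c (c : R) : KK := tof c%:P.
Lemma iota_is_zmod_morphism : zmod_morphism iota_c.
Proof. by move=> a b; rewrite /iota_c !rmorphB. Qed.
Lemma iota_is_monoid_morphism : monoid_morphism iota_c.
Proof. by split=> [|a b]; rewrite /iota_c ?rmorph1 // !rmorphM. Qed.
HB.instance Definition _ := GRing.isZmodMorphism.Build R KK iota_c iota_is_zmod_morphism.
HB.instance Definition _ := GRing.isMonoidMorphism.Build R KK iota_c iota_is_monoid_morphism.

Definition embK : {rmorphism K -> KK} := iota_c \o emb.
Local Notation s' := (embK sq).
Definition xu (i : 'I_n) : KK := iota_c (X i) * u.

Lemma xuE i : xu i = tof ((X i)%:P * 'X).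
Proof. by rewrite /xu /iota_c (rmorphM tof). Qed.

Lemma s'E : s' ^+ 2 = iota_c t. Proof. by rewrite (rmorphXn iota_c). Qed.
Lemma xu_t_sub i j : xu i - s' ^+ 2 * xu j = iota_c (X i - t * X j) * u.
Proof. by rewrite s'E /xu (rmorphB iota_c) mulrBl (rmorphM iota_c t) mulrA. Qed.
Lemma xu_sub i j : xu i - xu j = iota_c (X i - X j) * u.
Proof. by rewrite (rmorphB iota_c) mulrBl. Qed.
(** The weights are homogeneous of degree 0, so u cancels and they are regular although x_i - x_j
    vanishes at u = 0. *)
Lemma hl_factor_xu i (J : {set 'I_n}) : hl_factor (s' ^+ 2) xu (xu i) J = iota_c (hl_factor t X (X i) J).
Proof.
rewrite /hl_factor rmorph_prod; apply: eq_bigr => j _.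
rewrite fmorph_div xu_t_sub xu_sub -mulf_div divff ?(u_neq0 tof_inj) // mulr1 //.
Qed.
Lemma hl_cross_xu (J L : {set 'I_n}) : hl_cross (s' ^+ 2) xu J L = iota_c (hl_cross t X J L).
Proof. by rewrite /hl_cross rmorph_prod; apply: eq_bigr => i _; apply: hl_factor_xu. Qed.
Lemma set_sum_xu l (J : {set 'I_n}) :
  set_sum (s' ^+ 2) xu l J = iota_c (set_sum t X l J) * u ^+ sumn l.
Proof.
elim: l J => [|a l IH] J /=; first by rewrite mulr1 rmorph_nat.
rewrite rmorph_sum mulr_suml; apply: eq_bigr => i _.
rewrite IH hl_factor_xu !rmorphM rmorphXn /xu exprMn exprD; ring.
Qed.
Lemma hl_full_xu l (J : {set 'I_n}) :
  hl_full embK xu l J = iota_c (hl_full emb X l J) * u ^+ sumn l.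
Proof. by rewrite /hl_full set_sum_xu fmorph_div /= mulrAC. Qed.

(** P_l in all n variables; those outside L carry exponent 0. *)
Definition hl (l : seq nat) : R :=
  \sum_(L : {set 'I_n}) hl_cross t X L (~: L) * hl_full emb X l L.

Definition lhs_poly (N : nat) : {poly R} :=
  \sum_(mu <- bounded_partitions N n) \sum_(nu <- bounded_partitions N n)
     (emb (coef mu nu) * hl (punion mu nu))%:P * 'X^(sumn mu + sumn nu).

Lemma xu_inj : injective xu.
Proof.
move=> i j /(mulIf (u_neq0 tof_inj))/eqP; rewrite /iota_c (inj_eq tof_inj) => /eqP/polyC_inj.
exact: X_inj.
Qed.
Lemma iota_neq0 c : c != 0 -> iota_c c != 0.
Proof. by move=> h; rewrite fmorph_eq0. Qed.
Lemma xu_neq0 i : xu i != 0.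
Proof. by rewrite mulf_neq0 ?iota_neq0 ?(u_neq0 tof_inj). Qed.
Lemma s'_generic i : (0 < i)%N -> 1 - s' ^+ 2 ^+ i != 0.
Proof. by move=> h; rewrite s'E -(rmorphXn iota_c) -(rmorph1 iota_c) -(rmorphB iota_c) iota_neq0 ?t_generic. Qed.

Lemma at1_sum M (J : Type) (r : seq J) (P : pred J) (f : J -> laurent KK) :
  at1 M (\sum_(j <- r | P j) f j) = \sum_(j <- r | P j) at1 M (f j).
Proof.
elim: r => [|j r IH]; first by rewrite !big_nil /at1 big1.
by rewrite !big_cons; case: ifP => // _; rewrite at1D IH.
Qed.
Lemma at1_monom M (e : int) : (`|e| <= M)%N -> at1 M (monom KK e) = 1.
Proof.
move=> h; have hk : (`|(e + M%:Z)%R| < (2 * M).+1)%N by lia.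
rewrite /at1 (bigD1 (Ordinal hk)) //= {1}/monom (_ : _ == e); last by apply/eqP; lia.
rewrite big1 ?addr0 // => k; rewrite -val_eqE /= /monom => hke.
by case: eqP => // e'; case/negP: hke; apply/eqP; lia.
Qed.

Lemma chain_sum_poly N M : (n <= M)%N ->
  at1 M (chain_sum s' xu N [set: 'I_n]) = tof (lhs_poly N).
Proof.
move=> hM; rewrite /chain_sum /lhs_poly rmorph_sum.
transitivity (\sum_(L : {set 'I_n}) \sum_(mu <- bounded_partitions N n) \sum_(nu <- bounded_partitions N n)
   hl_cross (s' ^+ 2) xu L (~: L) * (embK (coef mu nu) * hl_full embK xu (punion mu nu) L)).
  rewrite at1_sum; apply: eq_big => [L|L _]; first by rewrite subsetT.
  rewrite setTD (@chains_expand _ embK _ xu xu_inj xu_neq0 s'_generic N n L); last first.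
    by rewrite -[n in X in (_ <= X)%N]card_ord max_card.
  rewrite at1Z at1_sum big_seq mulr_sumr [RHS]big_seq; apply: eq_bigr => mu hmu.
  rewrite at1_sum big_seq mulr_sumr [RHS]big_seq; apply: eq_bigr => nu hnu.
  rewrite at1Z at1_monom ?mulr1 //.
  move: (size_bp hmu) (size_bp hnu) hM; move: (size mu) (size nu) => a b {hmu hnu} ha hb hM0; lia.
rewrite exchange_big; apply: eq_bigr => mu _; rewrite exchange_big rmorph_sum.
apply: eq_bigr => nu _ /=.
rewrite (rmorphM tof) (rmorphXn tof) -/(iota_c _) /hl (rmorphM iota_c) (rmorph_sum iota_c) mulr_sumr mulr_suml.
apply: eq_bigr => L _; rewrite hl_full_xu hl_cross_xu (rmorphM iota_c).
have -> : sumn (punion mu nu) = (sumn mu + sumn nu)%N.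
  by rewrite -sumn_cat; apply: perm_sumn; rewrite perm_sort.
rewrite /=; ring.
Qed.

Definition pair_factor (a : R) (D : nat) : {poly R} :=
  (1 - (t * a)%:P * 'X^2) * \sum_(e < D.+1) (a%:P * 'X^2) ^+ e.
Definition single_factor (a : R) (D : nat) : {poly R} :=
  (1 + (s * a)%:P * 'X) * \sum_(e < D.+1) ((s * a)%:P * 'X) ^+ e.
Definition rhs_poly (D : nat) : {poly R} :=
  (\prod_(j < n) \prod_(k < n | (j < k)%N) pair_factor (X j * X k) D) *
  \prod_(j < n) single_factor (X j) D.

Local Notation reg := (@regular R KK tof).
Local Notation smallu := (@small KK reg u).

Definition cong (N : nat) (a b : KK) := reg b /\ smallu N (a - b).

Lemma small_reg N a : smallu N a -> reg a.
Proof.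
move=> h; have uN : u ^+ N != 0 by rewrite expf_neq0 ?u_neq0.
rewrite -(divfK uN a); apply: regularM => //.
by rewrite -(rmorphXn tof); apply: regular_poly.
Qed.
Lemma cong_reg N a b : cong N a b -> reg a.
Proof. by move=> [hb /small_reg h]; rewrite -(subrK b a); apply: regularD. Qed.
Lemma congM N a b a' b' : cong N a b -> cong N a' b' -> cong N (a * a') (b * b').
Proof.
move=> h h'; have ra := cong_reg h; case: h h' => hb sb [hb' sb'].
split; first exact: regularM.
have -> : a * a' - b * b' = a * (a' - b') + b' * (a - b) by ring.
by apply: smallD; [exact: regularD| |]; apply: smallM => //; apply: regularM.
Qed.
Lemma cong_prod N (J : Type) (r : seq J) (P : pred J) (f g : J -> KK) :
  (forall j, P j -> cong N (f j) (g j)) ->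
  cong N (\prod_(j <- r | P j) f j) (\prod_(j <- r | P j) g j).
Proof.
move=> h; apply: big_ind2 => [|? ? ? ?|//]; last exact: congM.
by split; [exact: regular1 | rewrite subrr; apply: small0 => //;
  [exact: regular1|exact: regularD|exact: regularN]].
Qed.
(** The error of the truncated geometric series is q^(D+1) / (1 - q), and q is divisible by u. *)
Lemma cong_geom (p q : {poly R}) D : q`_0 = 0 ->
  cong D.+1 (tof (1 + p) / tof (1 - q)) (tof ((1 + p) * \sum_(e < D.+1) q ^+ e)).
Proof.
move=> q0; have q1 : (1 - q)`_0 != 0 by rewrite coefB coef1 q0 subr0 oner_neq0.
have hq := tof_neq0 tof_inj q1.
split; first exact: regular_poly.
have [r qE] : exists r, q = r * 'X.
  exists (drop_poly 1 q); rewrite -[LHS](poly_take_drop 1 q) expr1 (_ : take_poly 1 q = 0) ?add0r //.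
  by apply/polyP => -[|i]; rewrite coef_take_poly coef0 ?q0.
have -> : tof (1 + p) / tof (1 - q) - tof ((1 + p) * \sum_(e < D.+1) q ^+ e) =
   tof ((1 + p) * r ^+ D.+1) / tof (1 - q) * u ^+ D.+1.
  have e : (1 - q) * \sum_(e < D.+1) q ^+ e = 1 - q ^+ D.+1.
    by rewrite -opprB mulNr -subrX1 opprB.
  apply: (mulIf hq); rewrite mulrBl divfK // mulrAC divfK //.
  rewrite -(rmorphXn tof) -!(rmorphM tof) -(rmorphB tof); apply: (congr1 tof).
  rewrite -[X in _ - X]mulrA [X in _ * X]mulrC e qE exprMn; ring.
rewrite /small mulfK ?expf_neq0 ?(u_neq0 tof_inj) //; apply: regularM.
  exact: regular_poly.
exact: regular_inv.
Qed.

Lemma rhs_cong D :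
  cong D.+1 (\prod_(k < n) ((1 + s' * xu k) / (1 - s' * xu k) *
      kernel_factor (s' ^+ 2) xu (xu k) (initial_set n k)))
    (tof (rhs_poly D)).
Proof.
rewrite big_split /= mulrC /rhs_poly (rmorphM tof); apply: congM.
  rewrite /kernel_factor.
  rewrite [X in cong _ X _](_ : _ = \prod_(j < n) \prod_(k < n | (j < k)%N)
     ((1 - s' ^+ 2 * xu j * xu k) / (1 - xu j * xu k))); last first.
    rewrite (exchange_big_dep predT) //=; apply: eq_bigr => k _.
    by apply: eq_bigl => j; rewrite inE.
  rewrite rmorph_prod; apply: cong_prod => j _; rewrite rmorph_prod; apply: cong_prod => k _.
  have -> : 1 - s' ^+ 2 * xu j * xu k = tof (1 + - ((t * (X j * X k))%:P * 'X^2)).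
    rewrite s'E /iota_c !xuE -!(rmorphM tof) -(rmorph1 tof) -(rmorphB tof); apply: (congr1 tof).
    by rewrite !polyCM; ring.
  have -> : 1 - xu j * xu k = tof (1 - (X j * X k)%:P * 'X^2).
    rewrite !xuE -!(rmorphM tof) -(rmorph1 tof) -(rmorphB tof); apply: (congr1 tof).
    by rewrite !polyCM; ring.
  by apply: cong_geom; rewrite coefMXn.
rewrite rmorph_prod; apply: cong_prod => k _.
have sE : s' * xu k = tof ((s * X k)%:P * 'X).
  by rewrite xuE -(rmorphM tof) polyCM mulrA.
rewrite sE -(rmorph1 tof) -(rmorphD tof) -(rmorphB tof); apply: cong_geom.
by rewrite coefMX.
Qed.

Lemma coef_lhs_rhs D i : (i <= D)%N -> (lhs_poly D.+1)`_i = (rhs_poly D)`_i.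
Proof.
move=> iD; apply/eqP; rewrite -subr_eq0 -coefB; apply/eqP.
apply: (@small_poly_coef _ _ tof tof_inj D.+1); last by rewrite ltnS.
have rN := @regularN R KK tof; have rD := @regularD R KK tof tof_inj.
have rM := @regularM R KK tof; have r1 := @regular1 R KK tof.
have c0 (p : {poly R}) : p`_0 = 1 -> tof p != 0.
  by move=> h; apply: (tof_neq0 tof_inj); rewrite h oner_neq0.
have xx i1 j1 : 1 - xu i1 * xu j1 = tof (1 - (X i1 * X j1)%:P * 'X^2).
  rewrite !xuE -!(rmorphM tof) -(rmorph1 tof) -(rmorphB tof); apply: (congr1 tof).
  by rewrite !polyCM; ring.
have xx0 i1 j1 : (1 - (X i1 * X j1)%:P * 'X^2 : {poly R})`_0 = 1.
  by rewrite coefB coef1 coefMXn subr0.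
have sx i1 : 1 - s' * xu i1 = tof (1 - (s * X i1)%:P * 'X).
  rewrite xuE -(rmorphM tof) -(rmorph1 tof) -(rmorphB tof); apply: (congr1 tof).
  by rewrite polyCM mulrA.
have sx0 i1 : (1 - (s * X i1)%:P * 'X : {poly R})`_0 = 1.
  by rewrite coefB coef1 coefMX subr0.
have ru : reg u by apply: regular_poly.
have ri c : reg (iota_c c) by apply: regular_poly.
have txx i1 j1 : 1 - s' ^+ 2 * xu i1 * xu j1 != 0.
  rewrite s'E /iota_c !xuE -!(rmorphM tof) -(rmorph1 tof) -(rmorphB tof) c0 //.
  by rewrite coefB coef1 !coefM !big_ord1 /= !subn0 !coefMX !mulr0 subr0.
have [M0 h] := @truncated_identity KK s' n xu
  ltac:(by rewrite fmorph_eq0 sq_neq0)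
  ltac:(by rewrite -(rmorph_nat iota_c) fmorph_eq0)
  s'_generic xu_inj
  ltac:(by move=> i1; rewrite mulf_neq0 ?iota_neq0 ?(u_neq0 tof_inj))
  ltac:(by move=> i1 j1; rewrite xu_t_sub mulf_neq0 ?iota_neq0 ?(u_neq0 tof_inj))
  ltac:(by move=> i1 j1; rewrite xx c0)
  txx
  ltac:(by move=> i1; rewrite sx c0)
  reg u (u_neq0 tof_inj) r1 rD rN rM (ri _) ru
  ltac:(by move=> m k; rewrite -(emb_tbinom embK); apply: ri)
  ltac:(by move=> i1; rewrite mulfK ?(u_neq0 tof_inj))
  ltac:(move=> i1 j1 _; rewrite xu_t_sub xu_sub -mulf_div divff ?(u_neq0 tof_inj) // mulr1 -fmorph_div; exact: ri)
  ltac:(by move=> i1 j1; rewrite xx; apply: regular_inv; rewrite xx0 oner_neq0)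
  ltac:(by move=> i1; rewrite sx; apply: regular_inv; rewrite sx0 oner_neq0)
  D.+1.
(* The window must also contain all exponents l(mu) - l(nu), which are at most n in absolute
   value. *)
have := h (maxn M0 n) (leq_maxl _ _).
rewrite chain_sum_poly ?leq_maxr // => h1.
have [_ h2] := rhs_cong D.
rewrite (rmorphB tof) -(subrK (\prod_(k < n) ((1 + s' * xu k) / (1 - s' * xu k)
   * kernel_factor (s' ^+ 2) xu (xu k) (initial_set n k))) (tof (lhs_poly _))) -addrA.
exact: smallD.
Qed.
End Specialization.

Section HallLittlewood.
Variables (R : fieldType) (emb : {rmorphism K -> R}) (n : nat) (X : 'I_n -> R).
Hypothesis X_inj : injective X.
Hypothesis X0 : forall i, X i != 0.
Local Notation t := (emb sq ^+ 2).
Hypothesis t_generic : forall i, (0 < i)%N -> 1 - t ^+ i != 0.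

Lemma hl_large l : (n < size l)%N -> hl emb X l = 0.
Proof.
move=> h; rewrite /hl big1 // => L _; rewrite hl_full_card ?mulr0 //.
by have := max_card (mem L); rewrite card_ord; move: #|L| => c hc; lia.
Qed.

Lemma perm_sum_cat0 (m : nat) l : perm_sum t X (l ++ nseq m 0%N) = perm_sum t X l.
Proof.
apply: eq_bigr => w _; congr (_ * _); apply: eq_bigr => i _; congr (_ ^+ _).
by rewrite nth_cat nth_nseq; case: ltnP => // h; rewrite nth_default //; case: ifP.
Qed.

(** Padding l with zeros and cutting the list before them, the zeros contribute v_(n - l(l)), which
    cancels the corresponding normalizing factor. *)
Lemma hl_perm_sum l : (size l <= n)%N ->
  hl emb X l = (emb (vm (n - size l) * mult_prod vm l))^-1 * perm_sum t X l.
Proof.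
move=> ln; rewrite -(perm_sum_cat0 (n - size l)).
have t1 : 1 - t != 0 by rewrite -[t]expr1 t_generic.
rewrite -[X in perm_sum _ X _]/(X \o id) (@perm_sum_set_sum _ _ _ X); last 2 first.
- by [].
- by rewrite size_cat size_nseq subnKC.
rewrite imset_id set_sum_cat // mulr_sumr.
apply: eq_big => [L|L _]; first by rewrite subsetT.
rewrite setTD; case: (eqVneq #|L| (size l)) => hL; last first.
  by rewrite hl_full_card // set_sum_card // mulr0 !mul0r !mulr0 ?mul0r ?mulr0.
have -> : set_sum t X (nseq (n - size l) 0%N) (~: L) = tfact t (n - size l).
  by rewrite set_sum_zeros // cardsCs setCK card_ord hL eqxx.
rewrite /hl_full rmorphM emb_vm invfM.
have h := tfact_neq0 t_generic (n - size l).
rewrite -[LHS]mulr1 -[X in _ * X = _](divff h); ring.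
Qed.
End HallLittlewood.

(** * The identity in graded form *)

Section Grading.
Variables (R : fieldType) (emb : {rmorphism K -> R}) (n : nat) (X : 'I_n -> R).

(** The exponent of u records the degree, so adding the coefficients up to D amounts to truncating
    at degree D and setting u = 1. *)
Definition graded_eval (p : {mpoly K[n]}) : {poly R} :=
  mmap (polyC \o emb) (fun i => (X i)%:P * 'X) p.

Lemma graded_mmap1 (m : 'X_{1..n}) :
  mmap1 (fun i => (X i)%:P * 'X) m = (mmap1 X m)%:P * 'X^(mdeg m).
Proof.
rewrite /mmap1 mdegE rmorph_prod -prodrXr -big_split /=; apply: eq_bigr => i _.
by rewrite exprMn rmorphXn.
Qed.

Lemma sum_coef_graded_eval D p :
  \sum_(i < D.+1) (graded_eval p)`_i = mmap emb X (mtrunc D p).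
Proof.
rewrite /mtrunc raddf_sum [RHS]big_mkcond.
under [LHS]eq_bigr => i _ do rewrite /graded_eval /mmap coef_sum.
rewrite exchange_big; apply: eq_bigr => m _ /=.
under eq_bigr => i _ do rewrite graded_mmap1 mulrA -polyCM coefCM coefXn.
rewrite -mulr_sumr; case: leqP => h.
  rewrite (bigD1 (Ordinal (h : mdeg m < D.+1)%N)) //= eqxx big1 ?addr0 ?mulr1.
    by rewrite mmapZ mmapX.
  by move=> i; rewrite -val_eqE /= => /negPf->.
rewrite big1 ?mulr0 // => i _; rewrite (_ : (i == mdeg m :> nat) = false) //.
by have := ltn_ord i; move: (nat_of_ord i) (mdeg m) h => a b; lia.
Qed.

Lemma graded_eval_product D :
  graded_eval ((\prod_(j < n) \prod_(k < n | (j < k)%N)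
          ((1 - tt *: ('X_j * 'X_k)) * geom D ('X_j * 'X_k)))
       * \prod_(j < n) ((1 + sq *: 'X_j) * geom D (sq *: 'X_j))) = rhs_poly emb X D.
Proof.
pose f : {rmorphism {mpoly K[n]} -> {poly R}} := mmap (polyC \o emb) (fun i => (X i)%:P * 'X).
have fX i : f 'X_i = (X i)%:P * 'X by rewrite /f /= mmapX mmap1U.
have fZ c q : f (c *: q) = (emb c)%:P * f q by rewrite /f /= mmapZ.
rewrite -[graded_eval]/(f : _ -> _) rmorphM rmorph_prod; congr (_ * _).
  apply: eq_bigr => j _; rewrite rmorph_prod; apply: eq_bigr => k _.
  have e : f ('X_j * 'X_k) = (X j * X k)%:P * 'X^2.
    by rewrite rmorphM !fX polyCM; ring.
  rewrite rmorphM rmorphB rmorph1 fZ e rmorph_sum /pair_factor; congr (_ * _).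
    by rewrite /tt rmorphXn !polyCM; ring.
  by apply: eq_bigr => i _; rewrite rmorphXn e.
rewrite rmorph_prod; apply: eq_bigr => j _.
have e : f (sq *: 'X_j) = (emb sq * X j)%:P * 'X by rewrite fZ fX polyCM mulrA.
rewrite rmorphM rmorphD rmorph1 e rmorph_sum /single_factor; congr (_ * _).
by apply: eq_bigr => i _; rewrite rmorphXn e.
Qed.
End Grading.

(** * Comparison of the two enumerations of partitions *)

Section Enumeration.
Lemma mem_bseqs k B l : (l \in bseqs k B) =
  (size l <= k)%N && all (fun a => (0 < a <= B)%N) l.
Proof.
elim: k l => [|k IH] [|a l] //=; rewrite inE /=.
rewrite ltnS andbCA; apply/allpairsP/idP => [[[b r] /= [hb hr [-> ->]]]|].
  by move: hb; rewrite mem_iota add1n ltnS -IH hr => ->.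
move=> /andP[ha hl]; exists (a, l) => /=; split=> //; last by rewrite IH.
by rewrite mem_iota add1n ltnS.
Qed.

Lemma positive_size_sumn l : positive l -> (size l <= sumn l)%N.
Proof. by elim: l => //= a l IH /andP[ha /IH]; lia. Qed.
Lemma all_leq_sumn l : all (fun a => a <= sumn l)%N l.
Proof.
apply/allP => a; elim: l => //= b l IH; rewrite inE => /orP[/eqP->|/IH h]; first exact: leq_addr.
exact: leq_trans h (leq_addl _ _).
Qed.

Lemma mem_partitions_upto D l :
  (l \in partitions_upto D) = is_partition l && (sumn l <= D)%N.
Proof.
rewrite /partitions_upto mem_undup mem_filter; apply: andb_idr => /andP[/andP[_ pl] hl].
rewrite mem_bseqs (leq_trans (positive_size_sumn pl)) //=; apply/allP => a al.
by rewrite (allP pl) //= (leq_trans (allP (all_leq_sumn l) _ al)).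
Qed.

(** Parts of a partition of size at most D are at most N, and partitions with more than n parts
    contribute nothing. *)
Lemma sum_partitions_upto (V : nmodType) (D N n : nat) (P : pred (seq nat)) (f : seq nat -> V) :
  (D <= N)%N -> (forall l, P l -> (sumn l <= D)%N) -> (forall l, (n < size l)%N -> f l = 0) ->
  \sum_(l <- partitions_upto D | P l) f l = \sum_(l <- bounded_partitions N n | P l) f l.
Proof.
move=> DN PD fn.
rewrite (bigID (fun l => size l <= n)%N) /= [X in _ + X]big1 ?addr0; last first.
  by move=> l /andP[_]; rewrite -ltnNge => /fn.
rewrite -big_filter -[RHS]big_filter; apply: perm_big; apply: uniq_perm.
- by rewrite filter_uniq // undup_uniq.
- by rewrite filter_uniq // uniq_bounded_partitions.
move=> l; rewrite !mem_filter mem_partitions_upto mem_bounded_partitions.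
case Pl: (P l) => //=; rewrite (PD _ Pl) andbT andbC; congr (_ && _).
suff -> : all (fun a => a <= N)%N l by [].
apply: sub_all (all_leq_sumn l) => a ha.
by rewrite (leq_trans ha) // (leq_trans (PD _ Pl)).
Qed.
End Enumeration.

Section LeftSide.
Variables (R : fieldType) (emb : {rmorphism K -> R}) (n : nat) (X : 'I_n -> R).
Lemma sum_coef_lhs_poly D :
  \sum_(i < D.+1) (lhs_poly emb X D.+1)`_i =
  \sum_(mu <- partitions_upto D) \sum_(nu <- partitions_upto D | (sumn mu + sumn nu <= D)%N)
     emb (coef mu nu) * hl emb X (punion mu nu).
Proof.
have zero mu nu : (n < size mu + size nu)%N -> hl emb X (punion mu nu) = 0.
  by move=> h; rewrite hl_large // /punion size_sort size_cat.
transitivity (\sum_(mu <- bounded_partitions D.+1 n | (sumn mu <= D)%N)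
  \sum_(nu <- bounded_partitions D.+1 n | (sumn mu + sumn nu <= D)%N)
     emb (coef mu nu) * hl emb X (punion mu nu)); last first.
  rewrite -(@sum_partitions_upto _ D D.+1 n (fun mu => sumn mu <= D)%N) //=; last first.
    by move=> mu h; apply: big1 => nu _; rewrite zero ?mulr0 // ltn_addr.
  rewrite big_seq_cond [RHS]big_seq_cond; apply: eq_big => [mu|mu _].
    by rewrite andbT mem_partitions_upto -andbA andbb.
  rewrite (@sum_partitions_upto _ D D.+1 n) // => [nu h|nu h].
    exact: leq_trans (leq_addl _ _) h.
  by rewrite zero ?mulr0 // ltn_addl.
under eq_bigr => i _ do rewrite coef_sum.
rewrite exchange_big [RHS]big_mkcond; apply: eq_bigr => mu _ /=.
under eq_bigr => i _ do rewrite coef_sum.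
rewrite exchange_big /=.
have term nu : \sum_(i < D.+1) ((emb (coef mu nu) * hl emb X (punion mu nu))%:P *
    'X^(sumn mu + sumn nu))`_i =
  if (sumn mu + sumn nu <= D)%N then emb (coef mu nu) * hl emb X (punion mu nu) else 0.
  under eq_bigr do rewrite coefCM coefXn.
  rewrite -mulr_sumr; case: leqP => h.
    rewrite (bigD1 (Ordinal (h : sumn mu + sumn nu < D.+1)%N)) //= eqxx big1 ?addr0 ?mulr1 //.
    by move=> i; rewrite -val_eqE /= => /negPf->.
  by rewrite big1 ?mulr0 // => i _; rewrite ltn_eqF // (leq_trans (ltn_ord i)).
under eq_bigr => nu _ do rewrite term.
rewrite -big_mkcond; case: leqP => // h; apply: big_pred0 => nu.
by apply/negbTE; rewrite -ltnNge ltn_addr.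
Qed.
End LeftSide.

(** * The field of rational functions as a model of the abstract hypotheses *)

Section Concrete.
Variable n : nat.
Lemma cst_is_zmod_morphism : zmod_morphism (cst n).
Proof. by move=> a b; rewrite /cst mpolyCB tofracB. Qed.
Lemma cst_is_monoid_morphism : monoid_morphism (cst n).
Proof. by split=> [|a b]; rewrite /cst ?mpolyC1 ?tofrac1 // mpolyCM tofracM. Qed.
HB.instance Definition _ := GRing.isZmodMorphism.Build K (Fx n) (cst n) cst_is_zmod_morphism.
HB.instance Definition _ := GRing.isMonoidMorphism.Build K (Fx n) (cst n) cst_is_monoid_morphism.

Lemma xv_inj : injective (@xv n).
Proof.
move=> i j /eqP; rewrite /xv tofrac_eq => /eqP /(congr1 (fun p => p@_(U_(j))))/eqP.
rewrite !mcoeffXU eqxx; case: (i =P j) => //= _.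
by rewrite eq_sym oner_eq0.
Qed.
Lemma xv_neq0 i : @xv n i != 0.
Proof.
rewrite /xv tofrac_eq0; apply/negP => /eqP /(congr1 (fun p => p@_(U_(i))))/eqP.
by rewrite mcoeffXU eqxx mcoeff0 oner_eq0.
Qed.

Lemma tt_generic i : (0 < i)%N -> 1 - tt ^+ i != 0.
Proof.
move=> hi; rewrite /tt /sq -!(tofracXn, tofracB, tofrac1) tofrac_eq0 -exprM.
apply/negP => /eqP /(congr1 (fun p : {poly rat} => p`_0))/eqP.
by rewrite coefB coef1 coefXn coef0; case: i hi => // i _; rewrite muln_eq0 subr0 oner_eq0.
Qed.
Lemma cst_tt_generic i : (0 < i)%N -> 1 - cst n sq ^+ 2 ^+ i != 0.
Proof.
move=> hi; have := tt_generic hi.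
by rewrite -(fmorph_eq0 (cst n)) (rmorphB (cst n)) (rmorph1 (cst n)) !(rmorphXn (cst n)).
Qed.
Lemma xv_sub_neq0 i j : @xv n i - cst n sq ^+ 2 * xv j != 0.
Proof.
rewrite -(rmorphXn (cst n)) /xv /cst -tofracM -tofracB tofrac_eq0.
apply/negP => /eqP /(congr1 (fun p => p@_(U_(i))))/eqP.
rewrite mul_mpolyC mcoeffB mcoeffZ !mcoeffXU eqxx mcoeff0.
have := tt_generic (isT : (0 < 1)%N); rewrite expr1 => h.
by case: (j =P i) => _; rewrite ?mulr1 ?mulr0 ?subr0 ?(negPf h) ?oner_eq0.
Qed.
Lemma two_Fx_neq0 : 2%:R != 0 :> Fx n.
Proof.
have h : 2%:R != 0 :> rat by [].
rewrite -(rmorph_nat (cst n)) fmorph_eq0 -(rmorph_nat (@FracField.tofrac {poly rat})).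
by rewrite tofrac_eq0 -polyC_natr polyC_eq0.
Qed.

Lemma HL_hl l : HL n l = hl (cst n) (@xv n) l.
Proof.
rewrite /HL; case: ltnP => h; first by rewrite hl_large.
rewrite hl_perm_sum //; last 3 first.
- exact: xv_inj.
- exact: xv_neq0.
- exact: cst_tt_generic.
by rewrite /perm_sum -(rmorphXn (cst n)).
Qed.

Lemma mmap_tofrac (p : {mpoly K[n]}) : mmap (cst n) (@xv n) p = tofrac p.
Proof.
rewrite [in RHS](mpolyE p) (rmorph_sum (@FracField.tofrac {mpoly K[n]})).
apply: eq_bigr => m _; rewrite -mul_mpolyC (rmorphM (@FracField.tofrac {mpoly K[n]})); congr (_ * _).
rewrite mpolyXE_id (rmorph_prod (@FracField.tofrac {mpoly K[n]})).
by apply: eq_bigr => i _; rewrite (rmorphXn (@FracField.tofrac {mpoly K[n]})).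
Qed.
End Concrete.

(* For every number n of variables and every degree bound D, the part of degree
   <= D of the left side (a finite sum, since P_lambda is homogeneous of degree
   |lambda|) equals the degree <= D truncation of the power series expansion of
   prod_{j<k} (1 - t x_j x_k)/(1 - x_j x_k) * prod_j (1 + sqrt t x_j)/(1 - sqrt t x_j). *)
Theorem theorem1p4 (n D : nat) :
  \sum_(mu <- partitions_upto D) \sum_(nu <- partitions_upto D | (sumn mu + sumn nu <= D)%N)
      cst n (coef mu nu) * HL n (punion mu nu)
  = tofrac (mtrunc D
      ((\prod_(j < n) \prod_(k < n | (j < k)%N)
          ((1 - tt *: ('X_j * 'X_k)) * geom D ('X_j * 'X_k)))
       * \prod_(j < n) ((1 + sq *: 'X_j) * geom D (sq *: 'X_j)))).
Proof.
under eq_bigr => mu _ do under eq_bigr => nu _ do rewrite HL_hl.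
rewrite -sum_coef_lhs_poly -mmap_tofrac -sum_coef_graded_eval graded_eval_product.
apply: eq_bigr => i _; have hi := ltn_ord i.
(* The base field is that of rational functions in the actual variables, and u is adjoined to it in
   a further fraction field. *)
apply: (@coef_lhs_rhs _ _ _ _ (two_Fx_neq0 n) (@xv_inj n) (@xv_neq0 n) (@xv_sub_neq0 n)
  (@cst_tt_generic n) _ (@FracField.tofrac {poly Fx n})) => //.
by move=> p q /eqP; rewrite tofrac_eq => /eqP.
Qed.
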